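(* Let $N$ be the Nevanlinna class of the open unit disc $D(0,1)\subset\mathbb{C}$ and let $C$ be the Cesàro operator acting on holomorphic functions on $D(0,1)$. Then there exists a function $g\in N$ such that $C(g)\notin N$.
   Context: Let $D(0,1)=\{z\in\mathbb{C}:|z|<1\}$. For $x\ge 0$ define $\log^{+}x=\log x$ if $x\ge 1$ and $\log^{+}x=0$ if $0\le x<1$. The Nevanlinna class $N$ is the set of all holomorphic functions $f:D(0,1)\to\mathbb{C}$ such that $$\sup_{r\in(0,1)}\int_{0}^{2\pi}\log^{+}\left|f\left(re^{i\theta}\right)\right|\,d\theta<\infty.$$ The Cesàro operator $C$ is defined on holomorphic functions $f(z)=\sum_{n=0}^{\infty}a_nz^n$ on $D(0,1)$ by $$C(f)(z)=\sum_{n=0}^{\infty}\left(\frac{1}{n+1}\sum_{k=0}^{n}a_k\right)z^n ,\qquad z\in D(0,1).$$ Equivalently, $C(f)(z)=\frac{1}{z}\int_{[0,z]}\frac{f(\zeta)}{1-\zeta}\,d\zeta$ for $z\in D(0,1)\setminus\{0\}$, where $[0,z]$ is the line segment from $0$ to $z$ (and the value at $z=0$ is given by removing the singularity). *)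

(* Defs.v *)
From Stdlib Require Export Reals.
From Stdlib Require Import ClassicalEpsilon.
From Coquelicot Require Export Coquelicot.
Open Scope R_scope.

(* Functions on the open unit disc are represented by total functions C -> C
   whose values outside the disc are irrelevant. *)
Definition in_disc (z : C) : Prop := Cmod z < 1.

Definition holomorphic_on_disc (f : C -> C) : Prop :=
  forall z : C, in_disc z -> @ex_derive C_AbsRing C_NormedModule f z.

Definition log_plus (x : R) : R := if Rle_dec 1 x then ln x else 0.

(* The point r e^{i theta}. *)
Definition polar (r theta : R) : C := (r * cos theta, r * sin theta).

(* For holomorphic f and 0 < r < 1 the integrand is continuous in theta, so the
   total operator RInt is the genuine Riemann integral.  Boundedness of the set
   of these integrals is finiteness of their supremum. *)
Definition Nevanlinna (f : C -> C) : Prop :=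
  holomorphic_on_disc f /\
  bound (fun I : R => exists r : R, 0 < r < 1 /\
           I = RInt (fun theta => log_plus (Cmod (f (polar r theta)))) 0 (2 * PI)).

Definition has_power_series (a : nat -> C) (f : C -> C) : Prop :=
  forall z : C, in_disc z ->
    @is_pseries C_AbsRing C_NormedModule a z (f z).

(* The (necessarily unique) sequence a with f(z) = sum_n a_n z^n on the disc;
   such a sequence exists when f is holomorphic on the disc, and the value is
   unspecified when there is none. *)
Definition power_series_coef (f : C -> C) : nat -> C :=
  epsilon (inhabits (fun _ : nat => RtoC 0)) (fun a => has_power_series a f).

(* [sum_n a n] has the n + 1 terms a_0, ..., a_n. *)
Definition cesaro_mean (a : nat -> C) (n : nat) : C :=
  (RtoC (/ INR (S n)) * sum_n a n)%C.

(* [iota] selects the sum of the (convergent) power series. *)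
Definition cesaro (f : C -> C) (z : C) : C :=
  @iota C_CompleteNormedModule
    (fun s : C => @is_pseries C_AbsRing C_NormedModule
                    (cesaro_mean (power_series_coef f)) z s).

(* Main.v *)
Require Import Defs.
From Stdlib Require Import Lra Lia Psatz ClassicalEpsilon Factorial.

(* If [H] is a primitive of [G] vanishing at 0 and [g = (1 - z) G], then [z * cesaro g = H], so it
   suffices to find [G] for which [(1 - z) G] is in N and [H] is not.

   In the half-plane coordinate [w = (1 + z) / (1 - z)] put
   [f_k = exp (w + s_k^2 / (w - i y_k))].  Then [log |f_k|] is the Poisson integral of the measure with
   an atom at infinity and an atom of mass about [(s_k / y_k)^2 = 1 / (k + 2)^2] at [i y_k].  All the
   [f_k] are thus dominated by the Poisson integral of one finite measure, and so is a weighted sum of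
   them.  On the circle of radius [s_k] about [i y_k] one has
   [w + s_k^2 / (w - i y_k) = i y_k + 2 s_k cos phi]: the phase is constant, nothing cancels, and a
   suitably weighted primitive of [f_k] jumps by at least about [exp s_k] across [i y_k].  As the [y_k]
   grow geometrically, this term dominates [H] on the arc where [Im w] is between [2 y_k] and [256 y_k].
   That arc has length about [1 / y_k], so it adds about [s_k / y_k = 1 / (k + 2)] to the integral of
   [log^+ |H|], and these contributions have a divergent sum. *)

(** * Series of complex numbers *)

(** On the circle of radius [s] about [iy] the number [s ^ 2 / (w - iy)] is the complex conjugate of
    [w - iy]. This is why the atom at infinity is there: it contributes [w] itself, and the two
    varying imaginary parts cancel. The atom at [iy] alone would leave the phase [- s sin phi],
    whose oscillation destroys the jump. An atom is cheap because its mass, seen from the origin, is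
    quadratic in the radius, while the jump that it causes does not fade with the distance from the
    atom. Since [cesaro] is defined through coefficients, every function is built together with a
    power series whose absolute sums are controlled, and primitives come from termwise integration.
    Contour integrals then become increments of such a primitive, estimated along a path by the real
    mean value theorem. *)

Lemma is_series_Cmod (u : nat -> C) (l : C) :
  @is_series C_AbsRing C_NormedModule u l <->
  (forall eps : R, 0 < eps -> exists N, forall n, (N <= n)%nat ->
     Cmod (sum_n u n - l)%C < eps).
Proof.
split.
- intros H eps Heps.
  assert (H1 := proj1 (filterlim_locally_ball_norm
     (F := eventually) (sum_n u : nat -> C_NormedModule) l) H (mkposreal eps Heps)).
  exact H1.
- intros H.
  apply (proj2 (filterlim_locally_ball_norm
     (F := eventually) (sum_n u : nat -> C_NormedModule) l)).
  intros eps. apply (H eps (cond_pos eps)).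
Qed.

Lemma is_derive_Cmod (f : C -> C) (z l : C) :
  @is_derive C_AbsRing C_NormedModule f z l <->
  (forall eps : R, 0 < eps -> exists del, 0 < del /\ forall u,
     Cmod (u - z)%C < del ->
     Cmod (f u - f z - (u - z) * l)%C <= eps * Cmod (u - z)%C).
Proof.
split.
- intros [_ H] eps Heps.
  destruct (H z (fun P hP => hP) (mkposreal eps Heps)) as [del Hd].
  exists del. split. apply cond_pos.
  intros u Hu. exact (Hd u Hu).
- intros H. split.
  + apply (is_linear_scal_l (l : C_NormedModule)).
  + intros x Hx eps.
    assert (E : z = x) by exact (@is_filter_lim_locally_unique _ (AbsRing_NormedModule C_AbsRing) z x Hx).
    subst x.
    destruct (H eps (cond_pos eps)) as [del [H0 H1]].
    exists (mkposreal del H0). intros u Hu. exact (H1 u Hu).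
Qed.

(* The generic sums of Coquelicot leave equations typed in a canonical structure, which [ring] does not recognize. *)
Ltac ring_R := cbv beta; match goal with |- ?x = ?y => change (x = y :> R) end; ring.
Ltac ring_C := cbv beta; match goal with |- ?x = ?y => change (x = y :> C) end; ring.

Lemma sum_n_SC (u : nat -> C) n : sum_n u (S n) = (sum_n u n + u (S n))%C.
Proof. exact (sum_Sn u n). Qed.

Lemma sum_n_SR (u : nat -> R) n : sum_n u (S n) = sum_n u n + u (S n).
Proof. exact (sum_Sn u n). Qed.

Lemma sum_n_scal_R (c : R) (b : nat -> R) N : sum_n (fun n => c * b n) N = c * sum_n b N.
Proof.
induction N; [rewrite !sum_O; reflexivity|]. rewrite !sum_n_SR, IHN. ring_R.
Qed.

Lemma sum_n_scal_C (c : C) (b : nat -> C) N :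
  sum_n (fun n => c * b n)%C N = (c * sum_n b N)%C.
Proof.
induction N; [rewrite !sum_O; reflexivity|]. rewrite !sum_n_SC, IHN. ring_C.
Qed.

Lemma le_of_eps (a b : R) : (forall eps, 0 < eps -> a <= b + eps) -> a <= b.
Proof.
intros H. destruct (Rle_dec a b) as [h|h]; [exact h|].
specialize (H ((a - b) / 2)). lra.
Qed.

Lemma sum_n_ge0 (b : nat -> R) N : (forall n, 0 <= b n) -> 0 <= sum_n b N.
Proof.
intros H; induction N; [rewrite sum_O; apply H|].
rewrite sum_n_SR. specialize (H (S N)). lra.
Qed.

Lemma sum_n_mono (b : nat -> R) M N :
  (forall n, 0 <= b n) -> (M <= N)%nat -> sum_n b M <= sum_n b N.
Proof.
intros H HMN; induction HMN; [lra|]. rewrite sum_n_SR. specialize (H (S m)). lra.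
Qed.

Lemma sum_n_le_R (a b : nat -> R) N :
  (forall n, (n <= N)%nat -> a n <= b n) -> sum_n a N <= sum_n b N.
Proof.
intros H; induction N; [rewrite !sum_O; apply H; lia|].
rewrite !sum_n_SR. assert (h := H (S N) (le_n _)).
assert (sum_n a N <= sum_n b N) by (apply IHN; intros; apply H; lia). lra.
Qed.

Lemma is_series_R_eps (b : nat -> R) (T : R) :
  is_series b T -> forall eps, 0 < eps -> exists N, forall n, (N <= n)%nat ->
     Rabs (sum_n b n - T) < eps.
Proof.
intros H eps Heps.
exact (proj1 (filterlim_locally (F := eventually) (sum_n b) T) H (mkposreal eps Heps)).
Qed.

Lemma sum_n_le_series (b : nat -> R) (T : R) N :
  (forall n, 0 <= b n) -> is_series b T -> sum_n b N <= T.
Proof.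
intros Hb H. apply le_of_eps; intros eps Heps.
destruct (is_series_R_eps b T H eps Heps) as [N0 HN].
specialize (HN (max N N0) ltac:(lia)).
assert (h := sum_n_mono b N (max N N0) Hb ltac:(lia)).
apply Rabs_def2 in HN. lra.
Qed.

Lemma series_le_of_partial (b : nat -> R) (T B : R) :
  is_series b T -> (forall N, sum_n b N <= B) -> T <= B.
Proof.
intros H HB. apply le_of_eps; intros eps Heps.
destruct (is_series_R_eps b T H eps Heps) as [N0 HN].
specialize (HN N0 ltac:(lia)). specialize (HB N0).
apply Rabs_def2 in HN. lra.
Qed.

Lemma ex_series_bounded (b : nat -> R) (B : R) :
  (forall n, 0 <= b n) -> (forall N, sum_n b N <= B) -> ex_series b.
Proof.
intros Hb HB.
assert (H : ex_finite_lim_seq (sum_n b)).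
{ apply (ex_finite_lim_seq_incr _ B); [|exact HB].
  intros n; rewrite sum_n_SR. specialize (Hb (S n)). lra. }
destruct H as [l Hl]. exists l. exact Hl.
Qed.

Lemma is_series_scal_R (c : R) (b : nat -> R) (T : R) :
  is_series b T -> is_series (fun n => c * b n) (c * T).
Proof. apply (@is_series_scal R_AbsRing R_NormedModule). Qed.

Lemma Cmod_sum_n_diff (u : nat -> C) (b : nat -> R) M N :
  (forall n, Cmod (u n) <= b n) -> (M <= N)%nat ->
  Cmod (sum_n u N - sum_n u M)%C <= sum_n b N - sum_n b M.
Proof.
intros H HMN; induction HMN.
- replace (sum_n u M - sum_n u M)%C with (RtoC 0) by ring. rewrite Cmod_0. lra.
- rewrite sum_n_SC, sum_n_SR.
  replace (sum_n u m + u (S m) - sum_n u M)%C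
    with ((sum_n u m - sum_n u M) + u (S m))%C by ring.
  eapply Rle_trans; [apply Cmod_triangle|]. specialize (H (S m)). lra.
Qed.

Lemma Cmod_sum_n_le (u : nat -> C) (b : nat -> R) N :
  (forall n, (n <= N)%nat -> Cmod (u n) <= b n) -> Cmod (sum_n u N) <= sum_n b N.
Proof.
intros H; induction N; [rewrite !sum_O; apply H; lia|].
rewrite sum_n_SC, sum_n_SR. eapply Rle_trans; [apply Cmod_triangle|].
assert (h := H (S N) (le_n _)).
assert (Cmod (sum_n u N) <= sum_n b N) by (apply IHN; intros; apply H; lia). lra.
Qed.

Notation is_Cseries := (@is_series C_AbsRing C_NormedModule).

Lemma is_Cseries_ext (u v : nat -> C) (l : C) :
  (forall n, u n = v n) -> is_Cseries u l -> is_Cseries v l.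
Proof. intros H. apply is_series_ext. exact H. Qed.

Lemma is_Cseries_unique (u : nat -> C) (l l' : C) :
  is_Cseries u l -> is_Cseries u l' -> l = l'.
Proof.
intros H H'.
exact (@filterlim_locally_unique nat C_AbsRing C_NormedModule eventually _ _ l l' H H').
Qed.

Lemma is_Cseries_plus (u v : nat -> C) (l l' : C) :
  is_Cseries u l -> is_Cseries v l' -> is_Cseries (fun n => u n + v n)%C (l + l')%C.
Proof. apply (@is_series_plus C_AbsRing C_NormedModule). Qed.

Lemma is_Cseries_scal (c : C) (u : nat -> C) (l : C) :
  is_Cseries u l -> is_Cseries (fun n => c * u n)%C (c * l)%C.
Proof. apply (@is_series_scal C_AbsRing C_NormedModule). Qed.

Lemma ex_Cseries (u : nat -> C) (b : nat -> R) (B : R) :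
  (forall n, Cmod (u n) <= b n) -> (forall N, sum_n b N <= B) ->
  exists l, is_Cseries u l.
Proof.
intros H HB.
assert (Hb : forall n, 0 <= b n)
  by (intros n; eapply Rle_trans; [apply Cmod_ge_0|apply H]).
destruct (ex_series_bounded b B Hb HB) as [T HT].
assert (E : @ex_series C_AbsRing C_CompleteNormedModule u).
{ apply (@ex_series_le C_AbsRing C_CompleteNormedModule u b); [exact H|].
  exists T; exact HT. }
destruct E as [l Hl]. exists l. exact Hl.
Qed.

Lemma Cmod_Cseries_le (u : nat -> C) (l : C) (B : R) :
  is_Cseries u l -> (forall N, Cmod (sum_n u N) <= B) -> Cmod l <= B.
Proof.
intros H HB. apply le_of_eps; intros eps Heps.
destruct (proj1 (is_series_Cmod u l) H eps Heps) as [N HN].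
specialize (HN N (le_n _)). specialize (HB N).
replace l with (sum_n u N - (sum_n u N - l))%C by ring.
eapply Rle_trans; [apply Cmod_triangle|]. rewrite Cmod_opp. lra.
Qed.

Lemma Cseries_tail (u : nat -> C) (l : C) (b : nat -> R) (T : R) M :
  is_Cseries u l -> (forall n, Cmod (u n) <= b n) -> is_series b T ->
  Cmod (l - sum_n u M)%C <= T - sum_n b M.
Proof.
intros Hu Hub Hb.
assert (Hb0 : forall n, 0 <= b n)
  by (intros n; eapply Rle_trans; [apply Cmod_ge_0|apply Hub]).
apply le_of_eps; intros eps Heps.
destruct (proj1 (is_series_Cmod u l) Hu eps Heps) as [N0 HN].
specialize (HN (max M N0) ltac:(lia)).
assert (h := Cmod_sum_n_diff u b M (max M N0) Hub ltac:(lia)).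
assert (h' := sum_n_le_series b T (max M N0) Hb0 Hb).
replace (l - sum_n u M)%C with
  (- (sum_n u (max M N0) - l) + (sum_n u (max M N0) - sum_n u M))%C by ring.
eapply Rle_trans; [apply Cmod_triangle|]. rewrite Cmod_opp. lra.
Qed.

Lemma is_Cseries_sum_n (c : nat -> nat -> C) (f : nat -> C) M :
  (forall m, is_Cseries (c m) (f m)) ->
  is_Cseries (fun n => sum_n (fun m => c m n) M) (sum_n f M).
Proof.
intros H; induction M.
- rewrite sum_O. eapply is_Cseries_ext; [|apply (H O)].
  intros n. rewrite sum_O. reflexivity.
- rewrite sum_n_SC. eapply is_Cseries_ext; [|apply (is_Cseries_plus _ _ _ _ IHM (H (S M)))].
  intros n. rewrite sum_n_SC. reflexivity.
Qed.

(** * Interchange of summation in absolutely convergent double series *)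

Section DoubleSeries.
Variables (c : nat -> nat -> C) (B : nat -> R) (T : R).
Hypothesis (HcB : forall m N, sum_n (fun n => Cmod (c m n)) N <= B m).
Hypothesis (HB : is_series B T).

Lemma double_series_term m n : Cmod (c m n) <= B m.
Proof.
eapply Rle_trans; [|apply (HcB m n)].
destruct n; [rewrite sum_O; lra|]. rewrite sum_n_SR.
assert (h := sum_n_ge0 (fun n => Cmod (c m n)) n (fun n => Cmod_ge_0 _)). lra.
Qed.

Lemma double_series_bound0 m : 0 <= B m.
Proof. eapply Rle_trans; [apply Cmod_ge_0|apply (double_series_term m O)]. Qed.

(** Discarding the rows beyond [M] costs at most the tail of [B], both for the sum of the row sums
    and, uniformly in [n], for the first columns. The finitely many remaining rows can be switched
    freely. *)
Lemma double_series_switch (f d : nat -> C) (S : C) :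
  (forall m, is_Cseries (c m) (f m)) -> (forall n, is_Cseries (fun m => c m n) (d n)) ->
  is_Cseries f S -> is_Cseries d S.
Proof.
intros Hf Hd HS. apply is_series_Cmod; intros eps Heps.
destruct (is_series_R_eps B T HB (eps / 4) ltac:(lra)) as [M HM].
specialize (HM M (le_n _)). apply Rabs_def2 in HM.
destruct (proj1 (is_series_Cmod _ _) (is_Cseries_sum_n c f M Hf) (eps / 4) ltac:(lra))
  as [N HN].
exists N; intros n Hn. specialize (HN n Hn).
assert (h1 : Cmod (S - sum_n f M)%C <= T - sum_n B M).
{ apply Cseries_tail; [exact HS| |exact HB].
  intros m. apply (Cmod_Cseries_le (c m) _ _ (Hf m)).
  intros K. eapply Rle_trans; [|apply (HcB m K)].
  apply Cmod_sum_n_le; intros; lra. }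
assert (h2 : Cmod (sum_n d n - sum_n (fun m => sum_n (c m) n) M)%C <= T - sum_n B M).
{ apply Cseries_tail; [| |exact HB].
  - apply (is_Cseries_ext (fun m => sum_n (fun k => c m k) n)); [reflexivity|].
    apply (is_Cseries_sum_n (fun k m => c m k) d n Hd).
  - intros m. eapply Rle_trans; [|apply (HcB m n)].
    apply Cmod_sum_n_le; intros; lra. }
rewrite (sum_n_switch c M n) in h2.
replace (sum_n d n - S)%C with
 ((sum_n d n - sum_n (fun j => sum_n (fun i => c i j) M) n)
  + ((sum_n (fun j => sum_n (fun i => c i j) M) n - sum_n f M)
  + - (S - sum_n f M)))%C by ring.
eapply Rle_lt_trans; [apply Cmod_triangle|].
assert (h3 := Cmod_triangle (sum_n (fun j => sum_n (fun i => c i j) M) n - sum_n f M)%C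
   (- (S - sum_n f M))%C).
rewrite Cmod_opp in h3. lra.
Qed.

Lemma double_series_abs (d : nat -> C) N :
  (forall n, is_Cseries (fun m => c m n) (d n)) ->
  sum_n (fun n => Cmod (d n)) N <= T.
Proof.
intros Hd. apply le_of_eps; intros eps Heps.
(* Finitely many column limits are replaced by sums over one common number of rows; what remains is
   a finite double sum. *)
assert (H : forall eps, 0 < eps -> exists M0, forall M, (M0 <= M)%nat ->
   sum_n (fun n => Cmod (d n)) N <= sum_n (fun n => Cmod (sum_n (fun m => c m n) M)) N + eps).
{ clear eps Heps. induction N; intros eps Heps.
  - destruct (proj1 (is_series_Cmod _ _) (Hd O) eps Heps) as [M0 HM0].
    exists M0; intros M HM. specialize (HM0 M HM). rewrite !sum_O.
    replace (d O) with (sum_n (fun m => c m O) M - (sum_n (fun m => c m O) M - d O))%C by ring.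
    eapply Rle_trans; [apply Cmod_triangle|]. rewrite Cmod_opp. lra.
  - destruct (IHN (eps / 2) ltac:(lra)) as [M1 HM1].
    destruct (proj1 (is_series_Cmod _ _) (Hd (Datatypes.S N)) (eps / 2) ltac:(lra)) as [M0 HM0].
    exists (max M0 M1); intros M HM. specialize (HM0 M ltac:(lia)). specialize (HM1 M ltac:(lia)).
    rewrite !sum_n_SR.
    set (p := sum_n (fun m => c m (Datatypes.S N)) M) in *.
    assert (h : Cmod (d (Datatypes.S N)) <= Cmod p + Cmod (p - d (Datatypes.S N))%C).
    { replace (d (Datatypes.S N)) with (p - (p - d (Datatypes.S N)))%C at 1 by ring.
      eapply Rle_trans; [apply Cmod_triangle|]. rewrite Cmod_opp. lra. }
    lra. }
destruct (H eps Heps) as [M0 HM]. specialize (HM M0 (le_n _)).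
eapply Rle_trans; [exact HM|]. apply Rplus_le_compat_r.
apply Rle_trans with (sum_n (fun n => sum_n (fun m => Cmod (c m n)) M0) N).
{ apply sum_n_le_R; intros n _. apply Cmod_sum_n_le; intros; lra. }
rewrite (sum_n_switch (fun n m => Cmod (c m n)) N M0).
apply Rle_trans with (sum_n B M0).
{ apply sum_n_le_R; intros m _. apply HcB. }
apply sum_n_le_series; [apply double_series_bound0|exact HB].
Qed.
End DoubleSeries.

Lemma is_Cseries_cons (u : nat -> C) (l : C) :
  is_Cseries (fun n => u (S n)) l -> is_Cseries u (u O + l)%C.
Proof.
intros H. apply (@is_series_decr_1 C_AbsRing C_NormedModule).
change (is_Cseries (fun n => u (S n)) (u O + l + - u O)%C).
replace (u O + l + - u O)%C with l by ring. exact H.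
Qed.

Lemma Cseries_terms_bounded (u : nat -> C) (l : C) :
  is_Cseries u l -> exists M, forall n, Cmod (u n) <= M.
Proof.
intros H. destruct (proj1 (is_series_Cmod u l) H 1 ltac:(lra)) as [N HN].
assert (Hfin : forall K, exists M, 2 <= M /\ forall n, (n <= K)%nat -> Cmod (u n) <= M).
{ induction K as [|K [M [hM IH]]].
  - exists (Rmax 2 (Cmod (u O))). split; [apply Rmax_l|].
    intros n Hn. replace n with O by lia. apply Rmax_r.
  - exists (Rmax M (Cmod (u (S K)))). split; [eapply Rle_trans; [exact hM|apply Rmax_l]|].
    intros n Hn. destruct (Nat.eq_dec n (S K)) as [->|hn]; [apply Rmax_r|].
    eapply Rle_trans; [apply IH; lia|apply Rmax_l]. }
destruct (Hfin N) as [M [hM HM]]. exists M; intros n.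
destruct (Nat.le_gt_cases n N) as [h|h]; [apply HM; lia|].
destruct n; [lia|].
assert (h1 := HN n ltac:(lia)). assert (h2 := HN (S n) ltac:(lia)).
replace (u (S n)) with ((sum_n u (S n) - l) + - (sum_n u n - l))%C
  by (rewrite sum_n_SC; ring).
eapply Rle_trans; [apply Cmod_triangle|]. rewrite Cmod_opp. lra.
Qed.

(** * Termwise differentiation of complex power series *)

Section TermwiseDerivative.
Variables (a : nat -> C) (f : C -> C) (R0 : R).
Hypothesis Hf : forall z, Cmod z < R0 -> is_Cseries (fun n => a n * z ^ n)%C (f z).

Let alpha (n : nat) := Cmod (a n).

(** Passing to the real power series of the moduli gives access to [CV_radius_derive]: the series
    differentiated once or twice is absolutely summable inside the same disc. *)
Lemma CV_radius_Cmod r : 0 <= r < R0 -> Rbar_le (Finite r) (CV_radius alpha).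
Proof.
intros [h0 h1].
assert (Hr : Cmod (RtoC r) < R0) by (rewrite Cmod_R, Rabs_pos_eq; lra).
destruct (Cseries_terms_bounded _ _ (Hf _ Hr)) as [M HM].
apply CV_radius_bounded. exists M. intros n. specialize (HM n).
rewrite Cmod_mult, Cmod_pow, Cmod_R, (Rabs_pos_eq r) in HM by lra.
unfold alpha. rewrite Rabs_mult, (Rabs_pos_eq (Cmod _)), (Rabs_pos_eq (r ^ n));
 [exact HM| |apply Cmod_ge_0]. apply pow_le; lra.
Qed.

Lemma alpha_lt r : 0 <= r < R0 -> Rbar_lt (Finite (Rabs r)) (CV_radius alpha).
Proof.
intros Hr. rewrite Rabs_pos_eq by lra.
eapply Rbar_lt_le_trans; [|apply (CV_radius_Cmod ((r + R0) / 2)); lra].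
simpl; lra.
Qed.

Lemma ex_series_Cmod r : 0 <= r < R0 -> ex_series (fun n => Cmod (a n) * r ^ n).
Proof.
intros Hr. eapply ex_series_ext; [|apply (CV_disk_inside _ _ (alpha_lt r Hr))].
intros n. unfold alpha. apply Rabs_pos_eq.
apply Rmult_le_pos; [apply Cmod_ge_0|apply pow_le; lra].
Qed.

Lemma ex_series_Cmod_derive r : 0 <= r < R0 ->
  ex_series (fun n => INR (S n) * Cmod (a (S n)) * r ^ n).
Proof.
intros Hr.
assert (H := alpha_lt r Hr). rewrite <- CV_radius_derive in H.
eapply ex_series_ext; [|apply (CV_disk_inside _ _ H)].
intros n. unfold PS_derive, alpha. apply Rabs_pos_eq.
apply Rmult_le_pos; [|apply pow_le; lra].
apply Rmult_le_pos; [apply pos_INR|apply Cmod_ge_0].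
Qed.

Lemma ex_series_Cmod_derive2 r : 0 <= r < R0 ->
  ex_series (fun n => INR (S n) * (INR (S (S n)) * Cmod (a (S (S n)))) * r ^ n).
Proof.
intros Hr.
assert (H := alpha_lt r Hr). rewrite <- CV_radius_derive, <- CV_radius_derive in H.
eapply ex_series_ext; [|apply (CV_disk_inside _ _ H)].
intros n. unfold PS_derive, alpha. apply Rabs_pos_eq.
apply Rmult_le_pos; [|apply pow_le; lra].
apply Rmult_le_pos; [apply pos_INR|].
apply Rmult_le_pos; [apply pos_INR|apply Cmod_ge_0].
Qed.

(** The bound [n (n - 1) rho ^ (n - 2)] for the second derivative of [z ^ n]; it is twice the Taylor
    constant, which keeps the induction below simple. *)
Let kappa (rho : R) (n : nat) : R :=
  match n with S (S m) => INR (S m) * INR (S (S m)) * rho ^ m | _ => 0 end.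

Let Dpow (z : C) (n : nat) : C := match n with O => 0%C | S m => (INR n * z ^ m)%C end.

Lemma Cpow_second_order (z u : C) rho n : Cmod z <= rho -> Cmod u <= rho ->
  Cmod (u ^ n - z ^ n - (u - z) * Dpow z n)%C <= kappa rho n * Cmod (u - z)%C ^ 2.
Proof.
intros Hz Hu. assert (Hrho : 0 <= rho) by (eapply Rle_trans; [apply Cmod_ge_0|exact Hz]).
induction n as [|n IH].
- simpl. replace (1 - 1 - (u - z) * 0)%C with (RtoC 0) by ring. rewrite Cmod_0. lra.
- destruct n as [|n].
  + simpl. replace (u * 1 - z * 1 - (u - z) * (1 * 1))%C with (RtoC 0) by ring.
    rewrite Cmod_0. lra.
  + replace (u ^ S (S n) - z ^ S (S n) - (u - z) * Dpow z (S (S n)))%C with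
      (u * (u ^ S n - z ^ S n - (u - z) * Dpow z (S n))
       + INR (S n) * z ^ n * ((u - z) * (u - z)))%C.
    2:{ unfold Dpow. rewrite (S_INR (S n)), RtoC_plus, !Cpow_S. ring. }
    eapply Rle_trans; [apply Cmod_triangle|].
    rewrite !Cmod_mult, Cmod_pow, Cmod_R, Rabs_pos_eq by apply pos_INR.
    assert (h1 : Cmod z ^ n <= rho ^ n) by (apply pow_incr; split; [apply Cmod_ge_0|exact Hz]).
    assert (h0 : 0 <= Cmod z ^ n) by (apply pow_le, Cmod_ge_0).
    assert (hn := pos_INR n).
    set (q := Cmod (u - z)%C) in *. assert (hq : 0 <= q) by apply Cmod_ge_0.
    assert (hk : rho * kappa rho (S n) + INR (S n) * rho ^ n <= kappa rho (S (S n))).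
    { unfold kappa. rewrite !S_INR. destruct n as [|n]; simpl pow.
      - simpl INR. lra.
      - assert (hp : 0 <= rho * rho ^ n) by (apply Rmult_le_pos; [lra|apply pow_le; lra]).
        assert (hn' := pos_INR n). rewrite !S_INR.
        assert (h : 0 <= (INR n + 2) * (rho * rho ^ n)) by (apply Rmult_le_pos; lra).
        lra. }
    assert (hs := Cmod_ge_0 u).
    assert (h2 : Cmod u * Cmod (u ^ S n - z ^ S n - (u - z) * Dpow z (S n))%C
       <= rho * (kappa rho (S n) * q ^ 2)).
    { apply Rmult_le_compat; [lra|apply Cmod_ge_0|exact Hu|exact IH]. }
    assert (h3 : INR (S n) * Cmod z ^ n * (q * q) <= INR (S n) * rho ^ n * (q * q)).
    { apply Rmult_le_compat_r; [nra|]. apply Rmult_le_compat_l; [apply pos_INR|exact h1]. }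
    assert (h4 := Rmult_le_compat_r (q ^ 2) _ _ ltac:(nra) hk). nra.
Qed.

(** The second-order remainders of the terms, on a disc of radius [rho] strictly between [Cmod z]
    and [R0], add up to at most [T * Cmod (u - z) ^ 2] with [T] the sum of the second-derivative
    series. *)
Lemma is_derive_Cpseries z : Cmod z < R0 ->
  exists l, is_Cseries (fun n => INR (S n) * a (S n) * z ^ n)%C l /\
            @is_derive C_AbsRing C_NormedModule f z l.
Proof.
intros Hz. assert (Hz0 := Cmod_ge_0 z).
set (rho := (Cmod z + R0) / 2).
assert (Hrho : 0 <= rho < R0) by (unfold rho; lra).
assert (El : exists l, is_Cseries (fun n => INR (S n) * a (S n) * z ^ n)%C l).
{ destruct (ex_series_Cmod_derive (Cmod z) ltac:(lra)) as [T HT].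
  apply (ex_Cseries _ (fun n => INR (S n) * Cmod (a (S n)) * Cmod z ^ n) T).
  - intros n. rewrite !Cmod_mult, Cmod_pow, Cmod_R, Rabs_pos_eq by apply pos_INR. lra.
  - intros N. apply sum_n_le_series; [|exact HT]. intros n.
    apply Rmult_le_pos; [|apply pow_le; lra].
    apply Rmult_le_pos; [apply pos_INR|apply Cmod_ge_0]. }
destruct El as [l Hl]. exists l. split; [exact Hl|].
assert (Hl' : is_Cseries (fun n => a n * Dpow z n)%C l).
{ replace l with (a O * Dpow z O + l)%C by (simpl; ring).
  apply (is_Cseries_cons (fun n => a n * Dpow z n)%C).
  eapply is_Cseries_ext; [|exact Hl]. intros n. unfold Dpow. ring. }
destruct (ex_series_Cmod_derive2 rho Hrho) as [T HT].
set (beta := fun n => Cmod (a n) * kappa rho n).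
assert (Hbeta : forall N, sum_n beta N <= T).
{ assert (Hb0 : forall n, 0 <= beta n).
  { intros n. unfold beta. apply Rmult_le_pos; [apply Cmod_ge_0|].
    unfold kappa. destruct n as [|[|n]]; [lra|lra|].
    apply Rmult_le_pos; [|apply pow_le; lra]. apply Rmult_le_pos; apply pos_INR. }
  assert (HS : is_series beta T).
  { apply is_series_decr_1, is_series_decr_1.
    change (is_series (fun n => beta (S (S n))) (T + - beta 0%nat + - beta 1%nat)).
    assert (E : T + - beta 0%nat + - beta 1%nat = T) by (unfold beta, kappa; ring).
    rewrite E.
    eapply is_series_ext; [|exact HT]. intros n. unfold beta, kappa.
    ring_R. }
  intros N. apply sum_n_le_series; assumption. }
assert (HT0 : 0 <= T) by (specialize (Hbeta O); rewrite sum_O in Hbeta; unfold beta, kappa in Hbeta; lra).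
apply is_derive_Cmod. intros eps Heps.
exists (Rmin (rho - Cmod z) (eps / (T + 1))). split.
{ apply Rmin_pos; [unfold rho; lra|apply Rdiv_lt_0_compat; lra]. }
intros u Hu.
assert (Hu1 := Rlt_le_trans _ _ _ Hu (Rmin_l _ _)).
assert (Hu2 := Rlt_le_trans _ _ _ Hu (Rmin_r _ _)).
assert (Hurho : Cmod u <= rho).
{ replace u with (z + (u - z))%C by ring.
  eapply Rle_trans; [apply Cmod_triangle|]. lra. }
set (q := Cmod (u - z)%C) in *. assert (hq : 0 <= q) by apply Cmod_ge_0.
assert (HD : is_Cseries (fun n => a n * (u ^ n - z ^ n - (u - z) * Dpow z n))%C
   (f u - f z - (u - z) * l)%C).
{ replace (f u - f z - (u - z) * l)%C with (f u + ((-(1)) * f z + (- (u - z)) * l))%C by ring.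
  eapply is_Cseries_ext; [|apply is_Cseries_plus;
     [apply (Hf u); lra|apply is_Cseries_plus;
        [apply is_Cseries_scal, (Hf z Hz)|apply is_Cseries_scal, Hl']]].
  intros n. cbv beta. ring. }
apply Rle_trans with (T * q ^ 2).
- apply (Cmod_Cseries_le _ _ _ HD). intros N.
  apply Rle_trans with (sum_n (fun n => (q ^ 2) * beta n) N).
  + apply Cmod_sum_n_le. intros n _. rewrite Cmod_mult. unfold beta.
    assert (h := Cpow_second_order z u rho n ltac:(unfold rho; lra) Hurho).
    fold q in h. assert (h' := Rmult_le_compat_l _ _ _ (Cmod_ge_0 (a n)) h). lra.
  + rewrite sum_n_scal_R, (Rmult_comm T). apply Rmult_le_compat_l; [nra|apply Hbeta].
- assert (h : T * q <= eps).
  { apply Rle_trans with ((T + 1) * (eps / (T + 1))); [nra|]. right; field; lra. }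
  nra.
Qed.

End TermwiseDerivative.

(** * Increments along paths *)

Lemma is_derive_Rabs (p : R -> R) (t l : R) :
  is_derive p t l <->
  (forall eps : R, 0 < eps -> exists del, 0 < del /\ forall u,
     Rabs (u - t) < del -> Rabs (p u - p t - (u - t) * l) <= eps * Rabs (u - t)).
Proof.
split.
- intros [_ H] eps Heps.
  destruct (H t (fun P hP => hP) (mkposreal eps Heps)) as [del Hd].
  exists del. split; [apply cond_pos|]. intros u Hu. exact (Hd u Hu).
- intros H. split.
  + apply (is_linear_scal_l (l : R_NormedModule)).
  + intros x Hx eps.
    assert (E : t = x) by exact (@is_filter_lim_locally_unique _ R_NormedModule t x Hx).
    subst x. destruct (H eps (cond_pos eps)) as [del [H0 H1]].
    exists (mkposreal del H0). intros u Hu. exact (H1 u Hu).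
Qed.

Lemma Cmod_le_plus (z : C) : Cmod z <= Rabs (fst z) + Rabs (snd z).
Proof.
replace z with (RtoC (fst z) + Ci * RtoC (snd z))%C at 1.
- eapply Rle_trans; [apply Cmod_triangle|].
  rewrite Cmod_mult, !Cmod_R, Cmod_Ci. lra.
- destruct z as [x y]. unfold RtoC, Ci, Cplus, Cmult; simpl. f_equal; ring.
Qed.

(** The multiplier [e] turns a complex increment into a real function: [e = 1] gives the real part,
    [e = - Ci] the imaginary part, and a suitable unimodular [e] the modulus of the increment. *)
Lemma is_derive_along_path (f : C -> C) (gam : R -> C) (t : R) (l v e : C) :
  @is_derive C_AbsRing C_NormedModule f (gam t) l ->
  is_derive (fun s => Re (gam s)) t (Re v) -> is_derive (fun s => Im (gam s)) t (Im v) ->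
  is_derive (fun s => Re (e * f (gam s))%C) t (Re (e * (l * v))%C).
Proof.
intros Hf H1 H2.
assert (HE := Cmod_ge_0 e). assert (HL := Cmod_ge_0 l). assert (HV := Cmod_ge_0 v).
apply is_derive_Rabs; intros eps Heps.
set (eta := Rmin 1 (eps / (4 * (Cmod e + 1) * (Cmod l + 1)))).
assert (Heta : 0 < eta).
{ apply Rmin_pos; [lra|]. apply Rdiv_lt_0_compat; [lra|nra]. }
set (eta' := eps / (2 * (Cmod e + 1) * (Cmod v + 2))).
assert (Heta' : 0 < eta') by (apply Rdiv_lt_0_compat; [lra|nra]).
destruct (proj1 (is_derive_Rabs _ _ _) H1 eta Heta) as [d1 [D1 K1]].
destruct (proj1 (is_derive_Rabs _ _ _) H2 eta Heta) as [d2 [D2 K2]].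
destruct (proj1 (is_derive_Cmod _ _ _) Hf eta' Heta') as [d3 [D3 K3]].
exists (Rmin (Rmin d1 d2) (d3 / (Cmod v + 3))). split.
{ apply Rmin_pos; [apply Rmin_pos; assumption|apply Rdiv_lt_0_compat; lra]. }
intros u Hu.
assert (Hu1 : Rabs (u - t) < d1) by
  (eapply Rlt_le_trans; [exact Hu|]; eapply Rle_trans; [apply Rmin_l|apply Rmin_l]).
assert (Hu2 : Rabs (u - t) < d2) by
  (eapply Rlt_le_trans; [exact Hu|]; eapply Rle_trans; [apply Rmin_l|apply Rmin_r]).
assert (Hu3 := Rlt_le_trans _ _ _ Hu (Rmin_r _ _)).
specialize (K1 u Hu1). specialize (K2 u Hu2).
set (q := Rabs (u - t)) in *. assert (Hq : 0 <= q) by apply Rabs_pos.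
set (r := (gam u - gam t - RtoC (u - t) * v)%C).
assert (Hr : Cmod r <= 2 * eta * q).
{ eapply Rle_trans; [apply Cmod_le_plus|].
  replace (fst r) with (Re (gam u) - Re (gam t) - (u - t) * Re v)
    by (unfold r, Re; simpl; ring).
  replace (snd r) with (Im (gam u) - Im (gam t) - (u - t) * Im v)
    by (unfold r, Im; simpl; ring). lra. }
assert (Heta1 : eta <= 1) by apply Rmin_l.
assert (Hg : Cmod (gam u - gam t)%C <= (Cmod v + 2) * q).
{ replace (gam u - gam t)%C with (RtoC (u - t) * v + r)%C by (unfold r; ring).
  eapply Rle_trans; [apply Cmod_triangle|]. rewrite Cmod_mult, Cmod_R. fold q. nra. }
assert (Hd3 : Cmod (gam u - gam t)%C < d3).
{ eapply Rle_lt_trans; [exact Hg|].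
  destruct (Req_dec q 0) as [->|hq]; [lra|].
  apply Rlt_trans with ((Cmod v + 3) * q); [nra|].
  apply Rlt_le_trans with ((Cmod v + 3) * (d3 / (Cmod v + 3))); [nra|].
  right; field; lra. }
specialize (K3 _ Hd3).
set (X := (f (gam u) - f (gam t) - (gam u - gam t) * l)%C) in *.
replace (Re (e * f (gam u)) - Re (e * f (gam t)) - (u - t) * Re (e * (l * v)))
  with (Re (e * (X + r * l))%C)
  by (unfold X, r, Re; simpl; ring).
eapply Rle_trans; [apply re_le_Cmod|]. rewrite Cmod_mult.
assert (h : Cmod (X + r * l)%C <= eta' * ((Cmod v + 2) * q) + 2 * eta * q * Cmod l).
{ eapply Rle_trans; [apply Cmod_triangle|]. rewrite Cmod_mult.
  assert (eta' * Cmod (gam u - gam t)%C <= eta' * ((Cmod v + 2) * q))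
    by (apply Rmult_le_compat_l; lra).
  assert (Cmod r * Cmod l <= 2 * eta * q * Cmod l) by (apply Rmult_le_compat_r; lra). lra. }
assert (e1 : Cmod e * (eta' * ((Cmod v + 2) * q)) <= eps / 2 * q).
{ replace (eps / 2 * q) with ((Cmod e + 1) * (eta' * ((Cmod v + 2) * q)))
    by (unfold eta'; field; lra).
  apply Rmult_le_compat_r; [|lra].
  apply Rmult_le_pos; [lra|apply Rmult_le_pos; lra]. }
assert (e2 : Cmod e * (2 * eta * q * Cmod l) <= eps / 2 * q).
{ assert (Hm : eta <= eps / (4 * (Cmod e + 1) * (Cmod l + 1))) by apply Rmin_r.
  replace (eps / 2 * q) with
    ((Cmod e + 1) * (2 * (eps / (4 * (Cmod e + 1) * (Cmod l + 1))) * q * (Cmod l + 1)))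
    by (field; lra).
  assert (0 <= eta * q) by (apply Rmult_le_pos; lra).
  assert (eta * q <= eps / (4 * (Cmod e + 1) * (Cmod l + 1)) * q)
    by (apply Rmult_le_compat_r; lra).
  apply Rmult_le_compat; [lra| |lra|].
  - apply Rmult_le_pos; [nra|lra].
  - apply Rmult_le_compat; [nra|lra|nra|lra]. }
assert (h' := Rmult_le_compat_l _ _ _ HE h). lra.
Qed.

Lemma Cmod_le_of_Re (z : C) (M : R) :
  0 <= M -> (forall e : C, Cmod e <= 1 -> Re (e * z)%C <= M) -> Cmod z <= M.
Proof.
intros HM H. destruct (Req_dec (Cmod z) 0) as [h|h]; [lra|].
assert (hz := Cmod_ge_0 z).
specialize (H (/ RtoC (Cmod z) * Cconj z)%C).
assert (hne : RtoC (Cmod z) <> RtoC 0) by (intros E; apply h, RtoC_inj, E).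
rewrite Cmod_mult, Cmod_conj, (Cmod_inv _ hne), Cmod_R, Rabs_pos_eq in H by exact hz.
replace (Re (/ RtoC (Cmod z) * Cconj z * z)%C) with (Cmod z) in H.
- apply H. right; field; exact h.
- replace (/ RtoC (Cmod z) * Cconj z * z)%C with (/ RtoC (Cmod z) * (z * Cconj z))%C by ring.
  rewrite <- Cmod2_conj, RtoC_pow.
  replace (/ RtoC (Cmod z) * RtoC (Cmod z) ^ 2)%C with (RtoC (Cmod z)) by (field; exact hne).
  reflexivity.
Qed.

(** The mean value theorem fails for complex values, but it applies to the real part of [e * f]
    along the path for each fixed [e], and these real parts determine the modulus. *)
Lemma path_increment_le (f f' : C -> C) (gam dgam : R -> C) (a b M : R) :
  a <= b -> 0 <= M ->
  (forall t, a <= t <= b -> @is_derive C_AbsRing C_NormedModule f (gam t) (f' (gam t))) ->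
  (forall t, a <= t <= b -> is_derive (fun s => Re (gam s)) t (Re (dgam t)) /\
                            is_derive (fun s => Im (gam s)) t (Im (dgam t))) ->
  (forall t, a <= t <= b -> Cmod (f' (gam t) * dgam t)%C <= M) ->
  Cmod (f (gam b) - f (gam a))%C <= M * (b - a).
Proof.
intros Hab HM Hf Hg Hb.
apply Cmod_le_of_Re; [nra|]. intros e He.
destruct (MVT_gen (fun s => Re (e * f (gam s))%C) a b
   (fun s => Re (e * (f' (gam s) * dgam s))%C)) as [c [Hc E]].
- rewrite Rmin_left, Rmax_right by lra. intros t Ht.
  apply is_derive_along_path; [apply Hf|apply Hg|apply Hg]; lra.
- rewrite Rmin_left, Rmax_right by lra. intros t Ht.
  apply continuity_pt_filterlim, (@ex_derive_continuous R_AbsRing R_NormedModule).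
  eexists. apply is_derive_along_path; [apply Hf|apply Hg|apply Hg]; lra.
- rewrite Rmin_left, Rmax_right in Hc by lra.
  replace (Re (e * (f (gam b) - f (gam a)))%C)
    with (Re (e * f (gam b))%C - Re (e * f (gam a))%C) by (unfold Re; simpl; ring).
  rewrite E. apply Rmult_le_compat_r; [lra|].
  eapply Rle_trans; [apply Rle_abs|]. eapply Rle_trans; [apply re_le_Cmod|].
  rewrite Cmod_mult. specialize (Hb c Hc).
  assert (h := Cmod_ge_0 (f' (gam c) * dgam c)%C). assert (h' := Cmod_ge_0 e). nra.
Qed.

Lemma segment_increment_le (f f' : C -> C) (p q : C) (M : R) :
  0 <= M ->
  (forall t, 0 <= t <= 1 ->
     @is_derive C_AbsRing C_NormedModule f (p + RtoC t * (q - p))%C (f' (p + RtoC t * (q - p))%C)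
     /\ Cmod (f' (p + RtoC t * (q - p))%C) <= M) ->
  Cmod (f q - f p)%C <= M * Cmod (q - p)%C.
Proof.
intros HM H.
assert (h : Cmod (f (p + RtoC 1 * (q - p)) - f (p + RtoC 0 * (q - p)))%C
   <= M * Cmod (q - p)%C * (1 - 0)).
{ apply (path_increment_le f f' (fun t => p + RtoC t * (q - p))%C (fun _ => q - p)%C).
  - lra.
  - apply Rmult_le_pos; [exact HM|apply Cmod_ge_0].
  - intros t Ht. apply H; exact Ht.
  - intros t Ht. unfold Re, Im; split; simpl.
    + auto_derive; [exact I|]. ring.
    + auto_derive; [exact I|]. ring.
  - intros t Ht. rewrite Cmod_mult. apply Rmult_le_compat_r; [apply Cmod_ge_0|].
    apply H; exact Ht. }
replace (p + RtoC 1 * (q - p))%C with q in h by ring.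
replace (p + RtoC 0 * (q - p))%C with p in h by ring. lra.
Qed.

(** * The complex exponential *)

(** Through real functions the modulus and the addition formula are immediate; the power series,
    which carries analyticity, is the theorem [is_Cseries_cexp]. *)
Definition cexp (z : C) : C := (exp (Re z) * cos (Im z), exp (Re z) * sin (Im z)).

Lemma cexp_plus (z w : C) : cexp (z + w)%C = (cexp z * cexp w)%C.
Proof.
destruct z as [a b], w as [c d]. unfold cexp, Cmult; simpl.
rewrite exp_plus, cos_plus, sin_plus. f_equal; ring.
Qed.

Lemma Cmod_cexp (z : C) : Cmod (cexp z) = exp (Re z).
Proof.
unfold cexp, Cmod; simpl fst; simpl snd.
replace ((exp (Re z) * cos (Im z)) ^ 2 + (exp (Re z) * sin (Im z)) ^ 2)
  with ((exp (Re z)) ^ 2 * (Rsqr (sin (Im z)) + Rsqr (cos (Im z)))) by (unfold Rsqr; ring).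
rewrite sin2_cos2, Rmult_1_r. apply sqrt_pow2. left; apply exp_pos.
Qed.

Lemma sum_n_exp_le x N : 0 <= x -> sum_n (fun n => / INR (fact n) * x ^ n) N <= exp x.
Proof.
intros Hx. apply sum_n_le_series.
- intros n. apply Rmult_le_pos; [|apply pow_le; exact Hx].
  left. apply Rinv_0_lt_compat, INR_fact_lt_0.
- assert (H := is_exp_Reals x). unfold is_pseries in H.
  eapply is_series_ext; [|exact H]. intros n. rewrite pow_n_pow.
  change (x ^ n * / INR (fact n) = / INR (fact n) * x ^ n). ring.
Qed.

Lemma complex_exponential_ode (A B : R -> R) (a b : R) :
  (forall t, is_derive A t (a * A t - b * B t)) ->
  (forall t, is_derive B t (a * B t + b * A t)) ->
  A 0 = 1 -> B 0 = 0 -> A 1 = exp a * cos b /\ B 1 = exp a * sin b.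
Proof.
intros HA HB A0 B0.
(* This function and the one in [HQ] are the real and imaginary parts of
   [exp (- t (a + i b)) (A t + i B t)], which the equations make constant. *)
assert (HP : forall t, is_derive (fun t => exp (- (t * a)) * (A t * cos (t * b) + B t * sin (t * b))) t 0).
{ intros t. auto_derive.
  - split; [exists (a * A t - b * B t); exact (HA t)|].
    split; [exists (a * B t + b * A t); exact (HB t)|exact I].
  - change (Derive (fun x => A x) t) with (Derive A t).
    change (Derive (fun x => B x) t) with (Derive B t).
    rewrite (is_derive_unique _ _ _ (HA t)), (is_derive_unique _ _ _ (HB t)). ring. }
assert (HQ : forall t, is_derive (fun t => exp (- (t * a)) * (B t * cos (t * b) - A t * sin (t * b))) t 0).
{ intros t. auto_derive.
  - split; [exists (a * B t + b * A t); exact (HB t)|].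
    split; [exists (a * A t - b * B t); exact (HA t)|exact I].
  - change (Derive (fun x => A x) t) with (Derive A t).
    change (Derive (fun x => B x) t) with (Derive B t).
    rewrite (is_derive_unique _ _ _ (HA t)), (is_derive_unique _ _ _ (HB t)). ring. }
assert (Hconst : forall p : R -> R, (forall t, is_derive p t 0) -> p 1 = p 0).
{ intros p Hp. destruct (MVT_gen p 0 1 (fun _ => 0)) as [c [_ Hc]].
  - intros; apply Hp.
  - intros. apply continuity_pt_filterlim, (@ex_derive_continuous R_AbsRing R_NormedModule).
    eexists; apply Hp.
  - lra. }
assert (EP := Hconst _ HP). assert (EQ := Hconst _ HQ). cbv beta in EP, EQ.
rewrite !Rmult_0_l, !Rmult_1_l, Ropp_0, exp_0, cos_0, sin_0 in EP, EQ.
rewrite A0, B0 in EP, EQ.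
assert (Hexp : exp a * exp (- a) = 1) by (rewrite <- exp_plus, Rplus_opp_r; apply exp_0).
assert (Hsc := sin2_cos2 b). unfold Rsqr in Hsc.
assert (FP : A 1 * cos b + B 1 * sin b = exp a).
{ replace (A 1 * cos b + B 1 * sin b) with (exp a * (exp (- a) * (A 1 * cos b + B 1 * sin b)))
    by (rewrite <- Rmult_assoc, Hexp; ring). rewrite EP. ring. }
assert (FQ : B 1 * cos b - A 1 * sin b = 0).
{ replace (B 1 * cos b - A 1 * sin b) with (exp a * (exp (- a) * (B 1 * cos b - A 1 * sin b)))
    by (rewrite <- Rmult_assoc, Hexp; ring). rewrite EQ. ring. }
assert (G1 : A 1 = exp a * cos b).
{ rewrite <- FP. replace (A 1) with (A 1 * (sin b * sin b + cos b * cos b)) at 1 by (rewrite Hsc; ring).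
  replace (A 1 * (sin b * sin b + cos b * cos b)) with
   ((A 1 * cos b + B 1 * sin b) * cos b - (B 1 * cos b - A 1 * sin b) * sin b) by ring.
  rewrite FQ. ring. }
assert (G2 : B 1 = exp a * sin b).
{ rewrite <- FP. replace (B 1) with (B 1 * (sin b * sin b + cos b * cos b)) at 1 by (rewrite Hsc; ring).
  replace (B 1 * (sin b * sin b + cos b * cos b)) with
   ((A 1 * cos b + B 1 * sin b) * sin b + (B 1 * cos b - A 1 * sin b) * cos b) by ring.
  rewrite FQ. ring. }
split; assumption.
Qed.

(** The sum [E] of the exponential series is its own derivative. Along the ray from 0 through [w]
    its real and imaginary parts therefore solve the linear system of [complex_exponential_ode],
    whose value at time 1 is [cexp w]. *)
Lemma is_Cseries_cexp (w : C) : is_Cseries (fun n => RtoC (/ INR (fact n)) * w ^ n)%C (cexp w).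
Proof.
assert (Hex : forall z, exists l, is_Cseries (fun n => RtoC (/ INR (fact n)) * z ^ n)%C l).
{ intros z. apply (ex_Cseries _ (fun n => / INR (fact n) * Cmod z ^ n) (exp (Cmod z))).
  - intros n. rewrite Cmod_mult, Cmod_pow, Cmod_R, Rabs_pos_eq; [lra|].
    left. apply Rinv_0_lt_compat, INR_fact_lt_0.
  - intros N. apply sum_n_exp_le, Cmod_ge_0. }
set (E := fun z => epsilon (inhabits (RtoC 0)) (fun l => is_Cseries (fun n => RtoC (/ INR (fact n)) * z ^ n)%C l)).
assert (HE : forall z, is_Cseries (fun n => RtoC (/ INR (fact n)) * z ^ n)%C (E z))
  by (intros z; apply epsilon_spec, Hex).
assert (HE' : forall z, @is_derive C_AbsRing C_NormedModule E z (E z)).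
{ intros z.
  destruct (is_derive_Cpseries (fun n => RtoC (/ INR (fact n))) E (Cmod z + 1)
     (fun u _ => HE u) z ltac:(lra)) as [l [Hl Hd]].
  replace (E z) with l; [exact Hd|].
  apply (is_Cseries_unique _ _ _ Hl). eapply is_Cseries_ext; [|apply (HE z)].
  intros n. cbv beta. rewrite <- RtoC_mult. do 2 f_equal.
  rewrite fact_simpl, mult_INR. field. split; [apply INR_fact_neq_0|apply not_0_INR; lia]. }
assert (HE0 : E (RtoC 0) = RtoC 1).
{ apply (is_Cseries_unique _ _ _ (HE (RtoC 0))).
  replace (RtoC 1) with (RtoC (/ INR (fact 0)) * RtoC 0 ^ 0 + RtoC 0)%C.
  - apply (is_Cseries_cons (fun n => RtoC (/ INR (fact n)) * RtoC 0 ^ n)%C).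
    apply is_series_Cmod. intros eps Heps. exists O. intros n _.
    replace (sum_n _ n) with (RtoC 0).
    + replace (RtoC 0 - RtoC 0)%C with (RtoC 0) by ring. rewrite Cmod_0. exact Heps.
    + induction n; [rewrite sum_O, Cpow_S; ring_C|].
      rewrite sum_n_SC, <- IHn, Cpow_S. ring_C.
  - simpl. replace (/ 1) with 1 by field. ring. }
set (a := Re w). set (b := Im w).
set (A := fun t => Re (E (RtoC t * w)%C)). set (B := fun t => Im (E (RtoC t * w)%C)).
assert (HA : forall t, is_derive A t (a * A t - b * B t)).
{ intros t. assert (H := is_derive_along_path E (fun s => RtoC s * w)%C t (E (RtoC t * w)%C) w (RtoC 1)
    (HE' _)).
  assert (H1 : is_derive (fun s => Re (RtoC s * w)%C) t (Re w))
    by (unfold Re; simpl; auto_derive; [exact I|ring]).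
  assert (H2 : is_derive (fun s => Im (RtoC s * w)%C) t (Im w))
    by (unfold Im; simpl; auto_derive; [exact I|ring]).
  specialize (H H1 H2).
  replace (a * A t - b * B t) with (Re (RtoC 1 * (E (RtoC t * w) * w))%C)
    by (unfold A, B, a, b, Re, Im; simpl; ring).
  eapply is_derive_ext; [|exact H]. intros s. unfold A, Re; simpl; ring. }
assert (HB : forall t, is_derive B t (a * B t + b * A t)).
{ intros t. assert (H := is_derive_along_path E (fun s => RtoC s * w)%C t (E (RtoC t * w)%C) w (- Ci)%C
    (HE' _)).
  assert (H1 : is_derive (fun s => Re (RtoC s * w)%C) t (Re w))
    by (unfold Re; simpl; auto_derive; [exact I|ring]).
  assert (H2 : is_derive (fun s => Im (RtoC s * w)%C) t (Im w))
    by (unfold Im; simpl; auto_derive; [exact I|ring]).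
  specialize (H H1 H2).
  replace (a * B t + b * A t) with (Re (- Ci * (E (RtoC t * w) * w))%C)
    by (unfold A, B, a, b, Re, Im; simpl; ring).
  eapply is_derive_ext; [|exact H]. intros s. unfold B, Re, Im; simpl; ring. }
assert (A0 : A 0 = 1) by (unfold A; rewrite Cmult_0_l, HE0; reflexivity).
assert (B0 : B 0 = 0) by (unfold B; rewrite Cmult_0_l, HE0; reflexivity).
destruct (complex_exponential_ode A B a b HA HB A0 B0) as [G1 G2].
replace (cexp w) with (E w); [apply HE|].
unfold A, B in G1, G2. rewrite Cmult_1_l in G1, G2. unfold cexp. fold a b.
rewrite <- G1, <- G2. destruct (E w); reflexivity.
Qed.

Lemma pow_n_Cpow (z : C) n : @pow_n C_Ring z n = (z ^ n)%C.
Proof. induction n; [reflexivity|]. simpl. rewrite IHn. reflexivity. Qed.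

Lemma is_Cpseries_equiv (a : nat -> C) (z l : C) :
  @is_pseries C_AbsRing C_NormedModule a z l <-> is_Cseries (fun n => a n * z ^ n)%C l.
Proof.
unfold is_pseries. split; apply is_series_ext; intros n.
- rewrite <- pow_n_Cpow. apply Cmult_comm.
- rewrite <- pow_n_Cpow. apply Cmult_comm.
Qed.

(** * Power series with majorized coefficients *)

(** For each [rho] the least possible [B rho] is the norm of [f] in a Banach algebra of absolutely
    summable series. Hence products, exponentials and infinite sums of such functions stay analytic,
    with explicit bounds that can be made uniform in parameters. *)
Definition majorized (f : C -> C) (B : R -> R) : Prop :=
  exists a : nat -> C,
    (forall z, in_disc z -> is_Cseries (fun n => a n * z ^ n)%C (f z)) /\
    (forall rho N, 0 <= rho < 1 -> sum_n (fun n => Cmod (a n) * rho ^ n) N <= B rho).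

Lemma majorized_ext f g B B' :
  (forall z, in_disc z -> f z = g z) -> (forall rho, 0 <= rho < 1 -> B rho <= B' rho) ->
  majorized f B -> majorized g B'.
Proof.
intros E L [a [H1 H2]]. exists a. split.
- intros z Hz. rewrite <- E by exact Hz. apply H1, Hz.
- intros rho N Hr. eapply Rle_trans; [apply H2, Hr|apply L, Hr].
Qed.

Lemma majorized_bound f B z : majorized f B -> in_disc z -> Cmod (f z) <= B (Cmod z).
Proof.
intros [a [H1 H2]] Hz.
apply (Cmod_Cseries_le _ _ _ (H1 z Hz)). intros N.
eapply Rle_trans; [|apply (H2 (Cmod z) N)].
- apply Cmod_sum_n_le. intros n _. rewrite Cmod_mult, Cmod_pow. lra.
- split; [apply Cmod_ge_0|exact Hz].
Qed.

Lemma majorized_bound_ge0 f B rho : majorized f B -> 0 <= rho < 1 -> 0 <= B rho.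
Proof.
intros [a [_ H2]] Hr. eapply Rle_trans; [|apply (H2 rho O Hr)].
rewrite sum_O. simpl. assert (h := Cmod_ge_0 (a O)). lra.
Qed.

Lemma majorized_series (F : nat -> C -> C) (B : nat -> R -> R) (S : C -> C) (T : R -> R) :
  (forall m, majorized (F m) (B m)) ->
  (forall rho, 0 <= rho < 1 -> is_series (fun m => B m rho) (T rho)) ->
  (forall z, in_disc z -> is_Cseries (fun m => F m z) (S z)) ->
  majorized S T.
Proof.
intros HF HT HS.
set (a := fun m => epsilon (inhabits (fun _ : nat => RtoC 0)) (fun a : nat -> C =>
    (forall z, in_disc z -> is_Cseries (fun n => a n * z ^ n)%C (F m z)) /\
    (forall rho N, 0 <= rho < 1 -> sum_n (fun n => Cmod (a n) * rho ^ n) N <= B m rho))).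
assert (Ha : forall m, (forall z, in_disc z -> is_Cseries (fun n => a m n * z ^ n)%C (F m z)) /\
    (forall rho N, 0 <= rho < 1 -> sum_n (fun n => Cmod (a m n) * rho ^ n) N <= B m rho))
  by (intros m; apply epsilon_spec, HF).
assert (HB0 : forall m rho, 0 <= rho < 1 -> 0 <= B m rho)
  by (intros m rho; apply (majorized_bound_ge0 (F m)), HF).
assert (Hc : forall z, in_disc z ->
   forall m N, sum_n (fun n => Cmod (a m n * z ^ n)%C) N <= B m (Cmod z)).
{ intros z Hz m N. eapply Rle_trans; [|apply (proj2 (Ha m) (Cmod z) N)].
  - apply sum_n_le_R; intros n _. rewrite Cmod_mult, Cmod_pow. lra.
  - split; [apply Cmod_ge_0|exact Hz]. }
assert (Hmod : forall rho, 0 <= rho < 1 -> Cmod (RtoC rho) = rho)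
  by (intros rho Hr; rewrite Cmod_R; apply Rabs_pos_eq; lra).
(* At radius 1/2 a majorant controls each coefficient, [Cmod (a m n) <= 2 ^ n * B m (1/2)], so every
   column of coefficients is summable in [m]. *)
assert (Hb : forall n, exists l, is_Cseries (fun m => a m n) l).
{ intros n. apply (ex_Cseries _ (fun m => 2 ^ n * B m (1/2)) (2 ^ n * T (1/2))).
  - intros m. assert (h := double_series_term (fun m n => a m n * RtoC (1/2) ^ n)%C
      (fun m => B m (Cmod (RtoC (1/2))))
      (Hc (RtoC (1/2)) ltac:(unfold in_disc; rewrite Hmod; lra)) m n).
    cbv beta in h. rewrite Cmod_mult, Cmod_pow, Hmod in h by lra.
    assert (hp : 0 < 2 ^ n) by (apply pow_lt; lra).
    apply (Rmult_le_compat_l (2 ^ n)) in h; [|lra].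
    replace (2 ^ n * (Cmod (a m n) * (1/2) ^ n)) with (Cmod (a m n)) in h; [exact h|].
    replace ((1/2) ^ n) with (/ 2 ^ n).
    + field. lra.
    + unfold Rdiv. rewrite Rmult_1_l. symmetry. apply pow_inv.
  - intros N. rewrite sum_n_scal_R. apply Rmult_le_compat_l; [apply pow_le; lra|].
    apply sum_n_le_series; [intros m; apply HB0; lra|apply HT; lra]. }
set (b := fun n => epsilon (inhabits (RtoC 0)) (fun l => is_Cseries (fun m => a m n) l)).
assert (Hb' : forall n, is_Cseries (fun m => a m n) (b n)) by (intros n; apply epsilon_spec, Hb).
assert (Hd : forall z n, is_Cseries (fun m => a m n * z ^ n)%C (b n * z ^ n)%C).
{ intros z n. rewrite (Cmult_comm (b n)).
  eapply is_Cseries_ext; [|apply (is_Cseries_scal (z ^ n)%C _ _ (Hb' n))].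
  intros m. cbv beta. ring. }
exists b. split.
- intros z Hz.
  apply (double_series_switch (fun m n => a m n * z ^ n)%C (fun m => B m (Cmod z)) (T (Cmod z)))
    with (f := fun m => F m z).
  + apply Hc, Hz.
  + apply HT. split; [apply Cmod_ge_0|exact Hz].
  + intros m. apply (proj1 (Ha m)), Hz.
  + apply Hd.
  + apply HS, Hz.
- intros rho N Hr.
  assert (Hz : in_disc (RtoC rho)) by (unfold in_disc; rewrite Hmod; lra).
  eapply Rle_trans; [|apply (double_series_abs (fun m n => a m n * RtoC rho ^ n)%C
     (fun m => B m (Cmod (RtoC rho))) (T rho) (Hc _ Hz)) with (d := fun n => (b n * RtoC rho ^ n)%C) (N := N)].
  + apply sum_n_le_R; intros n _. rewrite Cmod_mult, Cmod_pow, Hmod by exact Hr. lra.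
  + rewrite Hmod by exact Hr. apply HT, Hr.
  + apply Hd.
Qed.

Lemma majorized_scal c f B :
  majorized f B -> majorized (fun z => c * f z)%C (fun rho => Cmod c * B rho).
Proof.
intros [a [H1 H2]]. exists (fun n => c * a n)%C. split.
- intros z Hz. eapply is_Cseries_ext; [|apply (is_Cseries_scal c _ _ (H1 z Hz))].
  intros n. cbv beta. ring.
- intros rho N Hr.
  apply Rle_trans with (sum_n (fun n => Cmod c * (Cmod (a n) * rho ^ n)) N).
  + apply sum_n_le_R; intros n _. rewrite Cmod_mult. lra.
  + rewrite sum_n_scal_R. apply Rmult_le_compat_l; [apply Cmod_ge_0|apply H2, Hr].
Qed.

Lemma majorized_plus f g B B' :
  majorized f B -> majorized g B' ->
  majorized (fun z => f z + g z)%C (fun rho => B rho + B' rho).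
Proof.
intros [a [H1 H2]] [b [K1 K2]]. exists (fun n => a n + b n)%C. split.
- intros z Hz. eapply is_Cseries_ext; [|apply (is_Cseries_plus _ _ _ _ (H1 z Hz) (K1 z Hz))].
  intros n. cbv beta. ring.
- intros rho N Hr. apply Rle_trans with
   (sum_n (fun n => Cmod (a n) * rho ^ n) N + sum_n (fun n => Cmod (b n) * rho ^ n) N).
  + clear - Hr. induction N as [|N IH].
    * rewrite !sum_O. simpl. assert (h := Cmod_triangle (a O) (b O)). lra.
    * rewrite !sum_n_SR. assert (h := Cmod_triangle (a (S N)) (b (S N))).
      assert (h' : 0 <= rho ^ S N) by (apply pow_le; lra).
      assert (h2 := Rmult_le_compat_r _ _ _ h' h). lra.
  + specialize (H2 rho N Hr). specialize (K2 rho N Hr). lra.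
Qed.

Lemma majorized_mulX f B :
  majorized f B -> majorized (fun z => z * f z)%C (fun rho => rho * B rho).
Proof.
intros [a [H1 H2]]. exists (fun n => match n with O => RtoC 0 | S k => a k end). split.
- intros z Hz. replace (z * f z)%C with (RtoC 0 * z ^ 0 + z * f z)%C by ring.
  apply (is_Cseries_cons (fun n => match n with O => RtoC 0 | S k => a k end * z ^ n)%C).
  eapply is_Cseries_ext; [|apply (is_Cseries_scal z _ _ (H1 z Hz))].
  intros n. cbv beta. rewrite Cpow_S. ring.
- intros rho N Hr. assert (h0 : 0 <= B rho)
    by (apply (majorized_bound_ge0 f); [exists a; split; assumption|exact Hr]).
  apply Rle_trans with (rho * (match N with O => 0 | S M => sum_n (fun n => Cmod (a n) * rho ^ n) M end)).
  + right. induction N as [|N IH]; [rewrite sum_O, Cmod_0; ring_R|].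
    rewrite sum_n_SR, IH. destruct N; [rewrite sum_O; simpl; ring|].
    rewrite (sum_n_SR (fun n => Cmod (a n) * rho ^ n)). simpl; ring.
  + apply Rmult_le_compat_l; [lra|]. destruct N; [exact h0|apply H2, Hr].
Qed.

Lemma majorized_mulXn f B m :
  majorized f B -> majorized (fun z => z ^ m * f z)%C (fun rho => rho ^ m * B rho).
Proof.
intros H. induction m as [|m IH].
- eapply majorized_ext; [| |exact H].
  + intros z _. simpl. ring.
  + intros rho _. simpl. lra.
- eapply majorized_ext; [| |apply (majorized_mulX _ _ IH)].
  + intros z _. cbv beta. rewrite Cpow_S. ring.
  + intros rho _. simpl. lra.
Qed.

(** The product is the series over [m] of the functions [b m * z ^ m * f z], so [majorized_series]
    replaces the Cauchy product of coefficients. *)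
Lemma majorized_mult f g B B' :
  majorized f B -> majorized g B' ->
  majorized (fun z => f z * g z)%C (fun rho => B rho * B' rho).
Proof.
intros Hf Hg. destruct Hg as [b [K1 K2]].
assert (Hex : forall rho, 0 <= rho < 1 -> ex_series (fun n => Cmod (b n) * rho ^ n)).
{ intros rho Hr. apply (ex_series_bounded _ (B' rho)); [|intros N; apply K2, Hr].
  intros n. apply Rmult_le_pos; [apply Cmod_ge_0|apply pow_le; lra]. }
apply (majorized_ext (fun z => f z * g z)%C _
   (fun rho => B rho * Series (fun n => Cmod (b n) * rho ^ n))).
- reflexivity.
- intros rho Hr. apply Rmult_le_compat_l; [apply (majorized_bound_ge0 f); assumption|].
  apply (series_le_of_partial _ _ _ (Series_correct _ (Hex rho Hr))).
  intros N. apply K2, Hr.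
- apply (majorized_series (fun m z => b m * (z ^ m * f z))%C
    (fun m rho => Cmod (b m) * (rho ^ m * B rho))).
  + intros m. apply majorized_scal, majorized_mulXn, Hf.
  + intros rho Hr.
    apply (is_series_ext (fun m => B rho * (Cmod (b m) * rho ^ m))); [intros m; ring_R|].
    apply is_series_scal_R, Series_correct, Hex, Hr.
  + intros z Hz. eapply is_Cseries_ext; [|apply (is_Cseries_scal (f z) _ _ (K1 z Hz))].
    intros n. cbv beta. ring.
Qed.

Lemma majorized_const c : majorized (fun _ => c) (fun _ => Cmod c).
Proof.
exists (fun n => match n with O => c | _ => RtoC 0 end). split.
- intros z _. apply is_series_Cmod. intros eps Heps. exists O. intros n _.
  replace (sum_n _ n) with c.
  + replace (c - c)%C with (RtoC 0) by ring. rewrite Cmod_0. exact Heps.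
  + induction n; [rewrite sum_O; simpl; ring_C|].
    rewrite sum_n_SC, <- IHn. ring_C.
- intros rho N _. right. induction N; [rewrite sum_O; simpl; ring_R|].
  rewrite sum_n_SR, IHN, Cmod_0. ring_R.
Qed.

Lemma sum_n_C_geom (q : C) n : (1 - q)%C <> RtoC 0 ->
  (sum_n (fun n => q ^ n)%C n - / (1 - q))%C = (- (q ^ S n) / (1 - q))%C.
Proof.
intros hne. induction n.
- rewrite sum_O, Cpow_S. change ((1 - / (1 - q))%C = (- (q * 1) / (1 - q))%C).
  field; exact hne.
- rewrite sum_n_SC.
  replace (sum_n (fun n => q ^ n) n + q ^ S n - / (1 - q))%C
   with ((sum_n (fun n => q ^ n) n - / (1 - q)) + q ^ S n)%C by ring.
  rewrite IHn, !Cpow_S. field; exact hne.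
Qed.

Lemma is_series_C_geom (q : C) : Cmod q < 1 -> is_Cseries (fun n => q ^ n)%C (/ (1 - q))%C.
Proof.
intros Hq.
assert (hne : (1 - q)%C <> RtoC 0).
{ intros E. assert (Hq1 : q = RtoC 1) by (replace q with (1 - (1 - q))%C by ring; rewrite E; ring).
  rewrite Hq1, Cmod_1 in Hq. lra. }
assert (hpos : 0 < Cmod (1 - q)%C) by (apply Cmod_gt_0, hne).
apply is_series_Cmod. intros eps Heps.
assert (hq0 := Cmod_ge_0 q).
destruct (pow_lt_1_zero (Cmod q) ltac:(rewrite Rabs_pos_eq; lra) (eps * Cmod (1 - q)%C)
   ltac:(apply Rmult_lt_0_compat; lra)) as [N HN].
exists N. intros n Hn. rewrite sum_n_C_geom by exact hne. unfold Cdiv.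
rewrite Cmod_mult, Cmod_opp, Cmod_pow, Cmod_inv by exact hne.
specialize (HN (S n) ltac:(lia)). rewrite Rabs_pos_eq in HN by (apply pow_le, hq0).
apply (Rmult_lt_reg_r (Cmod (1 - q)%C)); [exact hpos|].
rewrite Rmult_assoc, Rinv_l by lra. lra.
Qed.

Lemma majorized_geom om :
  Cmod om <= 1 -> majorized (fun z => / (1 - om * z))%C (fun rho => / (1 - rho)).
Proof.
intros Hom. assert (h0 := Cmod_ge_0 om). exists (fun n => om ^ n)%C. split.
- intros z Hz. assert (hz := Cmod_ge_0 z). unfold in_disc in Hz.
  eapply is_Cseries_ext; [|apply (is_series_C_geom (om * z)%C)].
  + intros n. apply Cpow_mult_l.
  + rewrite Cmod_mult. nra.
- intros rho N Hr.
  apply Rle_trans with (sum_n (fun n => rho ^ n) N).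
  + apply sum_n_le_R; intros n _. rewrite Cmod_pow.
    assert (h1 : Cmod om ^ n <= 1 ^ n) by (apply pow_incr; lra). rewrite pow1 in h1.
    assert (h2 : 0 <= rho ^ n) by (apply pow_le; lra). nra.
  + apply sum_n_le_series; [intros n; apply pow_le; lra|].
    apply is_series_geom. rewrite Rabs_pos_eq; lra.
Qed.

Lemma majorized_pow f B m :
  majorized f B -> majorized (fun z => f z ^ m)%C (fun rho => B rho ^ m).
Proof.
intros H. induction m as [|m IH].
- eapply majorized_ext; [| |apply (majorized_const (RtoC 1))].
  + reflexivity.
  + intros rho _. rewrite Cmod_1. simpl. lra.
- eapply majorized_ext; [| |apply (majorized_mult _ _ _ _ H IH)].
  + intros z _. rewrite Cpow_S. reflexivity.
  + intros rho _. simpl. lra.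
Qed.

Lemma majorized_cexp f B :
  majorized f B -> majorized (fun z => cexp (f z)) (fun rho => exp (B rho)).
Proof.
intros H.
apply (majorized_series (fun m z => RtoC (/ INR (fact m)) * f z ^ m)%C
   (fun m rho => / INR (fact m) * B rho ^ m)).
- intros m. eapply majorized_ext; [| |apply majorized_scal, (majorized_pow _ _ m H)].
  + reflexivity.
  + intros rho _. rewrite Cmod_R, Rabs_pos_eq; [lra|].
    left. apply Rinv_0_lt_compat, INR_fact_lt_0.
- intros rho _. assert (E := is_exp_Reals (B rho)). unfold is_pseries in E.
  eapply is_series_ext; [|exact E]. intros n. rewrite pow_n_pow.
  change (B rho ^ n * / INR (fact n) = / INR (fact n) * B rho ^ n). ring.
- intros z _. apply is_Cseries_cexp.
Qed.

Lemma majorized_holomorphic f B : majorized f B -> holomorphic_on_disc f.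
Proof.
intros [a [H _]] z Hz.
destruct (is_derive_Cpseries a f 1 H z Hz) as [l [_ Hl]]. exists l. exact Hl.
Qed.

(** The series is indexed by [z ^ S n] so that, for partial sums as coefficients, division by [z]
    leaves exactly the series of Cesaro means. *)
Lemma primitive_of_pseries (a : nat -> C) (f : C -> C) :
  (forall z, in_disc z -> is_Cseries (fun n => a n * z ^ n)%C (f z)) ->
  exists F : C -> C,
   (forall z, in_disc z -> is_Cseries (fun n => RtoC (/ INR (S n)) * a n * z ^ S n)%C (F z)) /\
   (forall z, in_disc z -> @is_derive C_AbsRing C_NormedModule F z (f z)) /\
   F (RtoC 0) = RtoC 0.
Proof.
intros H.
set (b := fun n => match n with O => RtoC 0 | S k => (RtoC (/ INR (S k)) * a k)%C end).
assert (Hex : forall z, in_disc z -> exists l, is_Cseries (fun n => b (S n) * z ^ S n)%C l).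
{ intros z Hz. assert (hz := Cmod_ge_0 z).
  destruct (ex_series_Cmod a f 1 H (Cmod z) ltac:(unfold in_disc in Hz; lra)) as [T HT].
  assert (Hpos : forall n, 0 <= Cmod (a n) * Cmod z ^ n)
    by (intros n; apply Rmult_le_pos; [apply Cmod_ge_0|apply pow_le, hz]).
  apply (ex_Cseries _ (fun n => Cmod (a n) * Cmod z ^ n) T).
  - intros n. unfold b. rewrite !Cmod_mult, Cmod_pow, Cmod_R.
    assert (h1 : 1 <= INR (S n)) by (rewrite S_INR; assert (h := pos_INR n); lra).
    assert (h2 : 0 < / INR (S n) <= 1).
    { split; [apply Rinv_0_lt_compat; lra|]. rewrite <- Rinv_1. apply Rinv_le_contravar; lra. }
    rewrite Rabs_pos_eq by lra. simpl pow. specialize (Hpos n). unfold in_disc in Hz.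
    replace (/ INR (S n) * Cmod (a n) * (Cmod z * Cmod z ^ n))
      with (/ INR (S n) * Cmod z * (Cmod (a n) * Cmod z ^ n)) by ring.
    rewrite <- (Rmult_1_l (Cmod (a n) * _)) at 2.
    apply Rmult_le_compat_r; [exact Hpos|nra].
  - intros N. apply sum_n_le_series; [exact Hpos|exact HT]. }
set (F := fun z => epsilon (inhabits (RtoC 0)) (fun l => is_Cseries (fun n => b (S n) * z ^ S n)%C l)).
assert (HF : forall z, in_disc z -> is_Cseries (fun n => b (S n) * z ^ S n)%C (F z))
  by (intros z Hz; apply epsilon_spec, Hex, Hz).
exists F. split; [exact HF|]. split.
- intros z Hz.
  assert (HF' : forall z, Cmod z < 1 -> is_Cseries (fun n => b n * z ^ n)%C (F z)).
  { intros u Hu. replace (F u) with (b O * u ^ 0 + F u)%C by (unfold b; ring).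
    apply (is_Cseries_cons (fun n => b n * u ^ n)%C), HF, Hu. }
  destruct (is_derive_Cpseries b F 1 HF' z Hz) as [l [Hl Hd]].
  replace (f z) with l; [exact Hd|].
  apply (is_Cseries_unique _ _ _ Hl). eapply is_Cseries_ext; [|apply (H z Hz)].
  intros n. unfold b. cbv beta iota.
  rewrite Cmult_assoc, <- RtoC_mult, Rinv_r by (apply not_0_INR; lia). ring.
- assert (h0 : in_disc (RtoC 0)) by (unfold in_disc; rewrite Cmod_0; lra).
  apply (is_Cseries_unique _ _ _ (HF _ h0)).
  apply is_series_Cmod. intros eps Heps. exists O. intros n _.
  replace (sum_n _ n) with (RtoC 0).
  + replace (RtoC 0 - RtoC 0)%C with (RtoC 0) by ring. rewrite Cmod_0. exact Heps.
  + induction n; [rewrite sum_O, Cpow_S; ring_C|].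
    rewrite sum_n_SC, <- IHn, Cpow_S. ring_C.
Qed.

(** * The Cesaro operator as a primitive *)

Lemma one_minus_neq0 (z : C) : in_disc z -> (1 - z)%C <> RtoC 0.
Proof.
intros Hz E. assert (E' : z = RtoC 1) by (replace z with (1 - (1 - z))%C by ring; rewrite E; ring).
unfold in_disc in Hz. rewrite E', Cmod_1 in Hz. lra.
Qed.

(** Abel summation: multiplying by [1 - z] telescopes up to the term [sum_n a N * z ^ S N]. This
    tends to 0 because [Cmod (sum_n a N) * rho ^ N] stays bounded for a [rho] between [Cmod z] and
    1. *)
Lemma partial_sums_pseries (a : nat -> C) (g : C -> C) :
  (forall z, in_disc z -> is_Cseries (fun n => a n * z ^ n)%C (g z)) ->
  forall z, in_disc z -> is_Cseries (fun n => sum_n a n * z ^ n)%C (g z / (1 - z))%C.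
Proof.
intros H z Hz. assert (Hz' := Hz). unfold in_disc in Hz'. assert (hz := Cmod_ge_0 z).
assert (hne := one_minus_neq0 z Hz).
assert (hpos : 0 < Cmod (1 - z)%C) by (apply Cmod_gt_0, hne).
assert (Habel : forall N, (sum_n (fun n => sum_n a n * z ^ n) N * (1 - z)
    = sum_n (fun n => a n * z ^ n) N - sum_n a N * z ^ S N)%C).
{ induction N as [|N IH].
  - rewrite !sum_O, Cpow_S. change ((a O * 1 * (1 - z) = a O * 1 - a O * (z * 1))%C). ring.
  - rewrite (sum_n_SC (fun n => sum_n a n * z ^ n)%C), (sum_n_SC (fun n => a n * z ^ n)%C).
    rewrite Cmult_plus_distr_r, IH, (sum_n_SC a), !Cpow_S. ring. }
set (rho := (Cmod z + 1) / 2). set (q := Cmod z / rho).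
assert (Hrho : 0 < rho < 1) by (unfold rho; lra).
assert (Hq : 0 <= q < 1).
{ unfold q. split; [apply Rmult_le_pos; [lra|left; apply Rinv_0_lt_compat; lra]|].
  apply (Rmult_lt_reg_r rho); [lra|]. unfold Rdiv. rewrite Rmult_assoc, Rinv_l; unfold rho; lra. }
destruct (ex_series_Cmod a g 1 H rho ltac:(lra)) as [T HT].
assert (Hs : forall N, Cmod (sum_n a N * z ^ S N)%C <= T * q ^ N).
{ intros N. rewrite Cmod_mult, Cmod_pow.
  assert (Ez : Cmod z = rho * q) by (unfold q; field; lra).
  assert (h1 : Cmod (sum_n a N) * rho ^ N <= T).
  { apply Rle_trans with (sum_n (fun n => Cmod (a n) * rho ^ n) N).
    - apply Rle_trans with (sum_n (fun n => rho ^ N * Cmod (a n)) N).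
      + rewrite sum_n_scal_R, Rmult_comm. apply Rmult_le_compat_l; [apply pow_le; lra|].
        apply Cmod_sum_n_le; intros; lra.
      + apply sum_n_le_R. intros n Hn. rewrite Rmult_comm.
        apply Rmult_le_compat_l; [apply Cmod_ge_0|].
        replace N with (n + (N - n))%nat by lia. rewrite pow_add.
        assert (0 <= rho ^ n) by (apply pow_le; lra).
        assert (h : rho ^ (N - n) <= 1 ^ (N - n)) by (apply pow_incr; lra).
        rewrite pow1 in h. nra.
    - apply sum_n_le_series; [|exact HT].
      intros n; apply Rmult_le_pos; [apply Cmod_ge_0|apply pow_le; lra]. }
  assert (h2 : 0 <= q ^ N) by (apply pow_le; lra).
  assert (h3 : 0 <= Cmod (sum_n a N) * rho ^ N)
    by (apply Rmult_le_pos; [apply Cmod_ge_0|apply pow_le; lra]).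
  replace (Cmod z ^ S N) with (Cmod z * (rho ^ N * q ^ N))
    by (rewrite <- Rpow_mult_distr, <- Ez; reflexivity).
  replace (Cmod (sum_n a N) * (Cmod z * (rho ^ N * q ^ N)))
    with (Cmod z * (Cmod (sum_n a N) * rho ^ N * q ^ N)) by ring.
  assert (h4 := Rmult_le_compat_r _ _ _ h2 h1).
  assert (h5 : 0 <= Cmod (sum_n a N) * rho ^ N * q ^ N) by (apply Rmult_le_pos; assumption). nra. }
assert (HT0 : 0 <= T) by (specialize (Hs O); assert (h := Cmod_ge_0 (sum_n a 0 * z ^ 1)%C); simpl pow in Hs; lra).
apply is_series_Cmod. intros eps Heps.
set (d := Cmod (1 - z)%C) in *.
assert (Hed : 0 < eps * d / 2) by (apply Rmult_lt_0_compat; [apply Rmult_lt_0_compat; lra|lra]).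
destruct (proj1 (is_series_Cmod _ _) (H z Hz) (eps * d / 2) Hed) as [N1 HN1].
destruct (pow_lt_1_zero q ltac:(rewrite Rabs_pos_eq; lra) (eps * d / 2 / (T + 1))
   ltac:(apply Rdiv_lt_0_compat; lra)) as [N2 HN2].
exists (max N1 N2). intros n Hn. specialize (HN1 n ltac:(lia)). specialize (HN2 n ltac:(lia)).
rewrite Rabs_pos_eq in HN2 by (apply pow_le; lra).
specialize (Hs n).
assert (h1 : T * q ^ n <= eps * d / 2).
{ apply Rle_trans with ((T + 1) * (eps * d / 2 / (T + 1))).
  - apply Rmult_le_compat; [lra|apply pow_le; lra|lra|lra].
  - right; field; lra. }
replace (sum_n (fun n => sum_n a n * z ^ n) n - g z / (1 - z))%C
  with ((sum_n (fun n => sum_n a n * z ^ n) n * (1 - z) - g z) / (1 - z))%C by (field; exact hne).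
rewrite Habel, Cmod_div by exact hne. fold d.
apply (Rmult_lt_reg_r d); [exact hpos|]. unfold Rdiv at 1. rewrite Rmult_assoc, Rinv_l, Rmult_1_r by lra.
replace (sum_n (fun n => a n * z ^ n) n - sum_n a n * z ^ S n - g z)%C
  with ((sum_n (fun n => a n * z ^ n) n - g z) + - (sum_n a n * z ^ S n))%C by ring.
eapply Rle_lt_trans; [apply Cmod_triangle|]. rewrite Cmod_opp. lra.
Qed.

Lemma cesaro_primitive (g : C -> C) :
  (exists a, has_power_series a g) ->
  exists H : C -> C,
    H (RtoC 0) = RtoC 0 /\
    forall z, in_disc z ->
      @is_derive C_AbsRing C_NormedModule H z (g z / (1 - z))%C /\ (z * cesaro g z = H z)%C.
Proof.
intros Hex. set (a := power_series_coef g).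
assert (Ha : has_power_series a g)
  by (unfold a, power_series_coef; apply epsilon_spec, Hex).
assert (Ha' : forall z, in_disc z -> is_Cseries (fun n => a n * z ^ n)%C (g z))
  by (intros z Hz; exact (proj1 (is_Cpseries_equiv a z (g z)) (Ha z Hz))).
destruct (primitive_of_pseries (sum_n a) (fun z => g z / (1 - z))%C (partial_sums_pseries a g Ha'))
  as [H [H1 [H2 H3]]].
exists H. split; [exact H3|]. intros z Hz. split; [apply H2, Hz|].
(* At the origin both sides of the product formula vanish, whatever [cesaro g] is there. *)
destruct (Req_dec (Cmod z) 0) as [E|E].
{ apply Cmod_eq_0 in E. subst z. rewrite H3. ring. }
assert (hne : z <> RtoC 0) by (intros E'; apply E; rewrite E'; apply Cmod_0).
assert (HS : is_Cseries (fun n => cesaro_mean a n * z ^ n)%C (/ z * H z)%C).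
{ eapply is_Cseries_ext; [|apply (is_Cseries_scal (/ z)%C _ _ (H1 z Hz))].
  intros n. unfold cesaro_mean. rewrite Cpow_S. field; exact hne. }
assert (E' : cesaro g z = (/ z * H z)%C).
{ unfold cesaro. apply (@iota_unique C_AbsRing C_CompleteNormedModule).
  - intros y Hy. apply (is_Cseries_unique (fun n => cesaro_mean a n * z ^ n)%C); [|exact HS].
    exact (proj1 (is_Cpseries_equiv (cesaro_mean a) z y) Hy).
  - exact (proj2 (is_Cpseries_equiv (cesaro_mean a) z _) HS). }
rewrite E'. field; exact hne.
Qed.

(** * The two-atom kernel *)

Definition cayley (w : C) : C := ((w - 1) / (w + 1))%C.

Definition atom_mass (s y : R) : R := s ^ 2 / (1 + y ^ 2).

(** The conjugate of the boundary point [cayley (iy)]: thus [herglotz (atom_dir y * z)] has its pole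
    exactly where the second atom sits. *)
Definition atom_dir (y : R) : C := (- ((1, y)%R / (1, - y)%R))%C.

Definition herglotz (z : C) : C := ((1 + z) / (1 - z))%C.

(* [atom_dir] is chosen so that [w + s ^ 2 / (w - iy)] becomes, up to an imaginary constant, the sum of
   two Herglotz kernels.  The denominator equals [(1 - z) (w - iy + s)]; its square makes
   [hker s y z dz = kder s y w dw], with a bounded factor in front of the exponential. *)
Definition hker (s y : R) (z : C) : C :=
  (cexp (herglotz z + RtoC (atom_mass s y) * herglotz (atom_dir y * z)) *
   (/ ((1 + s, - y)%R + (1 - s, y)%R * z)) ^ 2)%C.

(* [hker] transported to the half-plane [0 < Re w]. *)
Definition kder (s y : R) (w : C) : C :=
  (/ 2 * cexp (w + RtoC (s ^ 2) / (w - (0, y)%R) - (0, atom_mass s y * y)%R) /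
   (w - (0, y)%R + RtoC s) ^ 2)%C.

Lemma Cmod_ge_Re w : Re w <= Cmod w.
Proof. eapply Rle_trans; [apply Rle_abs|apply re_le_Cmod]. Qed.

Lemma Rinv_ge_1 x : 1 <= x -> 0 < / x <= 1.
Proof.
intros H. split; [apply Rinv_0_lt_compat; lra|].
rewrite <- Rinv_1. apply Rinv_le_contravar; lra.
Qed.

Lemma C_neq0_re (z : C) : fst z <> 0 -> z <> RtoC 0.
Proof. intros H E. apply H. rewrite E. reflexivity. Qed.

Lemma Cmod_sqr (z : C) : Cmod z ^ 2 = fst z ^ 2 + snd z ^ 2.
Proof. rewrite Cmod2_alt. reflexivity. Qed.

Lemma Cmod_pair_le a b c d : a ^ 2 + b ^ 2 <= c ^ 2 + d ^ 2 -> Cmod (a, b) <= Cmod (c, d).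
Proof. intros H. unfold Cmod; simpl fst; simpl snd. apply sqrt_le_1_alt, H. Qed.

Lemma Cmod_atom_dir y : Cmod (atom_dir y) = 1.
Proof.
unfold atom_dir. rewrite Cmod_opp, Cmod_div by (apply C_neq0_re; simpl; lra).
replace (Cmod (1, - y)%R) with (Cmod (1, y)%R).
- field. assert (h : (1, y)%R <> RtoC 0) by (apply C_neq0_re; simpl; lra).
  apply Cmod_gt_0 in h. lra.
- apply Rle_antisym; apply Cmod_pair_le; simpl; lra.
Qed.

Lemma in_disc_mult om z : Cmod om <= 1 -> in_disc z -> in_disc (om * z)%C.
Proof.
unfold in_disc. intros Ho Hz. rewrite Cmod_mult.
assert (h := Cmod_ge_0 z). assert (h' := Cmod_ge_0 om). nra.
Qed.

Lemma majorized_herglotz om : Cmod om <= 1 ->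
  majorized (fun z => herglotz (om * z)%C) (fun rho => 3 / (1 - rho)).
Proof.
intros Hom.
eapply majorized_ext; [| |apply majorized_plus;
  [apply (majorized_const (- (1))%C)|apply (majorized_scal (RtoC 2)), (majorized_geom om Hom)]].
- intros z Hz. unfold herglotz. field. apply one_minus_neq0, in_disc_mult; assumption.
- intros rho Hr. cbv beta. rewrite Cmod_opp, !Cmod_R, !Rabs_pos_eq by lra.
  apply (Rmult_le_reg_r (1 - rho)); [lra|]. field_simplify; lra.
Qed.

Lemma atom_mass_bounds s y : s ^ 2 <= 1 + y ^ 2 -> 0 <= atom_mass s y <= 1.
Proof.
intros H. unfold atom_mass. assert (h : 0 < 1 + y ^ 2) by nra. split.
- apply Rmult_le_pos; [nra|]. left. apply Rinv_0_lt_compat, h.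
- apply (Rmult_le_reg_r (1 + y ^ 2)); [exact h|]. unfold Rdiv.
  rewrite Rmult_assoc, Rinv_l by lra. lra.
Qed.

(** The point is a majorant free of [s] and [y], so that geometric weights suffice to sum the
    kernels. The mass is at most 1, so two Herglotz majorants [3 / (1 - rho)] give the 6. The linear
    denominator is a constant of modulus at least 1 times [1 - tau * z], where [Cmod tau <= 1]
    because its zero lies outside the open disc. *)
Lemma hker_majorized s y : 0 < s -> s ^ 2 <= 1 + y ^ 2 ->
  majorized (hker s y) (fun rho => exp (6 / (1 - rho)) * (/ (1 - rho)) ^ 2).
Proof.
intros Hs Hsy. destruct (atom_mass_bounds s y Hsy) as [Ha0 Ha1].
assert (HA0 : (1 + s, - y)%R <> RtoC 0) by (apply C_neq0_re; simpl; lra).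
assert (HA1 : 1 <= Cmod (1 + s, - y)%R).
{ eapply Rle_trans; [|apply Cmod_ge_Re]. simpl. lra. }
set (tau := (- ((1 - s, y)%R / (1 + s, - y)%R))%C).
assert (Htau : Cmod tau <= 1).
{ unfold tau. rewrite Cmod_opp, Cmod_div by exact HA0.
  apply (Rmult_le_reg_r (Cmod (1 + s, - y)%R)); [lra|]. unfold Rdiv.
  rewrite Rmult_assoc, Rinv_l by lra. rewrite Rmult_1_l, Rmult_1_r.
  apply Cmod_pair_le. nra. }
apply (majorized_ext
  (fun z => cexp (herglotz (1 * z) + RtoC (atom_mass s y) * herglotz (atom_dir y * z)) *
     (/ (1 + s, - y)%R * / (1 - tau * z)) ^ 2)%C _
  (fun rho => exp (3 / (1 - rho) + Cmod (RtoC (atom_mass s y)) * (3 / (1 - rho)))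
    * (Cmod (/ (1 + s, - y)%R)%C * / (1 - rho)) ^ 2)).
- intros z Hz. unfold hker. rewrite Cmult_1_l. f_equal. f_equal.
  assert (h1 : (1 - tau * z)%C <> RtoC 0)
    by (apply one_minus_neq0, in_disc_mult; assumption).
  replace ((1 + s, - y)%R + (1 - s, y)%R * z)%C with ((1 + s, - y)%R * (1 - tau * z))%C
    by (unfold tau; field; exact HA0).
  field. split; assumption.
- intros rho Hr. assert (hp : 0 < / (1 - rho)) by (apply Rinv_0_lt_compat; lra).
  apply Rmult_le_compat.
  + left; apply exp_pos.
  + apply pow2_ge_0.
  + rewrite Cmod_R, Rabs_pos_eq by exact Ha0.
    destruct (Req_dec (3 / (1 - rho) + atom_mass s y * (3 / (1 - rho))) (6 / (1 - rho))) as [->|h]; [lra|].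
    left. apply exp_increasing. unfold Rdiv in *. nra.
  + apply pow_incr. rewrite Cmod_inv by exact HA0.
    assert (h : 0 < / Cmod (1 + s, - y)%R <= 1)
      by (apply Rinv_ge_1, HA1).
    nra.
- apply majorized_mult.
  + apply majorized_cexp, majorized_plus.
    * apply majorized_herglotz. rewrite Cmod_1. lra.
    * apply majorized_scal, majorized_herglotz. rewrite Cmod_atom_dir. lra.
  + apply (majorized_pow (fun z => / (1 + s, - y)%R * / (1 - tau * z))%C
      (fun rho => Cmod (/ (1 + s, - y)%R)%C * / (1 - rho)) 2).
    apply majorized_scal, majorized_geom, Htau.
Qed.

Lemma Re_herglotz z : in_disc z ->
  Re (herglotz z) = (1 - Cmod z ^ 2) / Cmod (1 - z)%C ^ 2.
Proof.
intros Hz. assert (h := one_minus_neq0 z Hz). apply Cmod_gt_0 in h.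
assert (h2 : 0 < Cmod (1 - z)%C ^ 2) by (apply pow_lt, h).
rewrite !Cmod_sqr in *. destruct z as [a b]. simpl in *.
unfold herglotz, Cdiv, Cinv, Cmult, Cplus, Cminus, Copp, Re, RtoC; simpl in *.
field. nra.
Qed.

Lemma Re_herglotz_ge0 z : in_disc z -> 0 <= Re (herglotz z).
Proof.
intros Hz. rewrite Re_herglotz by exact Hz.
assert (h := Cmod_ge_0 z). unfold in_disc in Hz.
apply Rmult_le_pos; [nra|]. left. apply Rinv_0_lt_compat, pow_lt, Cmod_gt_0, one_minus_neq0, Hz.
Qed.

(** The denominator [D] is squared, and its two factors are used differently. One absorbs the
    weight, since [D / (1 - z)] has real part at least [s]. The other is bounded below by the
    difference of the moduli of its coefficients, whose squares differ by [4 s]. *)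
Lemma hker_weighted_bound s y z : 0 < s -> 0 <= y -> in_disc z ->
  Cmod (1 - z)%C * Cmod (hker s y z) <=
  (1 + s + y) / (2 * s ^ 2) *
   exp (Re (herglotz z) + atom_mass s y * Re (herglotz (atom_dir y * z))).
Proof.
intros Hs Hy Hz. unfold hker.
set (D := ((1 + s, - y)%R + (1 - s, y)%R * z)%C).
assert (h1 := one_minus_neq0 z Hz). assert (h1' := proj1 (Cmod_gt_0 _) h1).
assert (E1 : (D / (1 - z))%C = (herglotz z + (s, - y)%R)%C).
{ assert (ED : D = ((1 + z) + (s, - y)%R * (1 - z))%C).
  { unfold D. destruct z as [a b]. unfold Cmult, Cplus, Cminus, Copp, RtoC; simpl. f_equal; ring. }
  rewrite ED. unfold herglotz. field. exact h1. }
assert (B1 : s * Cmod (1 - z)%C <= Cmod D).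
{ replace D with (D / (1 - z) * (1 - z))%C by (field; exact h1).
  rewrite Cmod_mult. apply Rmult_le_compat_r; [lra|]. rewrite E1.
  eapply Rle_trans; [|apply re_le_Cmod]. eapply Rle_trans; [|apply Rle_abs].
  assert (h := Re_herglotz_ge0 z Hz). unfold Re in *. simpl in *. lra. }
assert (B2 : 2 * s / (1 + s + y) <= Cmod D).
{ set (A := Cmod (1 + s, - y)%R). set (A' := Cmod (1 - s, y)%R).
  assert (hA : A ^ 2 = (1 + s) ^ 2 + (- y) ^ 2) by apply Cmod_sqr.
  assert (hA' : A' ^ 2 = (1 - s) ^ 2 + y ^ 2) by apply Cmod_sqr.
  assert (hA0 : 0 <= A) by apply Cmod_ge_0. assert (hA'0 : 0 <= A') by apply Cmod_ge_0.
  assert (hAA : A' <= A) by (apply Cmod_pair_le; nra).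
  assert (hA1 : A <= 1 + s + y) by nra.
  assert (hD : A - A' <= Cmod D).
  { assert (h := Cmod_triangle D (- ((1 - s, y)%R * z))%C).
    assert (hE : @eq C (D + - ((1 - s, y)%R * z))%C (1 + s, - y)%R) by (unfold D; ring).
    rewrite hE in h.
    rewrite Cmod_opp, Cmod_mult in h. fold A A' in h. unfold in_disc in Hz.
    assert (h' := Cmod_ge_0 z). nra. }
  apply Rle_trans with (A - A'); [|exact hD].
  apply (Rmult_le_reg_r (1 + s + y)); [lra|].
  unfold Rdiv. rewrite Rmult_assoc, Rinv_l by lra. nra. }
assert (HD : 0 < Cmod D) by nra.
assert (HD0 : D <> RtoC 0) by (apply Cmod_gt_0, HD).
rewrite Cmod_mult, Cmod_cexp, Cmod_pow, Cmod_inv by exact HD0.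
replace (Re (herglotz z + RtoC (atom_mass s y) * herglotz (atom_dir y * z))%C)
  with (Re (herglotz z) + atom_mass s y * Re (herglotz (atom_dir y * z)))
  by (unfold Re; simpl; ring).
set (e := exp _). assert (he : 0 < e) by apply exp_pos.
assert (K : Cmod (1 - z)%C * (/ Cmod D) ^ 2 <= (1 + s + y) / (2 * s ^ 2)).
{ apply (Rmult_le_reg_r (Cmod D ^ 2 * (2 * s ^ 2))); [apply Rmult_lt_0_compat; nra|].
  replace (Cmod (1 - z)%C * (/ Cmod D) ^ 2 * (Cmod D ^ 2 * (2 * s ^ 2)))
    with ((s * Cmod (1 - z)%C) * (2 * s)) by (field; lra).
  replace ((1 + s + y) / (2 * s ^ 2) * (Cmod D ^ 2 * (2 * s ^ 2)))
    with (Cmod D * ((1 + s + y) * Cmod D)) by (field; lra).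
  apply Rmult_le_compat; [nra|lra|exact B1|].
  apply (Rmult_le_compat_l (1 + s + y)) in B2; [|lra].
  replace ((1 + s + y) * (2 * s / (1 + s + y))) with (2 * s) in B2 by (field; lra). exact B2. }
assert (h := Rmult_le_compat_r e _ _ ltac:(lra) K). lra.
Qed.

(** * Transport to the half-plane by the Cayley transform *)

Lemma cayley_neq w : 0 < Re w -> (w + 1)%C <> RtoC 0.
Proof. intros H. apply C_neq0_re. unfold Re in H. simpl. lra. Qed.

Lemma herglotz_cayley w : 0 < Re w -> herglotz (cayley w) = w.
Proof.
intros H. assert (h := cayley_neq w H). unfold herglotz, cayley.
field. split; [exact h|].
replace (w + 1 - (w - 1))%C with (RtoC 2) by ring. intros E. apply RtoC_inj in E. lra.
Qed.

Lemma cayley_herglotz z : in_disc z -> cayley (herglotz z) = z.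
Proof.
intros H. assert (h := one_minus_neq0 z H). unfold herglotz, cayley.
field. split; [exact h|].
replace (1 + z + (1 - z))%C with (RtoC 2) by ring. intros E. apply RtoC_inj in E. lra.
Qed.

Lemma cayley_in_disc w : 0 < Re w -> in_disc (cayley w).
Proof.
intros H. assert (h := cayley_neq w H). unfold in_disc, cayley.
rewrite Cmod_div by exact h. apply Cmod_gt_0 in h.
apply (Rmult_lt_reg_r (Cmod (w + 1)%C)); [exact h|].
unfold Rdiv. rewrite Rmult_assoc, Rinv_l, Rmult_1_r, Rmult_1_l by lra.
unfold Cmod. apply sqrt_lt_1_alt. split.
- assert (h1 := pow2_ge_0 (fst (w - 1)%C)). assert (h2 := pow2_ge_0 (snd (w - 1)%C)). lra.
- destruct w as [a b]. unfold Re in H; simpl in *. lra.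
Qed.

Lemma is_derive_cayley w : 0 < Re w ->
  @is_derive C_AbsRing (AbsRing_NormedModule C_AbsRing) cayley w (2 / (w + 1) ^ 2)%C.
Proof.
intros Hw. assert (h := cayley_neq w Hw).
(* [is_derive_comp] expects the inner derivative over the normed module of the ring itself. The
   estimate is the same for [C_NormedModule]; just the linearity component is proved again. *)
assert (K : @is_derive C_AbsRing C_NormedModule cayley w (2 / (w + 1) ^ 2)%C).
2:{ destruct K as [_ K]. split; [|exact K].
    apply (@is_linear_scal_l C_AbsRing (AbsRing_NormedModule C_AbsRing)). }
apply is_derive_Cmod. intros eps Heps.
exists (Rmin (Re w) (eps / 2)). split; [apply Rmin_pos; lra|]. intros u Hu.
assert (Hu1 := Rlt_le_trans _ _ _ Hu (Rmin_l _ _)).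
assert (Hu2 := Rlt_le_trans _ _ _ Hu (Rmin_r _ _)).
assert (Hre : 0 < Re u).
{ assert (k := re_le_Cmod (u - w)%C). apply Rabs_le_between in k.
  unfold Re in *; simpl in *. lra. }
assert (hu := cayley_neq u Hre).
replace (cayley u - cayley w - (u - w) * (2 / (w + 1) ^ 2))%C
  with (- (2) * (u - w) * (u - w) * / (u + 1) * / (w + 1) * / (w + 1))%C
  by (unfold cayley; field; split; assumption).
rewrite !Cmod_mult, !Cmod_inv, Cmod_opp, Cmod_R, Rabs_pos_eq by (assumption || lra).
assert (H1 : 0 < / Cmod (u + 1)%C <= 1).
{ assert (k := Cmod_ge_Re (u + 1)%C). unfold Re in *; simpl in k.
  apply Rinv_ge_1. lra. }
assert (H2 : 0 < / Cmod (w + 1)%C <= 1).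
{ assert (k := Cmod_ge_Re (w + 1)%C). unfold Re in *; simpl in k.
  apply Rinv_ge_1. lra. }
set (q := Cmod (u - w)%C) in *. assert (hq : 0 <= q) by apply Cmod_ge_0.
set (i := / Cmod (u + 1)%C) in *. set (j := / Cmod (w + 1)%C) in *.
assert (P1 : i * j <= 1) by nra. assert (P2 : 0 < i * j) by nra.
assert (P3 : 0 <= i * j * j <= 1) by nra.
replace (2 * q * q * i * j * j) with (2 * q * q * (i * j * j)) by ring.
assert (2 * q * q <= eps * q) by nra. assert (0 <= 2 * q * q) by nra. nra.
Qed.

Lemma is_derive_comp_cayley (F : C -> C) w l : 0 < Re w ->
  @is_derive C_AbsRing C_NormedModule F (cayley w) l ->
  @is_derive C_AbsRing C_NormedModule (fun w => F (cayley w)) w (l * (2 / (w + 1) ^ 2))%C.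
Proof.
intros Hw HF. rewrite Cmult_comm.
exact (@is_derive_comp C_AbsRing C_NormedModule F cayley w l _ HF (is_derive_cayley w Hw)).
Qed.

Lemma C_pair (a b : R) : @eq C (a, b) (RtoC a + Ci * RtoC b)%C.
Proof. unfold Ci, Cmult, Cplus, RtoC; simpl. f_equal; ring. Qed.

Lemma Ci_sqr : (Ci * Ci)%C = (- (1))%C.
Proof. unfold Ci, Cmult, Copp, RtoC; simpl. f_equal; ring. Qed.

Lemma hker_cayley s y w : 0 < s -> 0 < Re w ->
  (hker s y (cayley w) * (2 / (w + 1) ^ 2))%C = kder s y w.
Proof.
intros Hs Hw. assert (h := cayley_neq w Hw).
assert (h1 : (w - (0, y)%R)%C <> RtoC 0) by (apply C_neq0_re; unfold Re in Hw; simpl; lra).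
assert (h2 : (w - (0, y)%R + RtoC s)%C <> RtoC 0) by (apply C_neq0_re; unfold Re in Hw; simpl; lra).
assert (hy : (1, - y)%R <> RtoC 0) by (apply C_neq0_re; simpl; lra).
assert (hy2 : RtoC (1 + y ^ 2) <> RtoC 0) by (intros E; apply RtoC_inj in E; nra).
assert (two : RtoC 2 <> RtoC 0) by (intros E; apply RtoC_inj in E; lra).
assert (Ey : @eq C (0, y)%R (Ci * RtoC y)%C) by (rewrite C_pair; ring).
assert (Ey1 : @eq C (1, y)%R (1 + Ci * RtoC y)%C) by apply C_pair.
assert (Ey2 : @eq C (1, - y)%R (1 - Ci * RtoC y)%C) by (rewrite C_pair, RtoC_opp; ring).
unfold hker, kder. rewrite herglotz_cayley by exact Hw.
assert (EA : ((1 + s, - y)%R + (1 - s, y)%R * cayley w)%C = (2 * (w - (0, y)%R + RtoC s) / (w + 1))%C).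
{ rewrite (C_pair (1 + s)), (C_pair (1 - s)), RtoC_opp, RtoC_plus, RtoC_minus.
  rewrite Ey. unfold cayley. field. exact h. }
assert (EB : (RtoC (atom_mass s y) * herglotz (atom_dir y * cayley w))%C =
   (RtoC (s ^ 2) / (w - (0, y)%R) - (0, atom_mass s y * y)%R)%C).
{ assert (Eh : herglotz (atom_dir y * cayley w)%C = ((1 - (0, y)%R * w) / (w - (0, y)%R))%C).
  { assert (Hd : in_disc (atom_dir y * cayley w)%C)
      by (apply in_disc_mult; [rewrite Cmod_atom_dir; lra|apply cayley_in_disc, Hw]).
    assert (hd := one_minus_neq0 _ Hd).
    assert (Eom : (atom_dir y * cayley w)%C = (- ((1, y)%R * (w - 1)) / ((1, - y)%R * (w + 1)))%C)
      by (unfold atom_dir, cayley; field; split; assumption).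
    unfold herglotz. rewrite Eom. field_simplify_eq.
    - rewrite Ey, Ey1, Ey2. ring.
    - repeat split; try assumption.
      replace ((1, - y)%R * (w + 1) - - ((1, y)%R * (w - 1)))%C with (2 * (w - (0, y)%R))%C
        by (rewrite Ey, Ey1, Ey2; ring).
      apply Cmult_neq_0; assumption. }
  rewrite Eh.
  replace ((0, atom_mass s y * y)%R : C) with (Ci * RtoC y * RtoC (atom_mass s y))%C
    by (rewrite (C_pair 0), RtoC_mult; ring).
  unfold atom_mass. rewrite RtoC_div by nra.
  (* With [1 + y ^ 2] written as [1 - (i y) ^ 2], the claim becomes a rational identity in [w], [s]
     and [i y] that no longer involves the relation for [Ci]. *)
  replace (RtoC (1 + y ^ 2)) with (1 - (Ci * RtoC y) * (Ci * RtoC y))%C in *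
    by (rewrite RtoC_plus, RtoC_pow; replace ((Ci * RtoC y) * (Ci * RtoC y))%C with ((Ci * Ci) * RtoC y ^ 2)%C by ring; rewrite Ci_sqr; ring).
  rewrite Ey in *. field. split; assumption. }
rewrite EA, EB.
replace (w + (RtoC (s ^ 2) / (w - (0, y)%R) - (0, atom_mass s y * y)%R))%C
  with (w + RtoC (s ^ 2) / (w - (0, y)%R) - (0, atom_mass s y * y)%R)%C by ring.
set (e := cexp _).
field. repeat split; assumption.
Qed.

Lemma Re_segment (p q : C) t : Re (p + RtoC t * (q - p))%C = Re p + t * (Re q - Re p).
Proof. unfold Re; simpl. ring. Qed.

Lemma Im_segment (p q : C) t : Im (p + RtoC t * (q - p))%C = Im p + t * (Im q - Im p).
Proof. unfold Im; simpl. ring. Qed.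

Lemma Cmod_kder s y w : 0 < s -> 0 < Re w ->
  Cmod (kder s y w) =
  / 2 * exp (Re w + s ^ 2 * (Re w / Cmod (w - (0, y)%R)%C ^ 2)) * / Cmod (w - (0, y)%R + RtoC s)%C ^ 2.
Proof.
intros Hs Hw.
assert (h1 : (w - (0, y)%R)%C <> RtoC 0) by (apply C_neq0_re; unfold Re in Hw; simpl; lra).
assert (h2 : (w - (0, y)%R + RtoC s)%C <> RtoC 0) by (apply C_neq0_re; unfold Re in Hw; simpl; lra).
assert (two : RtoC 2 <> RtoC 0) by (intros E; apply RtoC_inj in E; lra).
unfold kder, Cdiv at 1. rewrite !Cmod_mult, Cmod_cexp, !Cmod_inv, Cmod_pow, Cmod_R, Rabs_pos_eq
  by (try apply Cpow_nz; assumption || lra).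
f_equal. f_equal. f_equal.
apply Cmod_gt_0 in h1. assert (h3 : 0 < Cmod (w - (0, y)%R)%C ^ 2) by (apply pow_lt, h1).
rewrite !Cmod_sqr in *. destruct w as [a b]. unfold Re, Cdiv, Cinv, Cmult, Cplus, Cminus, Copp, RtoC in *.
simpl in *. field. lra.
Qed.

Lemma exp_2_le : exp 2 <= 10.
Proof.
replace 2 with (1 + 1) by ring. rewrite exp_plus. assert (h := exp_le_3).
assert (h' := exp_pos 1). nra.
Qed.

Lemma exp_le x y : x <= y -> exp x <= exp y.
Proof. intros [H| ->]; [left; apply exp_increasing, H|right; reflexivity]. Qed.

(** Outside the disc of radius [s] about [iy] the second atom adds at most [Re w] to the exponent,
    so the exponential is at most [exp 2 <= 10]; the leading factor 1/2 makes it 5. *)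
Lemma kder_bound s y w : 1 <= s -> 0 < Re w <= 1 -> s ^ 2 <= Cmod (w - (0, y)%R)%C ^ 2 ->
  Cmod (kder s y w) <= 5.
Proof.
intros Hs Hw Hd. rewrite Cmod_kder by lra.
set (d := Cmod (w - (0, y)%R)%C ^ 2) in *. assert (hd : 0 < d) by nra.
assert (h1 : s ^ 2 * (Re w / d) <= 1).
{ apply (Rmult_le_reg_r d); [exact hd|]. unfold Rdiv.
  rewrite Rmult_assoc, Rmult_assoc, Rinv_l by lra. nra. }
assert (h2 : exp (Re w + s ^ 2 * (Re w / d)) <= 10).
{ eapply Rle_trans; [|apply exp_2_le]. apply exp_le. lra. }
assert (h3 : 1 <= Cmod (w - (0, y)%R + RtoC s)%C ^ 2).
{ assert (h := Cmod_ge_Re (w - (0, y)%R + RtoC s)%C). unfold Re in *; simpl in h. nra. }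
apply Rinv_ge_1 in h3. assert (h4 := exp_pos (Re w + s ^ 2 * (Re w / d))). nra.
Qed.

Lemma cos_1_ge : 1 / 2 <= cos 1.
Proof.
rewrite <- cos_PI3. apply cos_decr_1; assert (h := PI_4); assert (h' := PI2_3_2);
 unfold PI2 in *; lra.
Qed.

(** * The jump of a primitive across the second atom *)

Section Primitive.
Variables (s y : R) (F : C -> C).
Hypothesis Hs : 2 <= s.
Hypothesis Hsy : 2 * s <= y.
Hypothesis HF : forall w, 0 < Re w -> @is_derive C_AbsRing C_NormedModule F w (kder s y w).
Hypothesis HF1 : F (RtoC 1) = RtoC 0.

Let gam (t : R) : C := (s * cos t, y + s * sin t).
Let dgam (t : R) : C := (- (s * sin t), s * cos t).
Let kap : R := y - atom_mass s y * y.
Let q (t : R) : R := exp (2 * s * cos t) / (2 * s * (2 + 2 * cos t)).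

Lemma gam_derive t :
  is_derive (fun u => Re (gam u)) t (Re (dgam t)) /\ is_derive (fun u => Im (gam u)) t (Im (dgam t)).
Proof.
unfold gam, dgam, Re, Im; simpl; split; auto_derive; try exact I; ring.
Qed.

(* On the circle of radius [s] about the atom the exponent [w + s ^ 2 / (w - iy)] has constant
   imaginary part, so the integrand has constant phase. *)
Lemma kder_on_arc t : 0 < cos t ->
  (kder s y (gam t) * dgam t)%C = (RtoC (q t) * (Ci * cexp (0, kap)%R))%C.
Proof.
intros Hc.
set (u := (cos t, sin t)%R : C). set (u' := (cos t, - sin t)%R : C).
assert (Huu : (u * u')%C = RtoC 1).
{ unfold u, u', Cmult, RtoC; simpl. f_equal; [|ring].
  assert (h := sin2_cos2 t). unfold Rsqr in h. lra. }
assert (hu : u <> RtoC 0) by (apply C_neq0_re; simpl; lra).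
assert (hs : RtoC s <> RtoC 0) by (intros E; apply RtoC_inj in E; lra).
assert (two : RtoC 2 <> RtoC 0) by (intros E; apply RtoC_inj in E; lra).
assert (Esum : (u + u')%C = RtoC (2 * cos t))
  by (unfold u, u', Cplus, RtoC; simpl; f_equal; ring).
assert (E1 : (gam t - (0, y)%R)%C = (RtoC s * u)%C)
  by (unfold gam, u, Cminus, Copp, Cplus, Cmult, RtoC; simpl; f_equal; ring).
assert (E2 : dgam t = (Ci * RtoC s * u)%C)
  by (unfold dgam, u, Ci, Cmult, RtoC; simpl; f_equal; ring).
assert (E3 : (gam t + RtoC (s ^ 2) / (RtoC s * u) - (0, atom_mass s y * y)%R)%C =
   (RtoC (2 * s * cos t) + (0, kap)%R)%C).
{ replace (RtoC (s ^ 2) / (RtoC s * u))%C with (RtoC s * u')%C.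
  - unfold gam, u', kap, Cminus, Copp, Cplus, Cmult, RtoC; simpl; f_equal; ring.
  - rewrite RtoC_pow. replace (RtoC s * u')%C with (RtoC s * (u * u') / u)%C by (field; exact hu).
    rewrite Huu. field. split; assumption. }
unfold kder. rewrite E1, E2, E3, cexp_plus.
replace (cexp (RtoC (2 * s * cos t))) with (RtoC (exp (2 * s * cos t))).
2:{ unfold cexp, RtoC, Re, Im; simpl. rewrite cos_0, sin_0. f_equal; ring. }
set (K := cexp (0, kap)%R).
assert (E4 : (RtoC s * u + RtoC s)%C = (RtoC s * (u + 1))%C) by ring.
(* This is the second role of the squared denominator: it carries the phase [u], which cancels the
   phase of the tangent [dgam t]. *)
assert (E5 : ((u + 1) ^ 2)%C = (u * RtoC (2 + 2 * cos t))%C).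
{ rewrite RtoC_plus, <- Esum. replace (u * (RtoC 2 + (u + u')))%C with (u * 2 + u * u + u * u')%C by ring.
  rewrite Huu. ring. }
assert (hc2 : RtoC (2 + 2 * cos t) <> RtoC 0) by (intros E; apply RtoC_inj in E; lra).
rewrite E4, Cpow_mult_l, E5. unfold q.
rewrite RtoC_div, RtoC_mult, RtoC_mult by nra.
field. repeat split; assumption.
Qed.

Section Arc.
Variable phi : R.
Hypothesis Hphi : 1 <= phi <= PI.
Hypothesis Hcos : 0 < cos phi.

Lemma cos_on_arc t : - phi <= t <= phi -> cos phi <= cos t.
Proof.
intros Ht. destruct (Rle_dec 0 t) as [h|h].
- destruct (Req_dec t phi) as [->|h']; [lra|]. left. apply cos_decreasing_1; lra.
- rewrite <- (cos_neg t). destruct (Req_dec (- t) phi) as [->|h']; [lra|].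
  left. apply cos_decreasing_1; lra.
Qed.

Lemma gam_Re_pos t : - phi <= t <= phi -> 0 < Re (gam t).
Proof.
intros Ht. assert (h := cos_on_arc t Ht). unfold gam, Re; simpl. nra.
Qed.

Lemma arc_upper : Cmod (F (gam phi) - F (gam (- phi)))%C <= exp (2 * s).
Proof.
assert (hP := PI_4). assert (he := exp_pos (2 * s)).
(* The 8 comes from [2 * s * (2 + 2 * cos t) >= 8] for [s >= 2], and it compensates the length
   [2 * phi <= 8]. *)
apply Rle_trans with (exp (2 * s) / 8 * (phi - - phi)).
- apply (path_increment_le F (kder s y) gam dgam); [lra|lra| | |].
  + intros t Ht. apply HF, gam_Re_pos, Ht.
  + intros t _. apply gam_derive.
  + intros t Ht. assert (hc := cos_on_arc t Ht).
    rewrite kder_on_arc by lra.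
    rewrite !Cmod_mult, Cmod_cexp, Cmod_Ci, Cmod_R. simpl Re. rewrite exp_0.
    assert (h1 : exp (2 * s * cos t) <= exp (2 * s)).
    { apply exp_le. assert (h := COS_bound t). nra. }
    assert (h0 := exp_pos (2 * s * cos t)).
    assert (h2 : 8 <= 2 * s * (2 + 2 * cos t)) by nra.
    assert (h3 : 0 < / (2 * s * (2 + 2 * cos t)) <= / 8)
      by (split; [apply Rinv_0_lt_compat; lra|apply Rinv_le_contravar; lra]).
    rewrite Rabs_pos_eq.
    * unfold q, Rdiv. rewrite !Rmult_1_r. apply Rmult_le_compat; lra.
    * unfold q, Rdiv. apply Rmult_le_pos; lra.
- nra.
Qed.

(** A unimodular factor [e] undoes the constant phase, after which [Re (e * F)] increases along the
    arc with derivative [q]. The part [[-1, 1]], inside the arc since [1 <= phi], has [cos t >= 1/2]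
    and hence [q t >= exp s / (8 * s)]. *)
Lemma arc_lower : exp s / (4 * s) <= Cmod (F (gam phi) - F (gam (- phi)))%C.
Proof.
set (e := (- Ci * cexp (0, - kap)%R)%C).
set (p := fun t => Re (e * F (gam t))%C).
assert (Hp : forall t, - phi <= t <= phi -> is_derive p t (q t)).
{ intros t Ht. assert (hc := cos_on_arc t Ht).
  replace (q t) with (Re (e * (kder s y (gam t) * dgam t))%C).
  - apply is_derive_along_path; [apply HF, gam_Re_pos, Ht|apply gam_derive|apply gam_derive].
  - rewrite kder_on_arc by lra. unfold e.
    replace (- Ci * cexp (0, - kap)%R * (RtoC (q t) * (Ci * cexp (0, kap)%R)))%C
      with (- (Ci * Ci) * (cexp (0, - kap)%R * cexp (0, kap)%R) * RtoC (q t))%C by ring.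
    rewrite <- cexp_plus, Ci_sqr.
    replace ((0, - kap)%R + (0, kap)%R)%C with (RtoC 0)
      by (unfold Cplus, RtoC; simpl; f_equal; ring).
    unfold cexp, RtoC, Re, Im; simpl. rewrite exp_0, cos_0, sin_0. ring. }
assert (Hcont : forall t, - phi <= t <= phi -> continuity_pt p t).
{ intros t Ht. apply continuity_pt_filterlim, (@ex_derive_continuous R_AbsRing R_NormedModule).
  exists (q t). apply Hp, Ht. }
assert (Hinc : forall a b m, - phi <= a -> a <= b -> b <= phi ->
   (forall t, a <= t <= b -> m <= q t) -> m * (b - a) <= p b - p a).
{ intros a b m h1 h2 h3 Hm.
  destruct (MVT_gen p a b q) as [c [Hc E]];
    rewrite ?Rmin_left, ?Rmax_right in * by lra.
  - intros t Ht. apply Hp; lra.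
  - intros t Ht. apply Hcont; lra.
  - rewrite E. apply Rmult_le_compat_r; [lra|]. apply Hm; lra. }
assert (Hq0 : forall t, - phi <= t <= phi -> 0 <= q t).
{ intros t Ht. assert (hc := cos_on_arc t Ht). unfold q.
  apply Rmult_le_pos; [left; apply exp_pos|]. left; apply Rinv_0_lt_compat. nra. }
assert (Hq1 : forall t, - (1) <= t <= 1 -> exp s / (8 * s) <= q t).
{ intros t Ht. assert (h1 : 1 / 2 <= cos t).
  { eapply Rle_trans; [apply cos_1_ge|].
    destruct (Rle_dec 0 t) as [h|h].
    - destruct (Req_dec t 1) as [->|h']; [lra|]. left. apply cos_decreasing_1; lra.
    - rewrite <- (cos_neg t). destruct (Req_dec (- t) 1) as [->|h']; [lra|].
      left. apply cos_decreasing_1; lra. }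
  assert (h2 := COS_bound t). unfold q, Rdiv.
  apply Rmult_le_compat.
  - left; apply exp_pos.
  - left; apply Rinv_0_lt_compat; lra.
  - apply exp_le. nra.
  - apply Rinv_le_contravar; nra. }
assert (k1 := Hinc (- phi) (- (1)) 0 ltac:(lra) ltac:(lra) ltac:(lra) ltac:(intros; apply Hq0; lra)).
assert (k2 := Hinc (- (1)) 1 (exp s / (8 * s)) ltac:(lra) ltac:(lra) ltac:(lra) ltac:(intros; apply Hq1; lra)).
assert (k3 := Hinc 1 phi 0 ltac:(lra) ltac:(lra) ltac:(lra) ltac:(intros; apply Hq0; lra)).
assert (He : Cmod e = 1).
{ unfold e. rewrite Cmod_mult, Cmod_opp, Cmod_Ci, Cmod_cexp. simpl Re. rewrite exp_0. ring. }
assert (k4 := Cmod_ge_Re (e * (F (gam phi) - F (gam (- phi))))%C).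
rewrite Cmod_mult, He, Rmult_1_l in k4.
replace (Re (e * (F (gam phi) - F (gam (- phi))))%C) with (p phi - p (- phi)) in k4
  by (unfold p, Re; simpl; ring).
replace (exp s / (4 * s)) with (exp s / (8 * s) * (1 - - (1))) by (field; lra). lra.
Qed.
End Arc.

Lemma Cmod_sub_i_sqr w : Cmod (w - (0, y)%R)%C ^ 2 = Re w ^ 2 + (Im w - y) ^ 2.
Proof. rewrite Cmod_sqr. unfold Re, Im; simpl. ring. Qed.

Lemma primitive_segment (p p' : C) :
  (forall t, 0 <= t <= 1 ->
     0 < Re p + t * (Re p' - Re p) <= 1 /\
     s ^ 2 <= (Re p + t * (Re p' - Re p)) ^ 2 + (Im p + t * (Im p' - Im p) - y) ^ 2) ->
  Cmod (F p' - F p)%C <= 5 * Cmod (p' - p)%C.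
Proof.
intros H. apply (segment_increment_le F (kder s y)); [lra|]. intros t Ht.
destruct (H t Ht) as [H1 H2].
rewrite <- Re_segment in H1, H2. rewrite <- Im_segment in H2. split.
- apply HF. lra.
- apply kder_bound; [lra|exact H1|]. rewrite Cmod_sub_i_sqr. exact H2.
Qed.

(** The segment from 1, where [F] vanishes, stays at vertical distance at least [y / 2 >= s] from
    the atom, so [kder_bound] holds all along it: an atom high above [w] is not felt
    exponentially. *)
Lemma primitive_below w : 0 < Re w <= 1 -> 0 <= Im w <= y / 2 -> Cmod (F w) <= 5 * (1 + Im w).
Proof.
intros Hx Hy.
replace (F w) with (F w - F (RtoC 1))%C by (rewrite HF1; ring).
eapply Rle_trans; [apply primitive_segment|].
- intros t Ht. change (Re (RtoC 1)) with 1. change (Im (RtoC 1)) with 0.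
  assert (k1 : 0 <= t * (1 - Re w)) by (apply Rmult_le_pos; lra).
  assert (k2 : 0 <= (1 - t) * (1 - Re w)) by (apply Rmult_le_pos; lra).
  assert (k3 : 0 <= (1 - t) * Im w) by (apply Rmult_le_pos; lra).
  split; [lra|].
  assert (k4 : s <= - (0 + t * (Im w - 0) - y)) by lra.
  assert (k5 := pow2_ge_0 (1 + t * (Re w - 1))). nra.
- apply Rmult_le_compat_l; [lra|]. eapply Rle_trans; [apply Cmod_le_plus|].
  unfold Re, Im in *; simpl. rewrite (Rabs_left1 (fst w + - (1))), (Rabs_pos_eq (snd w + - 0)) by lra.
  lra.
Qed.

(** The path runs from 1 straight to the lower end of the arc, along the arc, then vertically up to
    [w]. The straight legs avoid the disc about the atom and cost the linear error; [D] is the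
    increment over the arc. Its lower bound serves for the dominant kernel, its upper bound for the
    kernels with smaller index. *)
Lemma primitive_above w : 0 < Re w <= 1 -> y + s <= Im w ->
  exists D, Cmod D <= exp (2 * s) /\ exp s / (4 * s) <= Cmod D /\
            Cmod (F w - D)%C <= 5 * (1 + Im w).
Proof.
(* This angle gives both ends of the arc the real part of [w], which makes the last leg vertical. *)
intros Hx Hy. set (phi := acos (Re w / s)).
assert (Hr : 0 < Re w / s <= 1 / 2).
{ split; [apply Rdiv_lt_0_compat; lra|].
  apply (Rmult_le_reg_r s); [lra|]. unfold Rdiv. rewrite Rmult_assoc, Rinv_l by lra. lra. }
assert (Hcos : cos phi = Re w / s) by (apply cos_acos; lra).
assert (Hb := acos_bound (Re w / s)). fold phi in Hb.
assert (Hphi : 1 <= phi <= PI).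
{ split; [|lra]. destruct (Rle_dec 1 phi) as [h|h]; [exact h|].
  assert (h' : cos 1 < cos phi) by (apply cos_decreasing_1; assert (h2 := PI2_3_2); unfold PI2 in *; lra).
  assert (h2 := cos_1_ge). lra. }
assert (Hc0 : 0 < cos phi) by lra.
assert (E1 : Re (gam phi) = Re w) by (unfold gam, Re at 1; simpl; rewrite Hcos; field; lra).
assert (E2 : Re (gam (- phi)) = Re w) by (unfold gam, Re at 1; simpl; rewrite cos_neg, Hcos; field; lra).
set (sg := s * sin phi).
assert (I1 : Im (gam phi) = y + sg) by reflexivity.
assert (I2 : Im (gam (- phi)) = y - sg) by (unfold gam, Im, sg; simpl; rewrite sin_neg; ring).
assert (Hsg : 0 <= sg).
{ apply Rmult_le_pos; [lra|]. apply sin_ge_0; lra. }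
assert (Hpyth : Re w ^ 2 + sg ^ 2 = s ^ 2).
{ assert (h := sin2_cos2 phi). unfold Rsqr in h.
  replace (Re w) with (s * cos phi) by (rewrite Hcos; field; lra). unfold sg.
  replace ((s * cos phi) ^ 2 + (s * sin phi) ^ 2)
    with (s ^ 2 * (sin phi * sin phi + cos phi * cos phi)) by ring.
  rewrite h. ring. }
assert (Hsg2 : sg <= s) by nra.
exists (F (gam phi) - F (gam (- phi)))%C.
split; [apply arc_upper; assumption|]. split; [apply arc_lower; assumption|].
assert (K1 : Cmod (F w - F (gam phi))%C <= 5 * Cmod (w - gam phi)%C).
{ apply primitive_segment. intros t Ht. rewrite E1, I1. split; [lra|].
  assert (0 <= t * (Im w - (y + sg))) by (apply Rmult_le_pos; lra). nra. }
assert (K2 : Cmod (F (gam (- phi)) - F (RtoC 1))%C <= 5 * Cmod (gam (- phi) - RtoC 1)%C).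
{ apply primitive_segment. intros t Ht. rewrite E2, I2.
  change (Re (RtoC 1)) with 1. change (Im (RtoC 1)) with 0.
  assert (k1 : 0 <= (1 - t) * (1 - Re w)) by (apply Rmult_le_pos; lra).
  assert (k2 : 0 <= (1 - t) * (y - sg)) by (apply Rmult_le_pos; lra).
  split; [nra|].
  replace (1 + t * (Re w - 1)) with (Re w + (1 - t) * (1 - Re w)) by ring.
  replace (0 + t * (y - sg - 0) - y) with (- (sg + (1 - t) * (y - sg))) by ring. nra. }
rewrite HF1 in K2.
replace (F w - (F (gam phi) - F (gam (- phi))))%C
  with ((F w - F (gam phi)) + (F (gam (- phi)) - RtoC 0))%C by ring.
eapply Rle_trans; [apply Cmod_triangle|].
assert (L1 : Cmod (w - gam phi)%C <= Im w - y - sg).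
{ eapply Rle_trans; [apply Cmod_le_plus|].
  replace (fst (w - gam phi)%C) with 0 by (unfold Re in E1; simpl in *; lra).
  replace (snd (w - gam phi)%C) with (Im w - y - sg) by (unfold Im, sg; simpl; ring).
  rewrite Rabs_R0, Rabs_pos_eq by lra. lra. }
assert (L2 : Cmod (gam (- phi) - RtoC 1)%C <= 1 + (y - sg)).
{ eapply Rle_trans; [apply Cmod_le_plus|].
  replace (fst (gam (- phi) - RtoC 1)%C) with (Re w - 1) by (rewrite <- E2; unfold Re; simpl; ring).
  replace (snd (gam (- phi) - RtoC 1)%C) with (y - sg) by (rewrite <- I2; unfold Im; simpl; ring).
  rewrite Rabs_left1, Rabs_pos_eq by lra. lra. }
lra.
Qed.
End Primitive.

(** * The superposition of kernels *)

(** The ratio 1000 separates the scales with room to spare: for [j < k] the jump bound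
    [exp (2 * sk j)] is at most [exp (sk k / 500)], and for [j > k] the height [256 * yk k] is still
    below [yk j / 2]. *)
Definition sk (k : nat) : R := 1000 ^ S k.
Definition yk (k : nat) : R := (INR k + 2) * sk k.

Lemma sk_ge k : 1000 <= sk k.
Proof.
unfold sk. simpl. assert (h : 1 ^ k <= 1000 ^ k) by (apply pow_incr; lra).
rewrite pow1 in h. lra.
Qed.

Lemma sk_S k : sk (S k) = 1000 * sk k.
Proof. reflexivity. Qed.

Lemma sk_ge_index k : INR k + 4 <= sk k.
Proof.
induction k; [unfold sk; simpl; lra|].
rewrite sk_S, S_INR. assert (h := pos_INR k). lra.
Qed.

Lemma sk_ge_pow2 k : 2 ^ k <= sk k.
Proof.
unfold sk. simpl. assert (h : 2 ^ k <= 1000 ^ k) by (apply pow_incr; lra).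
assert (h' : 0 < 2 ^ k) by (apply pow_lt; lra). lra.
Qed.

Lemma sk_lt j k : (j < k)%nat -> 1000 * sk j <= sk k.
Proof.
intros H. replace k with (S (k - S j) + j)%nat by lia.
induction (k - S j)%nat as [|m IH]; [rewrite <- sk_S; apply Rle_refl|].
change (S (S m) + j)%nat with (S (S m + j)). rewrite sk_S.
assert (h := sk_ge j). lra.
Qed.

Lemma yk_ge k : 2 * sk k <= yk k.
Proof. unfold yk. assert (h := sk_ge k). assert (h' := pos_INR k). nra. Qed.

Lemma yk_lt j k : (j < k)%nat -> 1000 * yk j <= yk k.
Proof.
intros H. unfold yk. assert (h := sk_lt j k H). assert (h1 := sk_ge j).
assert (h2 := pos_INR j). assert (h3 : INR j <= INR k) by (apply le_INR; lia).
assert (h4 : (INR j + 2) * (1000 * sk j) <= (INR k + 2) * sk k) by (apply Rmult_le_compat; lra).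
lra.
Qed.

Lemma sk_yk k : sk k ^ 2 <= 1 + yk k ^ 2.
Proof. assert (h := yk_ge k). assert (h' := sk_ge k). nra. Qed.

Definition hk (k : nat) (z : C) : C := (RtoC ((1 / 2) ^ k) * hker (sk k) (yk k) z)%C.

Definition major (rho : R) : R := exp (6 / (1 - rho)) * (/ (1 - rho)) ^ 2.

Lemma major_mono r r' : 0 <= r <= r' -> r' < 1 -> 0 < major r <= major r'.
Proof.
intros H H'. unfold major.
assert (h1 : 0 < / (1 - r)) by (apply Rinv_0_lt_compat; lra).
assert (h2 : / (1 - r) <= / (1 - r')) by (apply Rinv_le_contravar; lra).
split; [apply Rmult_lt_0_compat; [apply exp_pos|apply pow_lt, h1]|].
apply Rmult_le_compat; [left; apply exp_pos|apply pow2_ge_0| |].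
- apply exp_le. unfold Rdiv. lra.
- apply pow_incr. lra.
Qed.

Lemma half_pow_pos k : 0 < (1 / 2) ^ k.
Proof. apply pow_lt; lra. Qed.

Lemma hk_majorized k : majorized (hk k) (fun rho => (1 / 2) ^ k * major rho).
Proof.
eapply majorized_ext; [| |apply (majorized_scal (RtoC ((1 / 2) ^ k))), (hker_majorized (sk k) (yk k))].
- reflexivity.
- intros rho _. rewrite Cmod_R, Rabs_pos_eq by (left; apply half_pow_pos). apply Rle_refl.
- assert (h := sk_ge k). lra.
- apply sk_yk.
Qed.

Lemma is_series_half : is_series (fun k => (1 / 2) ^ k) 2.
Proof.
assert (h := is_series_geom (1 / 2) ltac:(rewrite Rabs_pos_eq; lra)).
replace (/ (1 - 1 / 2)) with 2 in h by field. exact h.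
Qed.

Lemma is_series_hk_major rho : is_series (fun k => (1 / 2) ^ k * major rho) (2 * major rho).
Proof.
rewrite Rmult_comm. eapply is_series_ext; [|apply (is_series_scal_R (major rho) _ _ is_series_half)].
intros n. ring_R.
Qed.

Definition Gsum (z : C) : C := epsilon (inhabits (RtoC 0)) (fun l => is_Cseries (fun k => hk k z) l).

Lemma hk_bound k z : in_disc z -> Cmod (hk k z) <= (1 / 2) ^ k * major (Cmod z).
Proof. intros Hz. exact (majorized_bound _ _ z (hk_majorized k) Hz). Qed.

Lemma is_Cseries_Gsum z : in_disc z -> is_Cseries (fun k => hk k z) (Gsum z).
Proof.
intros Hz. unfold Gsum. apply epsilon_spec.
apply (ex_Cseries _ (fun k => (1 / 2) ^ k * major (Cmod z)) (2 * major (Cmod z))).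
- intros k. apply hk_bound, Hz.
- intros N. apply sum_n_le_series; [|apply is_series_hk_major].
  intros n. eapply Rle_trans; [apply Cmod_ge_0|apply (hk_bound n z Hz)].
Qed.

Lemma Gsum_tail J z r : in_disc z -> Cmod z <= r < 1 ->
  Cmod (Gsum z - sum_n (fun k => hk k z) J)%C <= (1 / 2) ^ J * major r.
Proof.
intros Hz Hr. assert (h0 := Cmod_ge_0 z).
eapply Rle_trans.
- apply (Cseries_tail _ _ (fun k => (1 / 2) ^ k * major (Cmod z)) (2 * major (Cmod z)) J).
  + apply is_Cseries_Gsum, Hz.
  + intros k. apply hk_bound, Hz.
  + apply is_series_hk_major.
- assert (E : sum_n (fun k => (1 / 2) ^ k * major (Cmod z)) J = (2 - (1 / 2) ^ J) * major (Cmod z)).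
  { induction J; [rewrite sum_O; simpl; ring_R|]. rewrite sum_n_SR, IHJ. simpl pow.
    match goal with |- ?x = ?y => change (x = y :> R) end. field. }
  rewrite E. assert (h := major_mono (Cmod z) r ltac:(lra) ltac:(lra)).
  assert (h' := half_pow_pos J). nra.
Qed.

Lemma Gsum_majorized : majorized Gsum (fun rho => 2 * major rho).
Proof.
apply (majorized_series hk (fun k rho => (1 / 2) ^ k * major rho)).
- apply hk_majorized.
- intros rho _. apply is_series_hk_major.
- apply is_Cseries_Gsum.
Qed.

Definition witness (z : C) : C := ((1 - z) * Gsum z)%C.

Lemma witness_majorized : exists B, majorized witness B.
Proof.
eexists. apply majorized_mult; [|apply Gsum_majorized].
eapply majorized_ext; [| |apply majorized_plus;
  [apply (majorized_const (RtoC 1))|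
   apply (majorized_scal (- (1))%C), majorized_mulX, (majorized_const (RtoC 1))]].
- intros z _. cbv beta. ring.
- intros rho _. cbv beta. apply Rle_refl.
Qed.

(** * Primitives of the kernels and the dominant term *)

Lemma hk_primitive k : exists F : C -> C, F (RtoC 0) = RtoC 0 /\
  forall z, in_disc z -> @is_derive C_AbsRing C_NormedModule F z (hker (sk k) (yk k) z).
Proof.
assert (h := sk_ge k).
destruct (hker_majorized (sk k) (yk k) ltac:(lra) (sk_yk k)) as [a [Ha _]].
destruct (primitive_of_pseries a _ Ha) as [F [_ [H1 H2]]].
exists F. split; assumption.
Qed.

Definition Fk (k : nat) : C -> C := epsilon (inhabits (fun z : C => z)) (fun F =>
  F (RtoC 0) = RtoC 0 /\
  forall z, in_disc z -> @is_derive C_AbsRing C_NormedModule F z (hker (sk k) (yk k) z)).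

Lemma Fk_spec k : Fk k (RtoC 0) = RtoC 0 /\
  forall z, in_disc z -> @is_derive C_AbsRing C_NormedModule (Fk k) z (hker (sk k) (yk k) z).
Proof. unfold Fk. apply epsilon_spec. apply hk_primitive. Qed.

Lemma is_derive_sum_Fk J z : in_disc z ->
  @is_derive C_AbsRing C_NormedModule
    (fun u => sum_n (fun k => RtoC ((1 / 2) ^ k) * Fk k u)%C J) z (sum_n (fun k => hk k z) J).
Proof.
intros Hz.
assert (Hk : forall k, @is_derive C_AbsRing C_NormedModule
   (fun u => RtoC ((1 / 2) ^ k) * Fk k u)%C z (hk k z)).
{ intros k. apply is_derive_Cmod. intros eps Heps.
  set (c := RtoC ((1 / 2) ^ k)).
  assert (hc : 0 <= Cmod c) by apply Cmod_ge_0.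
  destruct (proj1 (is_derive_Cmod _ _ _) (proj2 (Fk_spec k) z Hz) (eps / (Cmod c + 1))
    ltac:(apply Rdiv_lt_0_compat; lra)) as [d [Hd Hu]].
  exists d. split; [exact Hd|]. intros u Hu'. specialize (Hu u Hu').
  unfold hk. fold c.
  replace (c * Fk k u - c * Fk k z - (u - z) * (c * hker (sk k) (yk k) z))%C
    with (c * (Fk k u - Fk k z - (u - z) * hker (sk k) (yk k) z))%C by ring.
  rewrite Cmod_mult. assert (hq := Cmod_ge_0 (u - z)%C).
  apply Rle_trans with ((Cmod c + 1) * (eps / (Cmod c + 1) * Cmod (u - z)%C)).
  - apply Rmult_le_compat; [lra|apply Cmod_ge_0|lra|exact Hu].
  - right; field; lra. }
induction J as [|J IH].
- rewrite sum_O. eapply is_derive_ext; [|apply (Hk O)]. intros u. rewrite sum_O. reflexivity.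
- rewrite sum_n_SC. eapply is_derive_ext; [|apply (@is_derive_plus C_AbsRing C_NormedModule _ _ z _ _ IH (Hk (S J)))].
  intros u. symmetry. apply (sum_n_SC (fun k => RtoC ((1 / 2) ^ k) * Fk k u)%C).
Qed.

Lemma in_disc_scale z t : in_disc z -> 0 <= t <= 1 ->
  Cmod (RtoC 0 + RtoC t * (z - RtoC 0))%C <= Cmod z.
Proof.
intros Hz Ht. replace (RtoC 0 + RtoC t * (z - RtoC 0))%C with (RtoC t * z)%C by ring.
rewrite Cmod_mult, Cmod_R, Rabs_pos_eq by lra. assert (h := Cmod_ge_0 z). nra.
Qed.

(** The difference of [H] and a finite sum of primitives has the tail of [Gsum] as derivative.
    Integrating over the segment from 0 to [z], of length less than 1, keeps the tail bound, so no
    infinite series of the [Fk] has to be formed. *)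
Lemma primitive_approx (H : C -> C) J z :
  H (RtoC 0) = RtoC 0 ->
  (forall z, in_disc z -> @is_derive C_AbsRing C_NormedModule H z (Gsum z)) ->
  in_disc z ->
  Cmod (H z - sum_n (fun k => RtoC ((1 / 2) ^ k) * Fk k z)%C J)%C <= (1 / 2) ^ J * major (Cmod z).
Proof.
intros H0 H1 Hz. assert (hz := Cmod_ge_0 z). unfold in_disc in Hz.
set (S := fun u => sum_n (fun k => RtoC ((1 / 2) ^ k) * Fk k u)%C J).
assert (hm := major_mono (Cmod z) (Cmod z) ltac:(lra) Hz).
assert (hp := half_pow_pos J).
assert (K : Cmod ((H z - S z) - (H (RtoC 0) - S (RtoC 0)))%C
   <= (1 / 2) ^ J * major (Cmod z) * Cmod (z - RtoC 0)%C).
{ apply (segment_increment_le (fun u => H u - S u)%C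
     (fun u => Gsum u - sum_n (fun k => hk k u) J)%C).
  - nra.
  - intros t Ht. assert (h := in_disc_scale z t Hz Ht).
    set (u := (RtoC 0 + RtoC t * (z - RtoC 0))%C) in *.
    assert (Hu : in_disc u) by (unfold in_disc; lra). split.
    + apply (@is_derive_minus C_AbsRing C_NormedModule); [apply H1, Hu|apply is_derive_sum_Fk, Hu].
    + apply Gsum_tail; [exact Hu|lra]. }
assert (S0 : S (RtoC 0) = RtoC 0).
{ unfold S. clear. induction J as [|J IH].
  - rewrite sum_O, (proj1 (Fk_spec O)). ring_C.
  - rewrite sum_n_SC, IH, (proj1 (Fk_spec _)). ring_C. }
rewrite H0, S0 in K.
replace (H z - S z - (RtoC 0 - RtoC 0))%C with (H z - S z)%C in K by ring.
replace (z - RtoC 0)%C with z in K by ring.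
eapply Rle_trans; [exact K|].
assert (hP : 0 <= (1 / 2) ^ J * major (Cmod z)) by (apply Rmult_le_pos; lra). nra.
Qed.

Lemma Cmod_sum_n_isolate (u : nat -> C) (b : nat -> R) k J : (k <= J)%nat ->
  (forall j, 0 <= b j) ->
  (forall j, j <> k -> Cmod (u j) <= b j) ->
  Cmod (u k) - sum_n b J <= Cmod (sum_n u J).
Proof.
intros Hk Hb0 Hb. set (v := fun j => if Nat.eq_dec j k then RtoC 0 else u j).
assert (Hv : Cmod (sum_n v J) <= sum_n b J).
{ apply Cmod_sum_n_le. intros n _. unfold v. destruct (Nat.eq_dec n k); [rewrite Cmod_0; apply Hb0|apply Hb; assumption]. }
assert (E : sum_n u J = (sum_n v J + u k)%C).
{ induction Hk as [|J Hk IH].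
  - assert (Hlt : forall m, (m < k)%nat -> sum_n u m = sum_n v m).
    { induction m; intros Hm.
      - rewrite !sum_O. unfold v. destruct (Nat.eq_dec 0 k); [lia|reflexivity].
      - rewrite !sum_n_SC, IHm by lia. unfold v at 3. destruct (Nat.eq_dec (S m) k); [lia|reflexivity]. }
    destruct k as [|k].
    + rewrite !sum_O. unfold v. simpl. ring_C.
    + rewrite !sum_n_SC, Hlt by lia. unfold v at 3.
      destruct (Nat.eq_dec (S k) (S k)); [|lia]. ring_C.
  - assert (Hv' : Cmod (sum_n v J) <= sum_n b J).
    { apply Cmod_sum_n_le. intros n _. unfold v. destruct (Nat.eq_dec n k); [rewrite Cmod_0; apply Hb0|apply Hb; assumption]. }
    rewrite !sum_n_SC, (IH Hv'). unfold v at 3.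
    destruct (Nat.eq_dec (S J) k); [lia|]. ring_C. }
assert (E' : (sum_n u J + - sum_n v J)%C = u k) by (rewrite E; ring_C).
assert (h := Cmod_triangle (sum_n u J) (- sum_n v J)%C). rewrite E', Cmod_opp in h. lra.
Qed.

(** The fourth power of [exp (s / 16) >= s / 16] is at least [s ^ 4 / 65536], and [10 ^ 6 / 65536]
    exceeds 15. *)
Lemma exp_ge_square s : 1000 <= s -> 15 * s ^ 2 <= exp (s / 4).
Proof.
intros Hs. replace (s / 4) with (s / 16 + s / 16 + (s / 16 + s / 16)) by field.
rewrite !exp_plus. assert (h := exp_ineq1_le (s / 16)). set (e := exp (s / 16)) in *.
assert (h1 : (s / 16) ^ 2 <= e * e) by nra.
assert (h2 : (s / 16) ^ 2 * (s / 16) ^ 2 <= e * e * (e * e)) by (apply Rmult_le_compat; nra).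
assert (h3 : 1000000 <= s ^ 2) by nra.
assert (h4 : 1000000 * s ^ 2 <= s ^ 2 * s ^ 2) by nra.
replace ((s / 16) ^ 2 * (s / 16) ^ 2) with (s ^ 2 * s ^ 2 / 65536) in h2 by field. lra.
Qed.

(** The budget for [s = sk k]: [/ s] bounds the weight from below and [exp s / (4 * s)] the jump.
    Subtracted are the other kernels, whose weights sum to at most 2, the error of the straight legs
    for the kernel [k] itself, and 1 for the truncated tail. *)
Lemma dominant_term_arith s : 1000 <= s ->
  exp (s / 2) <= / s * (exp s / (4 * s)) - 2 * (exp (s / 500) + 5 * (1 + 256 * s ^ 2))
     - 5 * (1 + 256 * s ^ 2) - 1.
Proof.
intros Hs. assert (h := exp_ge_square s Hs).
assert (E1 : exp (s / 2) = exp (s / 4) * exp (s / 4)) by (rewrite <- exp_plus; f_equal; field).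
assert (E2 : exp s = exp (s / 2) * exp (s / 2)) by (rewrite <- exp_plus; f_equal; field).
assert (h500 : exp (s / 500) <= exp (s / 2)) by (apply exp_le; lra).
assert (hs2 : 1000000 <= s ^ 2) by nra.
set (X := exp (s / 2)) in *.
assert (HX : 225 * (s ^ 2 * s ^ 2) <= X).
{ rewrite E1. assert (h' : (15 * s ^ 2) * (15 * s ^ 2) <= exp (s / 4) * exp (s / 4))
    by (apply Rmult_le_compat; lra). lra. }
assert (HX2 : 225000000 * s ^ 2 <= X) by nra.
assert (h3 : 56 * X <= / s * (exp s / (4 * s))).
{ rewrite E2. replace (/ s * (X * X / (4 * s))) with (X * (X / (4 * s ^ 2))) by (field; lra).
  assert (h4 : 56 <= X / (4 * s ^ 2)).
  { apply (Rmult_le_reg_r (4 * s ^ 2)); [lra|]. unfold Rdiv. rewrite Rmult_assoc, Rinv_l by lra. lra. }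
  assert (0 < X) by lra. nra. }
lra.
Qed.

Lemma Fk_cayley_derive k w : 0 < Re w ->
  @is_derive C_AbsRing C_NormedModule (fun w => Fk k (cayley w)) w (kder (sk k) (yk k) w).
Proof.
intros Hw. assert (h := sk_ge k). rewrite <- hker_cayley by lra.
apply is_derive_comp_cayley; [exact Hw|]. apply Fk_spec, cayley_in_disc, Hw.
Qed.

Lemma Fk_cayley_1 k : Fk k (cayley (RtoC 1)) = RtoC 0.
Proof.
replace (cayley (RtoC 1)) with (RtoC 0); [apply Fk_spec|].
unfold cayley. field.
Qed.

(** The strip is above atom [k], since [2 * yk k >= yk k + sk k], and far below all later atoms. So
    [primitive_above] applies for indices up to [k] and [primitive_below] for larger ones, and the
    jump of index [k] outweighs the rest. *)
Lemma primitive_lower_bound (H : C -> C) k z :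
  H (RtoC 0) = RtoC 0 ->
  (forall z, in_disc z -> @is_derive C_AbsRing C_NormedModule H z (Gsum z)) ->
  in_disc z -> 0 < Re (herglotz z) <= 1 -> 2 * yk k <= Im (herglotz z) <= 256 * yk k ->
  exp (sk k / 2) <= Cmod (H z).
Proof.
intros H0 H1 Hz Hx Hy. set (w := herglotz z) in *.
assert (Ez : z = cayley w) by (symmetry; apply cayley_herglotz, Hz).
assert (hs := sk_ge k). assert (hy := yk_ge k).
set (M := exp (sk k / 500) + 5 * (1 + Im w)).
assert (hM : 0 <= M) by (unfold M; assert (h := exp_pos (sk k / 500)); lra).
assert (Hother : forall j, j <> k -> Cmod (Fk j z) <= M).
{ intros j Hj. rewrite Ez. assert (hsj := sk_ge j). assert (hyj := yk_ge j).
  destruct (proj1 (Nat.lt_gt_cases j k) Hj) as [Hjk|Hjk].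
  - assert (h1 := yk_lt j k Hjk). assert (h2 := sk_lt j k Hjk).
    destruct (primitive_above (sk j) (yk j) (fun w => Fk j (cayley w)) ltac:(lra) ltac:(lra)
      (Fk_cayley_derive j) (Fk_cayley_1 j) w Hx ltac:(lra)) as [D [D1 [_ D3]]].
    replace (Fk j (cayley w)) with (D + (Fk j (cayley w) - D))%C by ring.
    eapply Rle_trans; [apply Cmod_triangle|].
    assert (h3 : exp (2 * sk j) <= exp (sk k / 500)) by (apply exp_le; lra).
    unfold M. lra.
  - assert (h1 := yk_lt k j Hjk).
    assert (h2 := primitive_below (sk j) (yk j) (fun w => Fk j (cayley w)) ltac:(lra) ltac:(lra)
      (Fk_cayley_derive j) (Fk_cayley_1 j) w Hx ltac:(lra)).
    cbv beta in h2. unfold M. assert (h := exp_pos (sk k / 500)). lra. }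
destruct (primitive_above (sk k) (yk k) (fun w => Fk k (cayley w)) ltac:(lra) ltac:(lra)
   (Fk_cayley_derive k) (Fk_cayley_1 k) w Hx ltac:(lra)) as [D [_ [D2 D3]]].
rewrite <- Ez in D3.
assert (hmaj := major_mono (Cmod z) (Cmod z) ltac:(split; [apply Cmod_ge_0|lra]) Hz).
(* The truncation index may depend on [z]: it is chosen to make the tail at most 1 at this point. *)
destruct (pow_lt_1_zero (1 / 2) ltac:(rewrite Rabs_pos_eq; lra) (/ major (Cmod z))
   ltac:(apply Rinv_0_lt_compat; lra)) as [J0 HJ0].
set (J := max J0 k). specialize (HJ0 J ltac:(unfold J; lia)).
rewrite Rabs_pos_eq in HJ0 by (left; apply half_pow_pos).
assert (K := primitive_approx H J z H0 H1 Hz).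
assert (K' : (1 / 2) ^ J * major (Cmod z) <= 1).
{ apply Rle_trans with (/ major (Cmod z) * major (Cmod z)).
  - apply Rmult_le_compat_r; lra.
  - rewrite Rinv_l by lra. lra. }
set (u := fun j => (RtoC ((1 / 2) ^ j) * Fk j z)%C) in *.
assert (Hmod : forall j, Cmod (RtoC ((1 / 2) ^ j)) = (1 / 2) ^ j)
  by (intros j; rewrite Cmod_R; apply Rabs_pos_eq; left; apply half_pow_pos).
assert (L := Cmod_sum_n_isolate u (fun j => (1 / 2) ^ j * M) k J ltac:(unfold J; lia)
  ltac:(intros j; assert (h := half_pow_pos j); nra)
  ltac:(intros j Hj; unfold u; rewrite Cmod_mult, Hmod;
        apply Rmult_le_compat_l; [left; apply half_pow_pos|apply Hother, Hj])).
assert (L2 : sum_n (fun j => (1 / 2) ^ j * M) J <= 2 * M).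
{ apply Rle_trans with (sum_n (fun j => M * (1 / 2) ^ j) J).
  - apply sum_n_le_R; intros; lra.
  - rewrite sum_n_scal_R, (Rmult_comm 2). apply Rmult_le_compat_l; [exact hM|].
    apply sum_n_le_series; [intros n; left; apply half_pow_pos|apply is_series_half]. }
assert (hw : Im w <= 256 * sk k ^ 2).
{ assert (h := sk_ge_index k). unfold yk in Hy.
  assert (h' : (INR k + 2) * sk k <= sk k * sk k) by (apply Rmult_le_compat_r; lra). lra. }
assert (Huk : / sk k * (exp (sk k) / (4 * sk k)) - 5 * (1 + Im w) <= Cmod (u k)).
{ unfold u. rewrite Cmod_mult, Hmod.
  assert (h1 : Cmod D - 5 * (1 + Im w) <= Cmod (Fk k z)).
  { assert (h := Cmod_triangle (Fk k z) (- (Fk k z - D))%C). rewrite Cmod_opp in h.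
    replace (Fk k z + - (Fk k z - D))%C with D in h by ring. lra. }
  (* The weight costs a factor of at most [sk k], negligible against the exponential jump. *)
  assert (h2 : / sk k <= (1 / 2) ^ k).
  { replace ((1 / 2) ^ k) with (/ 2 ^ k).
    - apply Rinv_le_contravar; [apply pow_lt; lra|apply sk_ge_pow2].
    - unfold Rdiv. rewrite Rmult_1_l. symmetry. apply pow_inv. }
  assert (h3 : (1 / 2) ^ k <= 1).
  { assert (h := pow_incr (1 / 2) 1 k ltac:(lra)). rewrite pow1 in h. exact h. }
  assert (h0 : 0 < / sk k) by (apply Rinv_0_lt_compat; lra).
  assert (h4 : 0 < exp (sk k) / (4 * sk k)) by (apply Rdiv_lt_0_compat; [apply exp_pos|lra]).
  assert (h5 : / sk k * (exp (sk k) / (4 * sk k)) <= (1 / 2) ^ k * Cmod D)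
    by (apply Rmult_le_compat; lra).
  assert (h6 := half_pow_pos k).
  assert (h7 : (1 / 2) ^ k * (Cmod D - 5 * (1 + Im w)) <= (1 / 2) ^ k * Cmod (Fk k z))
    by (apply Rmult_le_compat_l; lra).
  nra. }
assert (A := dominant_term_arith (sk k) hs).
assert (B : Cmod (sum_n u J) <= Cmod (H z) + 1).
{ replace (sum_n u J) with (H z - (H z - sum_n u J))%C by ring_C.
  eapply Rle_trans; [apply Cmod_triangle|]. rewrite Cmod_opp. lra. }
unfold M in *. lra.
Qed.

(** * Integrals over circles *)

Lemma Cmod_polar r t : 0 <= r -> Cmod (polar r t) = r.
Proof.
intros Hr. unfold polar, Cmod; simpl fst; simpl snd.
replace ((r * cos t) ^ 2 + (r * sin t) ^ 2) with (r ^ 2 * (Rsqr (sin t) + Rsqr (cos t)))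
  by (unfold Rsqr; ring).
rewrite sin2_cos2, Rmult_1_r. apply sqrt_pow2, Hr.
Qed.

Lemma in_disc_polar r t : 0 < r < 1 -> in_disc (polar r t).
Proof. intros Hr. unfold in_disc. rewrite Cmod_polar; lra. Qed.

Lemma polar_derive r t :
  is_derive (fun s => Re (polar r s)) t (Re (- (r * sin t), r * cos t)%R) /\
  is_derive (fun s => Im (polar r s)) t (Im (- (r * sin t), r * cos t)%R).
Proof. unfold polar, Re, Im; simpl; split; auto_derive; try exact I; ring. Qed.

Lemma Re_polar_continuity (f : C -> C) r t : 0 < r < 1 -> holomorphic_on_disc f ->
  continuity_pt (fun s => Re (f (polar r s))) t.
Proof.
intros Hr Hf. destruct (Hf (polar r t) (in_disc_polar r t Hr)) as [l Hl].
apply continuity_pt_filterlim, (@ex_derive_continuous R_AbsRing R_NormedModule).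
eexists. eapply is_derive_ext; [|apply (is_derive_along_path f (polar r) t l (- (r * sin t), r * cos t)%R (RtoC 1) Hl);
  apply polar_derive].
intros s. cbv beta. rewrite Cmult_1_l. reflexivity.
Qed.

Lemma Im_polar_continuity (f : C -> C) r t : 0 < r < 1 -> holomorphic_on_disc f ->
  continuity_pt (fun s => Im (f (polar r s))) t.
Proof.
intros Hr Hf. destruct (Hf (polar r t) (in_disc_polar r t Hr)) as [l Hl].
apply continuity_pt_filterlim, (@ex_derive_continuous R_AbsRing R_NormedModule).
eexists. eapply is_derive_ext; [|apply (is_derive_along_path f (polar r) t l (- (r * sin t), r * cos t)%R (- Ci)%C Hl);
  apply polar_derive].
intros s. unfold Re, Im; simpl. ring.
Qed.

(** The argument of [ln] is the maximum of 1 and [x]; this form makes continuity at the breakpoint 1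
    a matter of composition. *)
Lemma log_plus_Rmax x : log_plus x = ln ((1 + x + Rabs (x - 1)) / 2).
Proof.
unfold log_plus. destruct (Rle_dec 1 x) as [h|h].
- rewrite Rabs_pos_eq by lra. f_equal. field.
- rewrite Rabs_left by lra. replace ((1 + x + - (x - 1)) / 2) with 1 by field.
  symmetry. apply ln_1.
Qed.

Lemma log_plus_ge0 x : 0 <= log_plus x.
Proof.
unfold log_plus. destruct (Rle_dec 1 x) as [h|h]; [|lra].
rewrite <- ln_1. apply ln_le; lra.
Qed.

Lemma log_plus_continuity x : continuity_pt log_plus x.
Proof.
apply (continuity_pt_ext (fun x => ln ((1 + x + Rabs (x - 1)) / 2))).
{ intros y. symmetry. apply log_plus_Rmax. }
apply (continuity_pt_comp (fun x => (1 + x + Rabs (x - 1)) / 2) ln).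
- assert (hc : forall c, continuity_pt (fun _ => c) x)
    by (intros c; apply continuity_pt_const; intros a b; reflexivity).
  assert (hid : continuity_pt (fun x => x) x) by apply continuity_pt_id.
  apply (continuity_pt_mult (fun x => 1 + x + Rabs (x - 1)) (fun _ => / 2)); [|apply hc].
  apply (continuity_pt_plus (fun x => 1 + x) (fun x => Rabs (x - 1))).
  + apply (continuity_pt_plus (fun _ => 1) (fun x => x)); [apply hc|exact hid].
  + apply (continuity_pt_comp (fun x => x - 1) Rabs); [|apply Rcontinuity_abs].
    apply (continuity_pt_minus (fun x => x) (fun _ => 1)); [exact hid|apply hc].
- apply continuity_pt_filterlim, continuous_ln.
  assert (h := Rabs_pos (x - 1)). assert (h' := Rle_abs (- (x - 1))). rewrite Rabs_Ropp in h'.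
  destruct (Rle_dec 1 x); lra.
Qed.

Lemma log_plus_Cmod_continuity (f : C -> C) r t : 0 < r < 1 -> holomorphic_on_disc f ->
  continuity_pt (fun s => log_plus (Cmod (f (polar r s)))) t.
Proof.
intros Hr Hf.
apply (continuity_pt_comp (fun s => Cmod (f (polar r s))) log_plus); [|apply log_plus_continuity].
set (u := fun s => Re (f (polar r s))). set (v := fun s => Im (f (polar r s))).
apply (continuity_pt_ext (fun s => sqrt (u s * u s + v s * v s))).
{ intros s. unfold Cmod. f_equal. unfold u, v, Re, Im. ring. }
apply (continuity_pt_comp (fun s => u s * u s + v s * v s) sqrt).
- assert (hu : continuity_pt u t) by (apply Re_polar_continuity; assumption).
  assert (hv : continuity_pt v t) by (apply Im_polar_continuity; assumption).
  apply (continuity_pt_plus (fun s => u s * u s) (fun s => v s * v s));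
    apply continuity_pt_mult; assumption.
- apply continuity_pt_sqrt. nra.
Qed.

Lemma ex_RInt_log_plus (f : C -> C) r a b : 0 < r < 1 -> holomorphic_on_disc f ->
  ex_RInt (fun s => log_plus (Cmod (f (polar r s)))) a b.
Proof.
intros Hr Hf. apply (@ex_RInt_continuous R_CompleteNormedModule). intros t _.
apply continuity_pt_filterlim, log_plus_Cmod_continuity; assumption.
Qed.

(* Bundles integrability, since [RInt] has a junk value on functions that are not integrable. *)
Definition circle_le (f : R -> R) (B : R) : Prop :=
  ex_RInt f 0 (2 * PI) /\ RInt f 0 (2 * PI) <= B.

Lemma circle_le_plus f g B B' :
  circle_le f B -> circle_le g B' -> circle_le (fun t => f t + g t) (B + B').
Proof.
intros [H1 H2] [K1 K2]. split.
- apply (@ex_RInt_plus R_NormedModule f g); assumption.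
- assert (E := @RInt_plus R_CompleteNormedModule f g 0 (2 * PI) H1 K1).
  change (RInt (fun t => f t + g t) 0 (2 * PI) = RInt f 0 (2 * PI) + RInt g 0 (2 * PI)) in E.
  rewrite E. lra.
Qed.

Lemma circle_le_scal c f B : 0 <= c -> circle_le f B -> circle_le (fun t => c * f t) (c * B).
Proof.
intros Hc [H1 H2]. split.
- apply (@ex_RInt_scal R_NormedModule f); assumption.
- assert (E := @RInt_scal R_CompleteNormedModule f 0 (2 * PI) c H1).
  change (RInt (fun t => c * f t) 0 (2 * PI) = c * RInt f 0 (2 * PI)) in E.
  rewrite E. apply Rmult_le_compat_l; assumption.
Qed.

Lemma circle_le_const c : circle_le (fun _ => c) (2 * PI * c).
Proof.
split; [apply ex_RInt_const|]. rewrite RInt_const.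
change ((2 * PI - 0) * c <= 2 * PI * c). lra.
Qed.

Lemma circle_le_mono f g B :
  ex_RInt f 0 (2 * PI) -> (forall t, f t <= g t) -> circle_le g B -> circle_le f B.
Proof.
intros Hf Hfg [H1 H2]. split; [exact Hf|].
eapply Rle_trans; [|exact H2]. assert (h := PI_RGT_0).
apply RInt_le; [lra|exact Hf|exact H1|intros; apply Hfg].
Qed.

Lemma circle_le_ext f g B : (forall t, f t = g t) -> circle_le f B -> circle_le g B.
Proof.
intros E [H1 H2]. split.
- eapply ex_RInt_ext; [|exact H1]. intros; apply E.
- rewrite <- (RInt_ext f g); [exact H2|intros; apply E].
Qed.

Lemma polar_pow r t n : (polar r t ^ n)%C = polar (r ^ n) (INR n * t).
Proof.
induction n as [|n IH].
- unfold polar. simpl. rewrite Rmult_0_l, cos_0, sin_0. unfold RtoC. f_equal; ring.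
- rewrite Cpow_S, IH, S_INR, Rmult_plus_distr_r, Rmult_1_l.
  unfold polar, Cmult; simpl. rewrite cos_plus, sin_plus. f_equal; ring.
Qed.

(** The exponent [S n] excludes the constant term, the one power whose mean does not vanish; the
    frequency [m] can then be divided out in the antiderivative [P]. *)
Lemma circle_le_harmonic (c : C) r n : circle_le (fun t => Re (c * polar r t ^ S n)%C) 0.
Proof.
set (m := INR (S n)). assert (hm : m <> 0) by (apply not_0_INR; lia).
set (rho := r ^ S n).
set (P := fun t => (Re c * rho * sin (m * t) + Im c * rho * cos (m * t)) / m).
assert (H : is_RInt (fun t => Re c * rho * cos (m * t) - Im c * rho * sin (m * t)) 0 (2 * PI)
   (minus (P (2 * PI)) (P 0))).
{ apply (@is_RInt_derive R_CompleteNormedModule P).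
  - intros t _. unfold P. auto_derive; [exact I|]. field. exact hm.
  - intros t _. apply (@ex_derive_continuous R_AbsRing R_NormedModule). auto_derive. exact I. }
assert (E : @minus R_AbelianGroup (P (2 * PI)) (P 0) = 0).
{ change (P (2 * PI) - P 0 = 0). unfold P.
  replace (m * (2 * PI)) with (0 + 2 * m * PI) by ring. unfold m at 1 2.
  rewrite sin_period, cos_period, Rmult_0_r. field. exact hm. }
assert (H' : is_RInt (fun t => Re c * rho * cos (m * t) - Im c * rho * sin (m * t)) 0 (2 * PI) 0)
  by (rewrite E in H; exact H).
apply (circle_le_ext (fun t => Re c * rho * cos (m * t) - Im c * rho * sin (m * t))).
- intros t. rewrite polar_pow. fold m rho. unfold polar, Re, Im; simpl. ring.
- split; [eexists; exact H'|]. right. exact (is_RInt_unique _ _ _ _ H').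
Qed.

Lemma circle_le_geom_sum om r N :
  circle_le (fun t => Re (sum_n (fun n => (om * polar r t) ^ n)%C N)) (2 * PI).
Proof.
induction N as [|N IH].
- apply (circle_le_ext (fun _ => 1)).
  + intros t. rewrite sum_O. reflexivity.
  + replace (2 * PI) with (2 * PI * 1) by ring. apply circle_le_const.
- apply (circle_le_ext (fun t => Re (sum_n (fun n => (om * polar r t) ^ n)%C N)
     + Re (om ^ S N * polar r t ^ S N)%C)).
  + intros t. rewrite sum_n_SC, Cpow_mult_l. reflexivity.
  + replace (2 * PI) with (2 * PI + 0) by ring. apply circle_le_plus; [exact IH|].
    apply circle_le_harmonic.
Qed.

Lemma herglotz_holomorphic om : Cmod om <= 1 -> holomorphic_on_disc (fun z => herglotz (om * z)%C).
Proof. intros H. eapply majorized_holomorphic, majorized_herglotz, H. Qed.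

(** The exact value is [2 * PI]; giving up a factor 2 avoids a limit under the integral. With [N]
    large the kernel is twice a partial geometric sum, minus 1, plus a remainder of real part at
    most 1, so it lies below twice the partial sum. *)
Lemma circle_le_herglotz om r : Cmod om <= 1 -> 0 < r < 1 ->
  circle_le (fun t => Re (herglotz (om * polar r t)%C)) (4 * PI).
Proof.
intros Hom Hr.
destruct (pow_lt_1_zero r ltac:(rewrite Rabs_pos_eq; lra) ((1 - r) / 2) ltac:(lra)) as [N HN].
specialize (HN (S N) ltac:(lia)). rewrite Rabs_pos_eq in HN by (apply pow_le; lra).
apply (circle_le_mono _ (fun t => 2 * Re (sum_n (fun n => (om * polar r t) ^ n)%C N))).
- apply (@ex_RInt_continuous R_CompleteNormedModule). intros t _. apply continuity_pt_filterlim.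
  apply (Re_polar_continuity (fun z => herglotz (om * z)%C)); [exact Hr|].
  apply herglotz_holomorphic, Hom.
- intros t. set (q := (om * polar r t)%C).
  assert (Hq : in_disc q) by (apply in_disc_mult; [exact Hom|apply in_disc_polar, Hr]).
  assert (hne := one_minus_neq0 q Hq).
  assert (E : herglotz q = (2 * sum_n (fun n => q ^ n) N + (- (1) + 2 * (q ^ S N / (1 - q))))%C).
  { assert (h := sum_n_C_geom q N hne).
    replace (sum_n (fun n => q ^ n)%C N) with (/ (1 - q) + - (q ^ S N) / (1 - q))%C
      by (rewrite <- h; ring_C).
    unfold herglotz. field. exact hne. }
  assert (Hqr : Cmod q <= r).
  { unfold q. rewrite Cmod_mult, Cmod_polar by lra. assert (h := Cmod_ge_0 om). nra. }
  assert (B : Re (q ^ S N / (1 - q))%C <= 1 / 2).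
  { eapply Rle_trans; [apply Cmod_ge_Re|]. rewrite Cmod_div, Cmod_pow by exact hne.
    assert (h1 : Cmod q ^ S N <= r ^ S N) by (apply pow_incr; split; [apply Cmod_ge_0|exact Hqr]).
    assert (h2 : 1 - r <= Cmod (1 - q)%C).
    { assert (h := Cmod_triangle (1 - q)%C q). replace (1 - q + q)%C with (RtoC 1) in h by ring.
      rewrite Cmod_1 in h. lra. }
    apply (Rmult_le_reg_r (Cmod (1 - q)%C)); [lra|]. unfold Rdiv at 1.
    rewrite Rmult_assoc, Rinv_l by lra. lra. }
  rewrite E. unfold Re in *. simpl in *. lra.
- replace (4 * PI) with (2 * (2 * PI)) by ring. apply circle_le_scal; [lra|].
  apply circle_le_geom_sum.
Qed.

(** * The harmonic majorant of the witness *)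

Definition atom (k : nat) : R := atom_mass (sk k) (yk k).
Definition dir (k : nat) : C := atom_dir (yk k).

(** The Poisson integral of a unit mass at the boundary point 1, which is infinity in the
    half-plane, and of the atoms of index at most [J]. Truncation leaves finite sums to
    integrate. *)
Definition potential (J : nat) (z : C) : R :=
  Re (herglotz z) + sum_n (fun j => atom j * Re (herglotz (dir j * z)%C)) J.

(** The mass is at most [1 / (k + 2) ^ 2]; the telescoping bound keeps the total mass of any number
    of atoms below 1. *)
Lemma atom_bounds k : 0 <= atom k <= / (INR k + 1) - / (INR k + 2).
Proof.
split; [apply atom_mass_bounds, sk_yk|]. unfold atom, atom_mass.
assert (h := sk_ge k). assert (h' := pos_INR k). set (n := INR k) in *.
apply Rle_trans with (/ (n + 2) ^ 2).
- apply (Rmult_le_reg_r (1 + yk k ^ 2)); [nra|]. unfold Rdiv.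
  rewrite Rmult_assoc, Rinv_l by nra. unfold yk. fold n.
  replace (/ (n + 2) ^ 2 * (1 + ((n + 2) * sk k) ^ 2)) with (/ (n + 2) ^ 2 + sk k ^ 2) by (field; lra).
  assert (0 < / (n + 2) ^ 2) by (apply Rinv_0_lt_compat; nra). lra.
- replace (/ (n + 1) - / (n + 2)) with (/ ((n + 1) * (n + 2))) by (field; lra).
  apply Rinv_le_contravar; nra.
Qed.

Lemma Re_herglotz_dir_ge0 k z : in_disc z -> 0 <= Re (herglotz (dir k * z)%C).
Proof.
intros Hz. apply Re_herglotz_ge0, in_disc_mult; [|exact Hz].
unfold dir. rewrite Cmod_atom_dir. lra.
Qed.

Lemma potential_ge0 J z : in_disc z -> 0 <= potential J z.
Proof.
intros Hz. unfold potential. assert (h := Re_herglotz_ge0 z Hz).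
assert (h' : 0 <= sum_n (fun j => atom j * Re (herglotz (dir j * z)%C)) J).
{ apply sum_n_ge0. intros n. apply Rmult_le_pos; [apply atom_bounds|apply Re_herglotz_dir_ge0, Hz]. }
lra.
Qed.

Lemma circle_le_potential J r : 0 < r < 1 ->
  circle_le (fun t => potential J (polar r t)) (8 * PI).
Proof.
intros Hr. replace (8 * PI) with (4 * PI + 4 * PI) by ring. unfold potential.
assert (hpi := PI_RGT_0).
apply (circle_le_plus (fun t => Re (herglotz (polar r t)))).
- apply (circle_le_ext (fun t => Re (herglotz (RtoC 1 * polar r t)%C))).
  + intros t. rewrite Cmult_1_l. reflexivity.
  + apply circle_le_herglotz; [rewrite Cmod_1; lra|exact Hr].
- assert (H : circle_le (fun t => sum_n (fun j => atom j * Re (herglotz (dir j * polar r t)%C)) J)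
     ((1 - / (INR J + 2)) * (4 * PI))).
  { assert (Hd : forall j, circle_le (fun t => atom j * Re (herglotz (dir j * polar r t)%C))
        ((/ (INR j + 1) - / (INR j + 2)) * (4 * PI))).
    { intros j. assert (hb := atom_bounds j).
      assert (K : circle_le (fun t => atom j * Re (herglotz (dir j * polar r t)%C)) (atom j * (4 * PI))).
      { apply circle_le_scal; [apply atom_bounds|]. apply circle_le_herglotz; [|exact Hr].
        unfold dir. rewrite Cmod_atom_dir. lra. }
      destruct K as [K1 K2]. split; [exact K1|]. nra. }
    induction J as [|J IH].
    - apply (circle_le_ext (fun t => atom 0 * Re (herglotz (dir 0 * polar r t)%C))).
      + intros t. rewrite sum_O. reflexivity.
      + assert (K := Hd O). simpl INR in *.
        replace (1 - / (0 + 2)) with (/ (0 + 1) - / (0 + 2)) by field. exact K.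
    - apply (circle_le_ext (fun t => sum_n (fun j => atom j * Re (herglotz (dir j * polar r t)%C)) J
         + atom (S J) * Re (herglotz (dir (S J) * polar r t)%C))).
      + intros t. rewrite sum_n_SR. reflexivity.
      + assert (K := Hd (S J)). assert (hJ := pos_INR J).
        replace ((1 - / (INR (S J) + 2)) * (4 * PI)) with
          ((1 - / (INR J + 2)) * (4 * PI) + (/ (INR (S J) + 1) - / (INR (S J) + 2)) * (4 * PI))
          by (rewrite S_INR; field; lra).
        apply circle_le_plus; assumption. }
  destruct H as [H1 H2]. split; [exact H1|].
  assert (h : 0 < / (INR J + 2)) by (apply Rinv_0_lt_compat; assert (h := pos_INR J); lra). nra.
Qed.

Lemma hk_weighted_bound k J z : (k <= J)%nat -> in_disc z ->
  Cmod ((1 - z) * hk k z)%C <= (1 / 2) ^ k * exp (potential J z).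
Proof.
intros Hk Hz. unfold hk. rewrite !Cmod_mult, Cmod_R, Rabs_pos_eq by (left; apply half_pow_pos).
assert (hs := sk_ge k). assert (hy := yk_ge k). assert (hi := sk_ge_index k).
assert (h := hker_weighted_bound (sk k) (yk k) z ltac:(lra) ltac:(lra) Hz).
assert (hp := half_pow_pos k).
assert (B : (1 + sk k + yk k) / (2 * sk k ^ 2) <= 1).
{ apply (Rmult_le_reg_r (2 * sk k ^ 2)); [nra|]. unfold Rdiv.
  rewrite Rmult_assoc, Rinv_l by nra. unfold yk. nra. }
assert (E : exp (Re (herglotz z) + atom_mass (sk k) (yk k) * Re (herglotz (atom_dir (yk k) * z)))
   <= exp (potential J z)).
{ apply exp_le. unfold potential. apply Rplus_le_compat_l.
  set (b := fun j => atom j * Re (herglotz (dir j * z)%C)).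
  assert (Hb : forall j, 0 <= b j)
    by (intros j; apply Rmult_le_pos; [apply atom_bounds|apply Re_herglotz_dir_ge0, Hz]).
  change (b k <= sum_n b J).
  eapply Rle_trans; [|apply (sum_n_mono b k J Hb Hk)].
  destruct k; [rewrite sum_O; lra|]. rewrite sum_n_SR. assert (h0 := sum_n_ge0 b k Hb). lra. }
set (e1 := exp _) in h, E. assert (he : 0 < e1) by apply exp_pos.
assert (h2 : Cmod (1 - z)%C * Cmod (hker (sk k) (yk k) z) <= exp (potential J z)) by nra.
assert (h3 := Rmult_le_compat_l _ _ _ (Rlt_le _ _ hp) h2). lra.
Qed.

(** The weighted kernels up to [J] give twice the exponential. The tail, at most 1/2, times
    [Cmod (1 - z) <= 2] gives one more, as the potential is nonnegative. That [J] depends on [r] is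
    harmless, since the integral bound in [circle_le_potential] is independent of [J]. *)
Lemma witness_bound r : 0 < r < 1 ->
  exists J, forall z, Cmod z = r -> Cmod (witness z) <= 3 * exp (potential J z).
Proof.
intros Hr. assert (hm := major_mono r r ltac:(lra) ltac:(lra)).
destruct (pow_lt_1_zero (1 / 2) ltac:(rewrite Rabs_pos_eq; lra) (/ (2 * major r))
   ltac:(apply Rinv_0_lt_compat; lra)) as [J HJ].
exists J. intros z Hzr. assert (Hz : in_disc z) by (unfold in_disc; lra).
specialize (HJ J (le_n _)). rewrite Rabs_pos_eq in HJ by (left; apply half_pow_pos).
assert (T := Gsum_tail J z r Hz ltac:(lra)).
assert (T' : (1 / 2) ^ J * major r <= 1 / 2).
{ apply Rle_trans with (/ (2 * major r) * major r); [apply Rmult_le_compat_r; lra|].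
  right. field. lra. }
assert (h1 : Cmod (1 - z)%C <= 2).
{ unfold Cminus. eapply Rle_trans; [apply Cmod_triangle|]. rewrite Cmod_opp, Cmod_1. lra. }
set (S := sum_n (fun k => hk k z) J) in *.
assert (E : witness z = (sum_n (fun k => (1 - z) * hk k z)%C J + (1 - z) * (Gsum z - S))%C).
{ rewrite sum_n_scal_C. fold S. unfold witness. ring. }
rewrite E. eapply Rle_trans; [apply Cmod_triangle|]. rewrite (Cmod_mult (1 - z)%C (Gsum z - S)%C).
assert (h2 : 1 <= exp (potential J z)).
{ rewrite <- exp_0 at 1. apply exp_le, potential_ge0, Hz. }
assert (h3 : Cmod (sum_n (fun k => (1 - z) * hk k z)%C J) <= exp (potential J z) * 2).
{ apply Rle_trans with (sum_n (fun k => exp (potential J z) * (1 / 2) ^ k) J).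
  - apply Cmod_sum_n_le. intros k Hk. rewrite Rmult_comm. apply hk_weighted_bound; assumption.
  - rewrite sum_n_scal_R. apply Rmult_le_compat_l; [lra|].
    apply sum_n_le_series; [intros n; left; apply half_pow_pos|apply is_series_half]. }
assert (h4 := Cmod_ge_0 (Gsum z - S)%C). assert (h5 := Cmod_ge_0 (1 - z)%C). nra.
Qed.

Lemma witness_Nevanlinna : Nevanlinna witness.
Proof.
destruct witness_majorized as [B HB].
assert (Hhol := majorized_holomorphic _ _ HB). split; [exact Hhol|].
exists (2 * PI * ln 3 + 8 * PI). intros I0 [r [Hr ->]].
destruct (witness_bound r Hr) as [J HJ].
assert (K : circle_le (fun t => log_plus (Cmod (witness (polar r t)))) (2 * PI * ln 3 + 8 * PI)).
{ apply (circle_le_mono _ (fun t => ln 3 + potential J (polar r t))).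
  - apply ex_RInt_log_plus; assumption.
  - intros t. assert (h := HJ (polar r t) (Cmod_polar r t ltac:(lra))).
    assert (h' := potential_ge0 J _ (in_disc_polar r t Hr)).
    assert (h3 : 0 < ln 3) by (rewrite <- ln_1; apply ln_increasing; lra).
    unfold log_plus. destruct (Rle_dec 1 _) as [h1|h1]; [|lra].
    rewrite <- (ln_exp (potential J (polar r t))), <- ln_mult by (try apply exp_pos; lra).
    apply ln_le; [lra|exact h].
  - apply circle_le_plus; [apply circle_le_const|apply circle_le_potential, Hr]. }
apply K.
Qed.

(** * Divergence of the means of the primitive *)

Lemma sin_bounds t : 0 < t <= 1 -> t / 2 <= sin t <= t.
Proof.
intros Ht. split; [|left; apply sin_lt_x; lra].
destruct (MVT_gen sin 0 t cos) as [c [Hc E]].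
- intros x _. apply is_derive_Reals, derivable_pt_lim_sin.
- intros x _. apply continuity_sin.
- rewrite Rmin_left, Rmax_right in Hc by lra. rewrite sin_0 in E.
  assert (h : 1 / 2 <= cos c).
  { eapply Rle_trans; [apply cos_1_ge|]. assert (h := PI2_3_2). unfold PI2 in h.
    destruct (Req_dec c 1) as [->|hc]; [lra|]. left. apply cos_decreasing_1; lra. }
  nra.
Qed.

Lemma one_minus_polar_sqr r t : 0 < t <= 1 -> 1 / 2 <= r < 1 -> 1 - r <= t ->
  t ^ 2 / 8 <= Cmod (1 - polar r t)%C ^ 2 <= 2 * t ^ 2.
Proof.
intros Ht Hr Hrt. assert (E : Cmod (1 - polar r t)%C ^ 2 = (1 - r) ^ 2 + 4 * r * sin (t / 2) ^ 2).
{ rewrite Cmod_sqr. unfold polar; simpl.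
  replace t with (2 * (t / 2)) at 1 2 3 4 by field. rewrite cos_2a_sin, sin_2a.
  assert (h := sin2_cos2 (t / 2)). unfold Rsqr in h.
  set (sn := sin (t / 2)) in *. set (c := cos (t / 2)) in *.
  assert (h' : c * c = 1 - sn * sn) by lra.
  replace ((1 + - (r * (1 - 2 * sn * sn))) * ((1 + - (r * (1 - 2 * sn * sn))) * 1) +
    (0 + - (r * (2 * sn * c))) * ((0 + - (r * (2 * sn * c))) * 1))
    with ((1 - r * (1 - 2 * (sn * sn))) * (1 - r * (1 - 2 * (sn * sn))) +
       4 * r * r * (sn * sn) * (c * c)) by ring.
  rewrite h'. ring. }
rewrite E. assert (h := sin_bounds (t / 2) ltac:(lra)). set (sn := sin (t / 2)) in *.
assert (h1 : (t / 4) ^ 2 <= sn ^ 2 <= (t / 2) ^ 2) by (split; apply pow_incr; lra).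
assert (h2 : (1 - r) ^ 2 <= t ^ 2) by (apply pow_incr; lra).
assert (h3 := pow2_ge_0 (1 - r)). split; nra.
Qed.

Lemma Rdiv_mult_cancel x d : d <> 0 -> x / d * d = x.
Proof. intros H. field. exact H. Qed.

(** Near the boundary point 1 the half-plane coordinate of [polar r t] is about [2 i / t], so this
    window of [t] corresponds to heights of about [16 * yk k] to [32 * yk k]; the factor 8 on either
    side absorbs the crude estimates. The condition [1 - r <= t ^ 2 / 16] keeps the real part, at
    most [2 (1 - r) * 8 / t ^ 2], below 1. *)
Lemma herglotz_polar_region k r t :
  / (16 * yk k) <= t <= / (8 * yk k) -> 1 / 2 <= r < 1 -> 1 - r <= t ^ 2 / 16 ->
  0 < Re (herglotz (polar r t)) <= 1 /\ 2 * yk k <= Im (herglotz (polar r t)) <= 256 * yk k.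
Proof.
intros Ht Hr Hrt. assert (hy := yk_ge k). assert (hs := sk_ge k). set (y := yk k) in *.
assert (h0 : 0 < / (16 * y)) by (apply Rinv_0_lt_compat; lra).
assert (h1 : / (8 * y) <= 1) by (apply Rinv_ge_1; lra).
assert (Ht1 : 0 < t <= 1) by lra.
assert (Hz := in_disc_polar r t ltac:(lra)).
assert (B := one_minus_polar_sqr r t Ht1 Hr ltac:(nra)).
assert (hp := proj1 (Cmod_gt_0 _) (one_minus_neq0 _ Hz)).
assert (EI : Im (herglotz (polar r t)) = 2 * r * sin t / Cmod (1 - polar r t)%C ^ 2).
{ assert (hd : 0 < Cmod (1 - polar r t)%C ^ 2) by (apply pow_lt, hp).
  rewrite !Cmod_sqr in *. unfold herglotz, polar in *.
  unfold Cdiv, Cinv, Cmult, Cplus, Cminus, Copp, Im, RtoC in *; simpl in *. field. lra. }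
rewrite Re_herglotz by exact Hz. rewrite EI, Cmod_polar by lra.
set (D := Cmod (1 - polar r t)%C ^ 2) in *.
assert (hD : 0 < D) by nra.
assert (hsin := sin_bounds t Ht1).
assert (hty1 : 1 <= t * (16 * y)).
{ apply (Rmult_le_reg_l (/ (16 * y))); [lra|].
  replace (/ (16 * y) * (t * (16 * y))) with t by (field; lra). lra. }
assert (hty2 : t * (8 * y) <= 1).
{ apply (Rmult_le_reg_l (/ (8 * y))); [apply Rinv_0_lt_compat; lra|].
  replace (/ (8 * y) * (t * (8 * y))) with t by (field; lra). lra. }
split; split.
- apply Rdiv_lt_0_compat; nra.
- apply (Rmult_le_reg_r D); [exact hD|]. rewrite Rdiv_mult_cancel by lra. nra.
- apply (Rmult_le_reg_r D); [exact hD|]. rewrite Rdiv_mult_cancel by lra.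
  assert (a1 : 2 * y * D <= 2 * y * (2 * t ^ 2)) by (apply Rmult_le_compat_l; lra).
  assert (a2 : t * (t * (8 * y)) <= t * 1) by (apply Rmult_le_compat_l; lra).
  assert (a3 : t / 2 <= 2 * r * sin t) by nra. lra.
- apply (Rmult_le_reg_r D); [exact hD|]. rewrite Rdiv_mult_cancel by lra.
  assert (a1 : 256 * y * (t ^ 2 / 8) <= 256 * y * D) by (apply Rmult_le_compat_l; lra).
  assert (a2 : t * 1 <= t * (t * (16 * y))) by (apply Rmult_le_compat_l; lra).
  assert (a3 : 2 * r * sin t <= 2 * t) by nra. lra.
Qed.

(** Made for peeling off one window [[a, b]] at a time: the gap [[b, c]] before the next window is
    dropped by positivity. *)
Lemma RInt_lower (f : R -> R) a b c d m :
  a <= b -> b <= c -> c <= d -> ex_RInt f a d ->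
  (forall t, 0 <= f t) -> (forall t, a <= t <= b -> m <= f t) ->
  m * (b - a) + RInt f c d <= RInt f a d.
Proof.
intros hab hbc hcd He H0 Hm.
assert (eab : ex_RInt f a b) by (apply (ex_RInt_Chasles_1 f a b d); [lra|exact He]).
assert (ebd : ex_RInt f b d) by (apply (ex_RInt_Chasles_2 f a b d); [lra|exact He]).
assert (ebc : ex_RInt f b c) by (apply (ex_RInt_Chasles_1 f b c d); [lra|exact ebd]).
assert (ecd : ex_RInt f c d) by (apply (ex_RInt_Chasles_2 f b c d); [lra|exact ebd]).
assert (E1 : RInt f a b + RInt f b d = RInt f a d) by (apply (RInt_Chasles f a b d); assumption).
assert (E2 : RInt f b c + RInt f c d = RInt f b d) by (apply (RInt_Chasles f b c d); assumption).
assert (h1 : 0 <= RInt f b c) by (apply RInt_ge_0; [lra|exact ebc|intros; apply H0]).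
assert (h2 : m * (b - a) <= RInt f a b).
{ replace (m * (b - a)) with (RInt (fun _ => m) a b)
    by (rewrite RInt_const; change ((b - a) * m = m * (b - a)); ring).
  apply RInt_le; [lra|apply ex_RInt_const|exact eab|intros; apply Hm; lra]. }
lra.
Qed.

Lemma harmonic_ge_ln K : ln (INR K + 3) - ln 2 <= sum_n (fun k => / (INR k + 2)) K.
Proof.
assert (step : forall x, 0 < x -> ln (x + 1) - ln x <= / x).
{ intros x Hx. assert (h := exp_ineq1_le (/ x)).
  assert (hx : 0 < / x) by (apply Rinv_0_lt_compat, Hx).
  replace (x + 1) with (x * (1 + / x)) by (field; lra). rewrite ln_mult by lra.
  assert (h' : ln (1 + / x) <= ln (exp (/ x))) by (apply ln_le; lra).
  rewrite ln_exp in h'. lra. }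
induction K as [|K IH].
- rewrite sum_O. simpl INR. assert (h := step 2 ltac:(lra)).
  replace (0 + 3) with (2 + 1) by ring. replace (0 + 2) with 2 by ring. exact h.
- rewrite sum_n_SR, S_INR. assert (hK := pos_INR K). assert (h := step (INR K + 3) ltac:(lra)).
  replace (INR K + 1 + 3) with (INR K + 3 + 1) by ring.
  replace (INR K + 1 + 2) with (INR K + 3) by ring. lra.
Qed.

(** A single circle refutes the bound [M]: [K] is fixed first, to make the first [K + 1]
    contributions exceed [M], and then [r] is taken so close to 1 that all these windows are usable
    on the same circle. *)
Lemma cesaro_witness_not_Nevanlinna : ~ Nevanlinna (cesaro witness).
Proof.
intros [Hhol [M HM]].
assert (Hps : exists a, has_power_series a witness).
{ destruct witness_majorized as [B [a [Ha _]]]. exists a. intros z Hz.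
  exact (proj2 (is_Cpseries_equiv a z (witness z)) (Ha z Hz)). }
destruct (cesaro_primitive witness Hps) as [H [H0 H1]].
assert (HG : forall z, in_disc z -> @is_derive C_AbsRing C_NormedModule H z (Gsum z)).
{ intros z Hz. destruct (H1 z Hz) as [Hd _].
  replace (Gsum z) with (witness z / (1 - z))%C; [exact Hd|].
  unfold witness. field. apply one_minus_neq0, Hz. }
(* The contributions sum to at least [(ln (K + 3) - ln 2) / 32], which this choice makes larger than
   [M]. *)
destruct (INR_unbounded (exp (32 * M + ln 2))) as [K HK].
assert (hyK := yk_ge K). assert (hsK := sk_ge K).
set (tm := / (16 * yk K)). assert (htm : 0 < tm <= 1) by (apply Rinv_ge_1; lra).
(* [tm] is the left end of the window nearest to 0, so [1 - r <= t ^ 2 / 16] holds in every window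
   up to index [K]. *)
set (r := 1 - tm ^ 2 / 16).
assert (Hr : 1 / 2 <= r < 1) by (unfold r; nra).
set (f := fun t => log_plus (Cmod (cesaro witness (polar r t)))).
assert (Hf0 : forall t, 0 <= f t) by (intros t; apply log_plus_ge0).
assert (Hex : forall a b, ex_RInt f a b) by (intros a b; apply ex_RInt_log_plus; [lra|exact Hhol]).
assert (Hlow : forall k t, (k <= K)%nat -> / (16 * yk k) <= t <= / (8 * yk k) -> sk k / 2 <= f t).
{ intros k t Hk Ht.
  assert (hyk := yk_ge k). assert (hsk := sk_ge k).
  assert (hyy : yk k <= yk K).
  { destruct (proj1 (Nat.lt_eq_cases k K) Hk) as [h|h].
    - assert (h' := yk_lt k K h). lra.
    - rewrite h. lra. }
  assert (htm' : tm <= t).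
  { eapply Rle_trans; [|apply Ht]. apply Rinv_le_contravar; lra. }
  assert (Hz := in_disc_polar r t ltac:(lra)).
  destruct (herglotz_polar_region k r t Ht Hr) as [R1 R2].
  { unfold r. assert (tm ^ 2 <= t ^ 2) by (apply pow_incr; lra). lra. }
  assert (L := primitive_lower_bound H k (polar r t) H0 HG Hz R1 R2).
  (* As [H z = z * cesaro witness z] and [Cmod z = r < 1], passing from [H] back to [cesaro witness]
     can only increase the modulus. *)
  rewrite <- (proj2 (H1 _ Hz)), Cmod_mult, Cmod_polar in L by lra.
  set (X := Cmod (cesaro witness (polar r t))) in *. assert (hX : 0 <= X) by apply Cmod_ge_0.
  assert (hX1 : exp (sk k / 2) <= X) by nra.
  assert (he : 1 <= exp (sk k / 2)) by (rewrite <- exp_0 at 1; apply exp_le; lra).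
  unfold f, log_plus. fold X. destruct (Rle_dec 1 X) as [h|h]; [|lra].
  rewrite <- (ln_exp (sk k / 2)). apply ln_le; [apply exp_pos|exact hX1]. }
(* The windows are disjoint and move towards 0 as [k] grows, so the induction extends the interval
   of integration to the left. Window [k] has length [1 / (16 * yk k)] and the integrand there is at
   least [sk k / 2], whence the 32. *)
assert (Hsum : forall k, (k <= K)%nat ->
   sum_n (fun k => / 32 * / (INR k + 2)) k <= RInt f (/ (16 * yk k)) (2 * PI)).
{ assert (hpi := PI2_3_2). unfold PI2 in hpi.
  assert (Hgain : forall k, sk k / 2 * (/ (8 * yk k) - / (16 * yk k)) = / 32 * / (INR k + 2)).
  { intros k. unfold yk. assert (hsk := sk_ge k). assert (h := pos_INR k). field. lra. }
  assert (H816 : forall k, 0 < / (16 * yk k) <= / (8 * yk k) /\ / (8 * yk k) <= 1).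
  { intros k. assert (hyk := yk_ge k). assert (hsk := sk_ge k). split; [split|].
    - apply Rinv_0_lt_compat; lra.
    - apply Rinv_le_contravar; lra.
    - apply Rinv_ge_1; lra. }
  induction k as [|k IH]; intros Hk.
  - rewrite sum_O. destruct (H816 O) as [[q1 q2] q3].
    assert (h := RInt_lower f (/ (16 * yk 0)) (/ (8 * yk 0)) (2 * PI) (2 * PI) (sk 0 / 2)
      q2 ltac:(lra) ltac:(lra) (Hex _ _) Hf0 (fun t => Hlow O t Hk)).
    rewrite RInt_point in h. change (@zero R_CompleteNormedModule) with 0 in h.
    rewrite Hgain in h. lra.
  - rewrite sum_n_SR. destruct (H816 (S k)) as [[q1 q2] q3]. destruct (H816 k) as [[p1 p2] p3].
    assert (hyk := yk_ge k). assert (hsk := sk_ge k).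
    assert (hyS := yk_lt k (S k) (Nat.lt_succ_diag_r k)).
    assert (hmid : / (8 * yk (S k)) <= / (16 * yk k)) by (apply Rinv_le_contravar; lra).
    assert (h := RInt_lower f (/ (16 * yk (S k))) (/ (8 * yk (S k))) (/ (16 * yk k)) (2 * PI) (sk (S k) / 2)
      q2 hmid ltac:(lra) (Hex _ _) Hf0 (fun t => Hlow (S k) t Hk)).
    rewrite Hgain in h. specialize (IH ltac:(lia)). lra. }
assert (Hfin := Hsum K (le_n _)). rewrite sum_n_scal_R in Hfin.
assert (Hharm := harmonic_ge_ln K).
assert (Hln : 32 * M + ln 2 < ln (INR K + 3)).
{ rewrite <- (ln_exp (32 * M + ln 2)). apply ln_increasing; [apply exp_pos|lra]. }
assert (hpi := PI2_3_2). unfold PI2 in hpi.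
assert (htot := RInt_lower f 0 0 tm (2 * PI) 0 ltac:(lra) ltac:(lra) ltac:(lra) (Hex _ _) Hf0
   ltac:(intros t _; apply Hf0)).
assert (Hbound : RInt f 0 (2 * PI) <= M) by (apply HM; exists r; split; [lra|reflexivity]).
fold tm in Hfin. lra.
Qed.

Theorem mainTheorem1 :
  exists g : C -> C, Nevanlinna g /\ ~ Nevanlinna (cesaro g).
Proof.
exists witness. split; [exact witness_Nevanlinna|exact cesaro_witness_not_Nevanlinna].
Qed.
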